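(* Let $\psi\in\mathsf{SC}$. If $\psi(\tfrac12)<c_*$, then the minimization problem (M), $\min_{v\in M_{\rm sym}}\mathcal{W}(v)$, has a unique solution $u$; in addition $u\in C^2([0,1])$ and the third derivative of $u$ belongs to $BV(0,1)$, while $u\notin C^3([0,1])$. On the other hand, if $\psi(\tfrac12)\ge c_*$, then problem (M) has no solution.
   Context: $\mathsf{SC}$ denotes the class of functions $\psi:[0,1]\to\mathbb{R}$ such that (i) $\psi(x)=\psi(1-x)$ for $x\in[0,1]$; (ii) $\psi(0)<0$, $\psi(\tfrac12)>0$ and $\psi(x)=(1-2x)\psi(0)+2x\,\psi(\tfrac12)$ for $0\le x\le\tfrac12$. $H(0,1):=H^2(0,1)\cap H^1_0(0,1)$ (Sobolev spaces of real-valued functions), and $$M_{\rm sym}:=\{v\in H(0,1) : v\ge\psi \text{ in } [0,1],\ v(x)=v(1-x)\text{ for }0\le x\le\tfrac12\}.$$ The elastic energy is $$\mathcal{W}(u):=\int_0^1\left(\frac{u''(x)}{(1+u'(x)^2)^{3/2}}\right)^2\sqrt{1+u'(x)^2}\,dx .$$ A solution of (M) is a function $u\in M_{\rm sym}$ attaining $\inf_{v\in M_{\rm sym}}\mathcal{W}(v)$. $c_*:=2/c_0$, where $c_0:=\int_{\mathbb{R}}(1+t^2)^{-5/4}\,dt$. *)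

(* Defs.v *)
From HB Require Import structures.
From mathcomp Require Import all_boot all_order all_algebra.
From mathcomp Require Import all_classical all_reals all_analysis.

Set Implicit Arguments.
Unset Strict Implicit.
Unset Printing Implicit Defensive.

Import Order.TTheory GRing.Theory Num.Theory.
Import numFieldNormedType.Exports.

Local Open Scope classical_set_scope.
Local Open Scope ring_scope.

(* Functions on [0,1] or (0,1) are functions R -> R; every definition below
   depends only on their values there (the test functions excepted, which are
   extended by zero).

   Sobolev spaces follow Brezis, Functional Analysis, Sobolev Spaces and PDE,
   Chapter 8: weak derivatives are tested against C^1_c(0,1), and H^1_0 is the
   closure of C^1_c(0,1) in H^1. *)
Section OneDimensionalSpaces.
Variable R : realType.
Implicit Types (u g phi : R -> R) (k : nat).

Local Notation mu := (@lebesgue_measure R).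
Local Notation I01 := (`]0, 1[%classic : set R).

Definition test_function phi : Prop :=
  [/\ forall x, derivable phi x 1, continuous (derive1 phi) &
      exists K : set R,
        [/\ compact K, K `<=` I01 & forall x, ~ K x -> phi x = 0]].

Definition is_weak_deriv u g : Prop :=
  [/\ locally_integrable I01 u, locally_integrable I01 g &
      forall phi, test_function phi ->
        \int[mu]_(x in I01) (u x * derive1 phi x) =
        - \int[mu]_(x in I01) (g x * phi x)].

Fixpoint is_weak_derivn k u g : Prop :=
  if k is k'.+1 then exists2 v, is_weak_deriv u v & is_weak_derivn k' v g
  else {ae mu, forall x, I01 x -> u x = g x}.

Definition L2 u : Prop := u \_ I01 \in Lfun mu 2%:E.

Fixpoint Hsob k u : Prop :=
  if k is k'.+1 then L2 u /\ (exists2 g, is_weak_deriv u g & Hsob k' g)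
  else L2 u.

Definition H10 u : Prop :=
  L2 u /\
  exists g, [/\ is_weak_deriv u g, L2 g &
    forall e : R, 0 < e -> exists2 phi, test_function phi &
      ('N[mu]_2%:E[EFin \o ((u \- phi)%R \_ I01)] +
       'N[mu]_2%:E[EFin \o ((g \- derive1 phi)%R \_ I01)] < e%:E)%E].

(* The value of wderiv u is determined almost everywhere on (0,1) when u is
   weakly differentiable; otherwise it is the zero function. *)
Definition wderiv u : R -> R := xget (cst 0) [set g | is_weak_deriv u g].

(* BV(0,1) through the variation sup { \int g phi' : |phi| <= 1 }. *)
Definition BV01 g : Prop :=
  mu.-integrable I01 (EFin \o g) /\
  exists C : R, forall phi, test_function phi -> (forall x, `|phi x| <= 1) ->
    \int[mu]_(x in I01) (g x * derive1 phi x) <= C.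

(* C^k([0,1]): the derivatives up to order k exist in (0,1) and extend
   continuously to [0,1]. *)
Fixpoint Ck01 k u : Prop :=
  {within `[0, 1], continuous u} /\
  (if k is k'.+1 then
     exists2 g, (forall x, I01 x -> is_derive x 1 u (g x)) & Ck01 k' g
   else True).

End OneDimensionalSpaces.

Section ObstacleProblem.
Variable R : realType.
Implicit Types (u v psi : R -> R).

Local Notation mu := (@lebesgue_measure R).
Local Notation I01 := (`]0, 1[%classic : set R).

Definition SC psi : Prop :=
  [/\ forall x : R, 0 <= x <= 1 -> psi x = psi (1 - x),
      psi 0 < 0, 0 < psi (1 / 2) &
      forall x : R, 0 <= x <= 1 / 2 ->
        psi x = (1 - 2 * x) * psi 0 + 2 * x * psi (1 / 2)].

Definition elastic_energy u : \bar R :=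
  (\int[mu]_(x in I01)
     ((wderiv (wderiv u) x / (1 + wderiv u x ^+ 2) `^ (3 / 2)) ^+ 2
      * Num.sqrt (1 + wderiv u x ^+ 2))%:E)%E.

(* Elements of H^2(0,1) are taken to be their continuous representatives, so
   that the pointwise constraints make sense. *)
Definition Msym psi : set (R -> R) :=
  [set v : R -> R | [/\ {within `[0, 1], continuous v}, Hsob 2 v, H10 v,
     forall x : R, 0 <= x <= 1 -> psi x <= v x &
     forall x : R, 0 <= x <= 1 / 2 -> v x = v (1 - x)]].

Definition is_solution psi u : Prop :=
  Msym psi u /\
  elastic_energy u = ereal_inf [set elastic_energy v | v in Msym psi].

Definition c_0 : R := \int[mu]_t ((1 + t ^+ 2) `^ (- (5 / 4))).

Definition c_star : R := 2 / c_0.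

End ObstacleProblem.

Arguments c_0 R : clear implicits.
Arguments c_star R : clear implicits.

(* Main.v *)
Require Import Defs.
From mathcomp Require Import all_boot all_order all_algebra.
From mathcomp Require Import all_classical all_reals all_analysis.
From mathcomp Require Import measurable_realfun.
From mathcomp Require Import ring lra.
Import Order.TTheory GRing.Theory Num.Theory.
Import numFieldNormedType.Exports.
Local Open Scope classical_set_scope.
Local Open Scope ring_scope.
Set Implicit Arguments.
Unset Strict Implicit.
Unset Printing Implicit Defensive.

(** Write [h] for the height of the obstacle at the midpoint, [J z] for the
    integral of [sqrt sin] from [0] to [z], and
    [E phi = J phi ^ 2 / (sin phi / 2 - h cos phi)].

    The energy of a competitor [v] is at least [E phi1 + E phi2] for some angles
    [phi1], [phi2] between [atan (2 h)] and [pi / 2], one for each half of the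
    interval. Let [P] be the slope and [f = P'] on the left half. By symmetry [P]
    vanishes at the midpoint, and since [v] vanishes at [0] and passes above the
    tip of the obstacle, the integral of [P] is at least [h]; this is the only
    way in which the obstacle enters. If [tan phi] is the largest slope, then,
    [sin phi - P cos phi] being [sqrt (1 + P ^ 2) sin (phi - atan P)], completing
    a square gives, for every [M],
      [f ^ 2 (1 + P ^ 2) ^ (- 5 / 2) + M ^ 2 (sin phi - P cos phi)
         >= 2 M |f| sqrt (sin (phi - atan P)) / (1 + P ^ 2)].
    The right-hand side is, up to sign, [2 M] times the derivative of
    [J (phi - atan P)], so it contributes at least [2 M J phi] between the point
    of largest slope and the midpoint. The best [M] gives [E phi]. This is
    [energy_lower_bound] and [half_energy]; the square is kept in the bound,
    because its vanishing is what uniqueness rests on. The chain rule used here,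
    [primitive_chain], and the description of H^2 by iterated primitives,
    [H2_repr], are proved for this purpose.

    Conversely, let [x phi] and [y phi] be the width and the height of the arc of
    the rectangular elastica from an inflection point, where its tangent makes
    the angle [phi] with the horizontal, to its top. If [y phi <= 2 h (x phi)],
    then a segment of slope [tan phi] followed by a suitable multiple of this arc
    reaches height [h] at the midpoint. Extended by symmetry, it is a competitor
    of energy exactly [2 E phi] ([elastica_competitor]); the segment disappears
    exactly when [y phi = 2 h (x phi)].

    The derivative of [E] has the sign of [y phi - 2 h (x phi)], and the slope
    [y / x] increases up to its value [2 / J (pi / 2) = 2 c_star R] at [pi / 2].
    So if [h < c_star R], then [E] is least at one critical angle only, and the
    arc for this angle is a minimizer. If [c_star R <= h], then [E] decreases
    strictly on the whole range and every [phi] gives a competitor, so every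
    competitor is beaten by another one.

    Uniqueness: for a minimizer both angles are critical and the square vanishes
    almost everywhere, which makes [P] a solution of an autonomous equation. That
    equation is not Lipschitz at the inflection point, but the position is an
    explicit increasing function of the angle ([elastica_time_slope]), which
    determines [P].

    Regularity: on each half the curvature is a smooth function of the position
    up to the midpoint. There the second derivative, even about the midpoint, has
    opposite one-sided derivatives, which are not zero. So the third derivative
    has bounded variation and a jump. *)

(** * Derivatives of real functions *)

Section DerivativeRules.
Context {R : realType}.
Implicit Types (f g : R -> R) (a b c d x : R).

(** The rules below are stated for functions in applied form and leave the
    derivative as a variable, so that [compute_deriv] can assemble a derivative
    by unification and its simplification is an ordinary identity. *)
Lemma deq f x a b : is_derive x 1 f a -> a = b -> is_derive x 1 f b.
Proof. by move=> ? <-. Qed.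

Lemma dcst c x : is_derive x 1 (fun=> c) 0.
Proof. exact: is_derive_cst. Qed.

Lemma did x : is_derive x 1 (fun y => y) 1.
Proof. exact: is_derive_id. Qed.

Lemma dD f g x a b : is_derive x 1 f a -> is_derive x 1 g b ->
  is_derive x 1 (fun y => f y + g y) (a + b).
Proof. by move=> ? ?; exact: is_deriveD. Qed.

Lemma dN f x a : is_derive x 1 f a -> is_derive x 1 (fun y => - f y) (- a).
Proof. by move=> ?; exact: is_deriveN. Qed.

Lemma dM f g x a b : is_derive x 1 f a -> is_derive x 1 g b ->
  is_derive x 1 (fun y => f y * g y) (a * g x + f x * b).
Proof.
move=> fa gb; have H := is_deriveM fa gb.
by apply: deq H _; rewrite /GRing.scale/=; ring.
Qed.

Lemma dV f x a : f x != 0 -> is_derive x 1 f a ->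
  is_derive x 1 (fun y => (f y)^-1) (- (f x) ^- 2 * a).
Proof. by move=> fx fa; exact: is_deriveV fx fa. Qed.

Lemma dX f n x a : is_derive x 1 f a ->
  is_derive x 1 (fun y => f y ^+ n.+1) (n.+1%:R * f x ^+ n * a).
Proof.
move=> fa; have H := @is_deriveX _ _ f n.+1 x 1 a fa.
by move: H; rewrite exprfctE => H; exact: deq H _.
Qed.

Lemma dcomp f g x a b : is_derive (g x) 1 f a -> is_derive x 1 g b ->
  is_derive x 1 (fun y => f (g y)) (a * b).
Proof. by move=> ? ?; exact: is_derive1_comp. Qed.

Lemma dsin g x b : is_derive x 1 g b ->
  is_derive x 1 (fun y => sin (g y)) (cos (g x) * b).
Proof. by apply: dcomp. Qed.

Lemma dcos g x b : is_derive x 1 g b ->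
  is_derive x 1 (fun y => cos (g y)) (- sin (g x) * b).
Proof. by apply: dcomp. Qed.

Lemma dsqrt g x b : 0 < g x -> is_derive x 1 g b ->
  is_derive x 1 (fun y => Num.sqrt (g y)) ((2 * Num.sqrt (g x))^-1 * b).
Proof. by move=> gx; apply: dcomp; exact: is_derive1_sqrt. Qed.

Lemma dcts f x a : is_derive x 1 f a -> {for x, continuous f}.
Proof. by move=> [fa _]; apply/differentiable_continuous/derivable1_diffP. Qed.

Lemma dext f g x a : f =1 g -> is_derive x 1 f a -> is_derive x 1 g a.
Proof. by move=> /funext ->. Qed.

Lemma dnear f g x a : (\near x, f x = g x) -> is_derive x 1 f a ->
  is_derive x 1 g a.
Proof. exact: near_eq_is_derive. Qed.

Lemma duniq f x a b : is_derive x 1 f a -> is_derive x 1 f b -> a = b.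
Proof. by move=> [_ <-] [_ <-]. Qed.

Lemma d1E f x a : is_derive x 1 f a -> derive1 f x = a.
Proof. by move=> [_ <-]; rewrite derive1E. Qed.

(** Carathéodory's slope functions glue along with the branches. *)
Lemma dglue f g c d : f c = g c -> is_derive c 1 f d -> is_derive c 1 g d ->
  is_derive c 1 (fun x => if x <= c then f x else g x) d.
Proof.
move=> fg /is_derive1_caratheodory[u [uE uc ud]].
move=> /is_derive1_caratheodory[v [vE vc vd]].
apply/is_derive1_caratheodory.
exists (fun x => if x <= c then u x else v x); split.
- move=> z; rewrite lexx; case: ifP => // _.
  by rewrite fg vE.
- move: uc vc => /cvgrPdist_lt uc /cvgrPdist_lt vc.
  apply/cvgrPdist_lt => e e0; rewrite /= lexx.
  have [/= d1 d10 h1] := uc _ e0.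
  have := vc _ e0; rewrite vd -ud => -[/= d2 d20 h2].
  exists (Num.min d1 d2) => /=; first by rewrite lt_min d10.
  move=> t /=; rewrite lt_min => /andP[t1 t2].
  by case: ifP => _; [exact: h1|exact: h2].
- by rewrite lexx.
Qed.

Lemma MVT_is_derive f (df : R -> R) a b : a < b ->
  (forall x, a < x < b -> is_derive x 1 f (df x)) ->
  {within `[a, b], continuous f} ->
  exists2 c, a < c < b & f b - f a = df c * (b - a).
Proof.
move=> ab h cf; have h' x : x \in `]a, b[ -> is_derive x 1 f (df x).
  by rewrite in_itv/=; exact: h.
have [c cab fE] := MVT ab h' cf.
by exists c => //; move: cab; rewrite in_itv.
Qed.

Lemma incr_is_derive f (df : R -> R) a b : a < b ->
  (forall x, a < x < b -> is_derive x 1 f (df x)) ->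
  {within `[a, b], continuous f} ->
  (forall x, a < x < b -> 0 < df x) -> f a < f b.
Proof.
move=> ab h cf d0; have [c cab fE] := MVT_is_derive ab h cf.
by rewrite -subr_gt0 fE mulr_gt0 ?d0// subr_gt0.
Qed.

Lemma cst_is_derive f a b : a <= b ->
  (forall x, a < x < b -> is_derive x 1 f 0) ->
  {within `[a, b], continuous f} -> f a = f b.
Proof.
rewrite le_eqVlt => /predU1P[->//|ab] h cf.
have [c cab fE] := MVT_is_derive ab h cf.
by apply/esym/eqP; rewrite -subr_eq0 fE mul0r.
Qed.

End DerivativeRules.

Tactic Notation "nref" uconstr(t) := notypeclasses refine t.

Ltac derives := repeat first
  [ eassumption | exact: did | exact: dcst
  | nref (dX _ _) | nref (dD _ _) | nref (dN _) | nref (dM _ _) | nref (dsin _)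
  | nref (dcos _) | nref (dsqrt _ _) | nref (dV _ _) ].

Ltac compute_deriv := nref (deq _ _); [derives|].

(** * A C^1 function vanishing on a half-line *)

Section PositivePart.
Context {R : realType}.
Implicit Types x : R.

(** A building block for two things: steps used as test functions, and the sine
    of the tangent angle of a curve that starts with a segment. *)
Definition possq x : R := if x <= 0 then 0 else x ^+ 2.

Lemma is_derive_possq x : is_derive x 1 possq (2 * Num.max 0 x).
Proof.
have [x0|x0|->] := ltgtP x 0.
- apply: (@dnear _ (fun=> 0)); last by rewrite mulr0; exact: dcst.
  near=> y; rewrite /possq ifT//; apply/ltW; near: y.
  exact: lt_nbhsl.
- apply: (@dnear _ (fun y => y ^+ 2)).
    near=> y; rewrite /possq ifF//; apply/negbTE; rewrite -ltNge; near: y.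
    exact: lt_nbhsr.
  by compute_deriv; rewrite /=; ring.
- rewrite mulr0; nref (@dglue _ (fun=> 0) (fun y => y ^+ 2) 0 0 _ _ _).
  + by rewrite expr0n.
  + exact: dcst.
  + by compute_deriv; rewrite /= mulr0 mul0r.
Unshelve. all: by end_near. Qed.

Lemma possq_ge0 x : 0 <= possq x.
Proof. by rewrite /possq; case: ifP => // _; exact: sqr_ge0. Qed.

Lemma possqE x : 0 <= x -> possq x = x ^+ 2.
Proof.
rewrite /possq le_eqVlt => /predU1P[<-|x0]; first by rewrite lexx expr0n.
by rewrite leNgt x0.
Qed.

Lemma possq0 x : x <= 0 -> possq x = 0.
Proof. by rewrite /possq => ->. Qed.

Lemma sqrt_possq x : Num.sqrt (possq x) = Num.max 0 x.
Proof.
have [x0|x0] := leP x 0; first by rewrite possq0// sqrtr0.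
by rewrite possqE 1?ltW// sqrtr_sqr gtr0_norm.
Qed.

End PositivePart.

(** * The integral of the square root of the sine *)

Section SqrtSineIntegral.
Context {R : realType}.
Implicit Types x z : R.
Local Notation mu := (@lebesgue_measure R).

Definition sqrtsin x : R := Num.sqrt (sin x).

Lemma continuous_sqrtsin : continuous sqrtsin.
Proof.
move=> x; apply: continuous_comp; first exact: continuous_sin.
exact: sqrt_continuous.
Qed.

Lemma continuous_integrable (f : R -> R) a b :
  {within `[a, b], continuous f} -> mu.-integrable `[a, b] (EFin \o f).
Proof.
by move=> cf; apply: continuous_compact_integrable => //; exact: segment_compact.
Qed.

(** The base point is negative and [sqrt] vanishes on negative numbers, so
    [J] is differentiable at [0] too and vanishes just below it. *)
Definition J z : R := \int[mu]_(t in `[-2, z]) sqrtsin t.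

Lemma is_derive_J z : -2 < z -> is_derive z 1 J (sqrtsin z).
Proof.
move=> z2; have z1 : z < z + 1 by rewrite ltrDl.
have cs : {within `[-2, z + 1], continuous sqrtsin}.
  by apply: continuous_subspaceT; exact: continuous_sqrtsin.
have [dJ JE] := continuous_FTC1_closed z1 (continuous_integrable cs) z2
  (@continuous_sqrtsin z).
by split; [exact: dJ|rewrite -derive1E; exact: JE].
Qed.

Lemma sqrtsin_npos z : -2 <= z <= 0 -> sqrtsin z = 0.
Proof.
move=> /andP[z2 z0]; apply: ler0_sqrtr.
rewrite -[z]opprK sinN oppr_le0 sin_ge0_pi// oppr_ge0 z0/=.
by rewrite (le_trans _ (pi_ge2 R))// lerNl.
Qed.

Lemma J_npos z : -2 <= z <= 0 -> J z = 0.
Proof.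
move=> /andP[z2 z0].
rewrite /J (@eq_Rintegral _ _ _ _ _ (cst 0)); last first.
  move=> t; rewrite inE/= in_itv/= => /andP[t2 tz]; apply: sqrtsin_npos.
  by rewrite t2 (le_trans tz).
by rewrite Rintegral_cst// mul0r.
Qed.

Lemma J0 : J 0 = 0.
Proof. by apply: J_npos; rewrite lexx andbT; lra. Qed.

Lemma continuous_J z : -2 < z -> {for z, continuous J}.
Proof. by move=> /is_derive_J/dcts. Qed.

Lemma J_gt0 z : 0 < z <= pi -> 0 < J z.
Proof.
move=> /andP[z0 zpi]; rewrite -J0; apply: (@incr_is_derive _ _ sqrtsin) => //.
- by move=> x /andP[x0 _]; apply: is_derive_J; lra.
- apply: continuous_in_subspaceT => x; rewrite inE/= in_itv/= => /andP[x0 _].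
  by apply: continuous_J; lra.
- move=> x /andP[x0 xz]; rewrite sqrtr_gt0 sin_gt0_pi// x0/=.
  exact: lt_le_trans zpi.
Qed.

End SqrtSineIntegral.

(** * Width, height and energy of elastica arcs *)

Section ElasticaFunctions.
Context {R : realType}.
Implicit Types p x z h : R.

Lemma sqrtsin_gt0 p : 0 < p < pi -> 0 < sqrtsin p.
Proof. by move=> p0; rewrite sqrtr_gt0 sin_gt0_pi. Qed.

Lemma sqr_sqrtsin p : 0 <= p <= pi -> sqrtsin p ^+ 2 = sin p.
Proof. by move=> p0; rewrite sqr_sqrtr// sin_ge0_pi. Qed.

Lemma is_derive_sqrtsin p : 0 < p < pi ->
  is_derive p 1 sqrtsin (cos p / (2 * sqrtsin p)).
Proof.
move=> p0; nref (deq _ _); first by nref (dsqrt _ (dsin (did _))); exact: sin_gt0_pi.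
by rewrite /sqrtsin; ring.
Qed.

(** The rectangular elastica is the curve whose curvature is the square root of
    the sine of the angle [z] that its tangent makes with the tangent at an
    inflection point; along and across the latter its coordinates are
    [2 sqrtsin z] and [J z]. Here it is rotated so that the tangent at the
    inflection point has angle [p], and [elastica_x p], [elastica_y p] are the
    coordinates of the top, where the tangent is horizontal. *)
Definition elastica_x p : R := 2 * sqrtsin p * cos p + J p * sin p.
Definition elastica_y p : R := 2 * sqrtsin p * sin p - J p * cos p.

Lemma pihalf_lt_pi : pi / 2 < pi :> R.
Proof. by have := pi_gt0 R; lra. Qed.

Lemma elastica_x_gt0 p : 0 < p <= pi / 2 -> 0 < elastica_x p.
Proof.
move=> /andP[p0 p2]; have pp := pihalf_lt_pi.
apply: ltr_wpDl.
  rewrite !mulr_ge0 ?sqrtr_ge0// cos_ge0_pihalf// p2 andbT; lra.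
by rewrite mulr_gt0 ?J_gt0 ?sin_gt0_pi// p0/=; lra.
Qed.

Lemma continuous_elastica_x p : -2 < p -> {for p, continuous elastica_x}.
Proof.
move=> p2; apply: continuousD; apply: continuousM; try apply: continuousM.
- exact: cvg_cst.
- exact: continuous_sqrtsin.
- exact: continuous_cos.
- exact: continuous_J.
- exact: continuous_sin.
Qed.

Lemma continuous_elastica_y p : -2 < p -> {for p, continuous elastica_y}.
Proof.
move=> p2; apply: continuousB; apply: continuousM; try apply: continuousM.
- exact: cvg_cst.
- exact: continuous_sqrtsin.
- exact: continuous_sin.
- exact: continuous_J.
- exact: continuous_cos.
Qed.

Lemma is_derive_elastica_x p : 0 < p < pi ->
  is_derive p 1 elastica_x
    (cos p ^+ 2 / sqrtsin p - sqrtsin p * sin p + J p * cos p).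
Proof.
move=> p0; have s0 := sqrtsin_gt0 p0.
have d1 := is_derive_sqrtsin p0.
have d2 : is_derive p 1 J (sqrtsin p) by apply: is_derive_J; case/andP: p0; lra.
nref (deq _ _); [derives|].
by rewrite /=; field; rewrite gt_eqF.
Qed.

Lemma is_derive_elastica_y p : 0 < p < pi ->
  is_derive p 1 elastica_y (elastica_x p).
Proof.
move=> p0; have s0 := sqrtsin_gt0 p0.
have d1 := is_derive_sqrtsin p0.
have d2 : is_derive p 1 J (sqrtsin p) by apply: is_derive_J; case/andP: p0; lra.
nref (deq _ _); first by derives.
rewrite /elastica_x -sqr_sqrtsin; last by case/andP: p0 => /ltW-> /ltW->.
by rewrite /=; field; rewrite gt_eqF.
Qed.

(** Thanks to [cos ^ 2 + sin ^ 2 = 1], the numerator of the derivative reduces to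
    [2 sin p + J p ^ 2 + J p cos p / sqrt (sin p)]. *)
Lemma elastica_slope_incr p1 p2 : 0 < p1 -> p1 < p2 -> p2 <= pi / 2 ->
  elastica_y p1 / elastica_x p1 < elastica_y p2 / elastica_x p2.
Proof.
move=> p10 p12 p2h; have pp := pihalf_lt_pi.
apply: (@incr_is_derive _ (fun p => elastica_y p / elastica_x p)
  (fun p => (elastica_x p ^+ 2 - elastica_y p *
    (cos p ^+ 2 / sqrtsin p - sqrtsin p * sin p + J p * cos p)) / elastica_x p ^+ 2)) => //.
- move=> p /andP[pa pb].
  have p0pi : 0 < p < pi by apply/andP; split; lra.
  have x0 : 0 < elastica_x p by apply: elastica_x_gt0; apply/andP; split; lra.
  have d1 := is_derive_elastica_x p0pi.
  have d2 := is_derive_elastica_y p0pi.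
  nref (deq _ _); first by derives; rewrite ?gt_eqF.
  by rewrite /=; field; rewrite !gt_eqF// sqrtsin_gt0.
- apply: continuous_in_subspaceT => p; rewrite inE/= in_itv/= => /andP[pa pb].
  have x0 : 0 < elastica_x p by apply: elastica_x_gt0; apply/andP; split; lra.
  apply: continuousM; first by apply: continuous_elastica_y; lra.
  apply: continuousV; first by rewrite gt_eqF.
  by apply: continuous_elastica_x; lra.
- move=> p /andP[pa pb].
  have p0pi : 0 < p < pi by apply/andP; split; lra.
  have x0 : 0 < elastica_x p by apply: elastica_x_gt0; apply/andP; split; lra.
  have s0 := sqrtsin_gt0 p0pi.
  rewrite divr_gt0// ?exprn_gt0//.
  have J0 : 0 < J p by apply: J_gt0; apply/andP; split; lra.
  have c0 : 0 < cos p by apply: cos_gt0_pihalf; apply/andP; split; lra.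
  have sE : sin p = sqrtsin p ^+ 2 by rewrite sqr_sqrtsin//; apply/andP; split; lra.
  have cE : sqrtsin p ^+ 4 = 1 - cos p ^+ 2.
    by rewrite (_ : _ ^+ 4 = (sqrtsin p ^+ 2) ^+ 2); [rewrite -sE sin2cos2|ring].
  rewrite [ltRHS](_ : _ = 2 * sqrtsin p ^+ 2 + J p ^+ 2 + J p * cos p / sqrtsin p).
    by rewrite addr_gt0 ?addr_gt0 ?mulr_gt0 ?exprn_gt0 ?invr_gt0.
  have c2E : cos p ^+ 2 = 1 - sqrtsin p ^+ 4 by rewrite cE; ring.
  rewrite /elastica_x /elastica_y sE.
  move: c2E s0; set s := sqrtsin p; set c := cos p; set j := J p => c2E s0.
  rewrite [LHS](_ : _ = 2 * s ^+ 2 * (c ^+ 2 + s ^+ 4) + j ^+ 2 * (c ^+ 2 + s ^+ 4)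
      + j * c / s * (c ^+ 2 + s ^+ 4)).
    by rewrite c2E; ring.
  by rewrite /=; field; rewrite gt_eqF.
Qed.

(** What completing the square gives for the energy of a graph over an interval
    of length [1 / 2] that rises by [h], with largest slope [tan p]: the value of
    [2 M J p - M ^ 2 (sin p / 2 - h cos p)] for the best [M]. *)
Definition elastica_energy h p : R := J p ^+ 2 / (sin p / 2 - h * cos p).

Lemma height_denom_gt0 h p : atan (2 * h) < p -> p < pi / 2 ->
  0 < sin p / 2 - h * cos p.
Proof.
move=> hp p2.
have pN2 : - (pi / 2) < p by apply: lt_trans hp; exact: atan_gtNpi2.
have c0 : 0 < cos p by rewrite cos_gt0_pihalf// pN2.
have : tan (atan (2 * h)) < tan p.
  by rewrite ltr_tan// in_itv/= ?atan_gtNpi2 ?atan_ltpi2 ?pN2.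
by rewrite atanK /tan ltr_pdivlMr// => H; lra.
Qed.

Lemma atan_gt0 x : 0 < x -> 0 < atan x.
Proof. by move=> x0; rewrite -atan0 lt_atan. Qed.

(** The derivative factors through the comparison of the slope
    [elastica_y / elastica_x] with [2 h], so the monotonicity of that slope
    decides where the energy decreases. *)
Lemma is_derive_elastica_energy h p : 0 < h -> atan (2 * h) < p -> p < pi / 2 ->
  is_derive p 1 (elastica_energy h)
   (J p / (2 * (sin p / 2 - h * cos p) ^+ 2) * (elastica_y p - 2 * h * elastica_x p)).
Proof.
move=> h0 hp p2; have pp := pihalf_lt_pi.
have p0 : 0 < p by apply: lt_trans hp; apply: atan_gt0; rewrite mulr_gt0.
have q0 := height_denom_gt0 hp p2.
have d2 : is_derive p 1 J (sqrtsin p) by apply: is_derive_J; lra.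
nref (deq _ _).
  by derives; rewrite gt_eqF.
rewrite /elastica_x /elastica_y.
by rewrite /=; field; apply: lt0r_neq0; lra.
Qed.

Lemma elastica_energy_within h a b : 0 < h -> atan (2 * h) < a -> b < pi / 2 ->
  {within `[a, b], continuous (elastica_energy h)}.
Proof.
move=> h0 ha b2; apply: continuous_in_subspaceT => p.
rewrite inE/= in_itv/= => /andP[pa pb].
apply: dcts; apply: is_derive_elastica_energy => //; lra.
Qed.

Lemma elastica_energy_decr h p1 p2 : 0 < h -> atan (2 * h) < p1 -> p1 < p2 ->
  p2 < pi / 2 -> elastica_y p2 <= 2 * h * elastica_x p2 ->
  elastica_energy h p2 < elastica_energy h p1.
Proof.
move=> h0 hp p12 p2h yx; have pp := pihalf_lt_pi.
have p10 : 0 < p1 by apply: lt_trans hp; apply: atan_gt0; rewrite mulr_gt0.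
rewrite -ltrN2.
apply: (@incr_is_derive _ (fun p => - elastica_energy h p)
  (fun p => - (J p / (2 * (sin p / 2 - h * cos p) ^+ 2)
   * (elastica_y p - 2 * h * elastica_x p)))) => //.
- move=> p /andP[pa pb]; nref (dN _); apply: is_derive_elastica_energy => //; lra.
- by move=> p; apply: continuousN; exact: elastica_energy_within.
- move=> p /andP[pa pb]; rewrite oppr_gt0 pmulr_rlt0; last first.
    rewrite divr_gt0//; first by apply: J_gt0; apply/andP; split; lra.
    by rewrite mulr_gt0// exprn_gt0// height_denom_gt0//; lra.
  have x0 : 0 < elastica_x p by apply: elastica_x_gt0; apply/andP; split; lra.
  have x20 : 0 < elastica_x p2 by apply: elastica_x_gt0; apply/andP; split; lra.
  rewrite subr_lt0 -ltr_pdivrMr//.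
  apply: (@lt_le_trans _ _ (elastica_y p2 / elastica_x p2)).
    by apply: elastica_slope_incr; lra.
  by rewrite ler_pdivrMr.
Qed.

Lemma elastica_energy_incr h p1 p2 : 0 < h -> atan (2 * h) < p1 -> p1 < p2 ->
  p2 < pi / 2 -> 2 * h * elastica_x p1 <= elastica_y p1 ->
  elastica_energy h p1 < elastica_energy h p2.
Proof.
move=> h0 hp p12 p2h yx; have pp := pihalf_lt_pi.
have p10 : 0 < p1 by apply: lt_trans hp; apply: atan_gt0; rewrite mulr_gt0.
apply: (@incr_is_derive _ (elastica_energy h)
  (fun p => (J p / (2 * (sin p / 2 - h * cos p) ^+ 2)
   * (elastica_y p - 2 * h * elastica_x p)))) => //.
- move=> p /andP[pa pb]; apply: is_derive_elastica_energy => //; lra.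
- by apply: elastica_energy_within.
- move=> p /andP[pa pb]; rewrite pmulr_rgt0; last first.
    rewrite divr_gt0//; first by apply: J_gt0; apply/andP; split; lra.
    by rewrite mulr_gt0// exprn_gt0// height_denom_gt0//; lra.
  have x0 : 0 < elastica_x p by apply: elastica_x_gt0; apply/andP; split; lra.
  have x20 : 0 < elastica_x p1 by apply: elastica_x_gt0; apply/andP; split; lra.
  rewrite subr_gt0 -ltr_pdivlMr//.
  apply: (@le_lt_trans _ _ (elastica_y p1 / elastica_x p1)).
    by rewrite ler_pdivlMr.
  by apply: elastica_slope_incr; lra.
Qed.

Lemma elastica_slope_pihalf :
  elastica_y (pi / 2) / elastica_x (pi / 2) = 2 / J (pi / 2) :> R.
Proof.
rewrite /elastica_y /elastica_x /sqrtsin sin_pihalf cos_pihalf sqrtr1.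
by rewrite !mulr0 !mulr1 subr0 add0r.
Qed.

Lemma elastica_slope_lt h p : (J (pi / 2))^-1 <= h -> 0 < p -> p < pi / 2 ->
  elastica_y p < 2 * h * elastica_x p.
Proof.
move=> hh p0 p2; rewrite -ltr_pdivrMr; last by rewrite elastica_x_gt0// p0 ltW.
apply: lt_le_trans (elastica_slope_incr p0 p2 (lexx _)) _.
by rewrite elastica_slope_pihalf; lra.
Qed.

(** At [atan (2 h)] the difference [elastica_y - 2 h elastica_x] equals
    [- J cos (1 + (2 h) ^ 2)], which is negative; at [pi / 2] it has the sign of
    [1 / J (pi / 2) - h]. *)
Lemma critical_angle h : 0 < h < (J (pi / 2))^-1 ->
  exists p, [/\ atan (2 * h) < p, p < pi / 2 &
                elastica_y p = 2 * h * elastica_x p].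
Proof.
move=> /andP[h0 hJ]; have pp := pihalf_lt_pi.
set f := fun p : R => elastica_y p - 2 * h * elastica_x p.
have a2 := atan_ltpi2 (2 * h).
have a0 : 0 < atan (2 * h) by apply: atan_gt0; rewrite mulr_gt0.
have cf : {within `[atan (2 * h), pi / 2], continuous f}.
  apply: continuous_in_subspaceT => p; rewrite inE/= in_itv/= => /andP[pa pb].
  apply: continuousB; first by apply: continuous_elastica_y; lra.
  apply: continuousM; first exact: cvg_cst.
  by apply: continuous_elastica_x; lra.
have fa : f (atan (2 * h)) < 0.
  have c0 : 0 < cos (atan (2 * h)) by rewrite cos_gt0_pihalf// atan_gtNpi2.
  have tE := atanK (2 * h).
  have J0 : 0 < J (atan (2 * h)) by apply: J_gt0; apply/andP; split; lra.
  have sE : sin (atan (2 * h)) = 2 * h * cos (atan (2 * h)).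
    by have := congr1 ( *%R^~ (cos (atan (2 * h)))) tE; rewrite /tan/= divfK// gt_eqF.
  rewrite /f /elastica_y /elastica_x sE.
  set c := cos _; set s := sqrtsin _; set j := J _.
  rewrite [ltLHS](_ : _ = - (j * c * (1 + (2 * h) ^+ 2))); last by ring.
  rewrite oppr_lt0 !mulr_gt0//.
  by rewrite ltr_pwDl// sqr_ge0.
have fb : 0 < f (pi / 2).
  have x0 : 0 < elastica_x (pi / 2) :> R.
    by apply: elastica_x_gt0; apply/andP; split; lra.
  by rewrite subr_gt0 -ltr_pdivlMr// elastica_slope_pihalf; lra.
have [|p] := @IVT _ f _ _ 0 (ltW a2) cf.
  by rewrite ge_min le_max (ltW fa) (ltW fb) orbT.
rewrite in_itv/= => /andP[pa pb] fp.
exists p; split.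
- by rewrite lt_neqAle pa andbT; apply/eqP => pE; move: fa; rewrite pE fp ltxx.
- by rewrite lt_neqAle pb andbT; apply/eqP => pE; move: fb; rewrite -pE fp ltxx.
- by apply/eqP; rewrite -subr_eq0; apply/eqP.
Qed.

End ElasticaFunctions.

(** * The critical height *)

Section CriticalHeight.
Context {R : realType}.
Implicit Types t x : R.
Local Notation mu := (@lebesgue_measure R).

Definition speed x : R := Num.sqrt (1 + x ^+ 2).

Lemma speed_gt0 x : 0 < speed x.
Proof. by rewrite sqrtr_gt0 ltr_pwDl// sqr_ge0. Qed.

Lemma sqr_speed x : speed x ^+ 2 = 1 + x ^+ 2.
Proof. by rewrite sqr_sqrtr// addr_ge0// sqr_ge0. Qed.

Lemma continuous_speed : continuous speed.
Proof.
move=> x; apply: continuous_comp; last exact: sqrt_continuous.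
apply: continuousD; first exact: cvg_cst.
exact: exprn_continuous.
Qed.

Lemma powR_5_4 t :
  (1 + t ^+ 2) `^ (- (5 / 4)) = Num.sqrt (cos (atan t)) / (1 + t ^+ 2).
Proof.
have t0 : 0 <= 1 + t ^+ 2 by rewrite addr_ge0// sqr_ge0.
have t1 : 0 < 1 + t ^+ 2 by rewrite ltr_pwDl// sqr_ge0.
rewrite cos_atan powRN (_ : 5 / 4 = 1 + 2^-1 * 2^-1); last by field.
rewrite powRD ?(gt_eqF t1) ?implybT//.
rewrite powRr1// powRrM !powR12_sqrt// ?sqrtr_ge0//.
by rewrite sqrtrV ?sqrtr_ge0// invfM mulrC.
Qed.

(** The substitution [z = pi / 2 - atan t] turns the integrand into the square
    root of [sin z]. *)
Lemma c_0E : c_0 R = 2 * J (pi / 2).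
Proof.
have pp := pi_gt0 R.
pose f t : R := (1 + t ^+ 2) `^ (- (5 / 4)).
have f0 t : 0 <= f t by exact: powR_ge0.
have cf : continuous f.
  rewrite (_ : f = fun t => Num.sqrt (cos (atan t)) / (1 + t ^+ 2)); last first.
    by apply/funext => t; exact: powR_5_4.
  move=> t.
  have c1 : {for t, continuous (fun t : R => Num.sqrt (cos (atan t)))}.
    apply: continuous_comp; last exact: sqrt_continuous.
    by apply: continuous_comp; [exact: continuous_atan|exact: continuous_cos].
  have c2 : {for t, continuous (fun t : R => (1 + t ^+ 2)^-1)}.
    apply: continuousV; first by rewrite gt_eqF// ltr_pwDl// sqr_ge0.
    by apply: continuousD; [exact: cvg_cst|exact: exprn_continuous].
  exact: cvgM c1 c2.
have atan_half t : pi / 2 - atan t > 0 by rewrite subr_gt0 atan_ltpi2.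
have dF t : is_derive t 1 (fun t => - J (pi / 2 - atan t)) (f t).
  have d1 := dD (dcst (pi / 2) t) (dN (is_derive1_atan t)).
  have d2 : is_derive (pi / 2 - atan t) 1 J (sqrtsin (pi / 2 - atan t)).
    by apply: is_derive_J; apply: lt_trans (atan_half t).
  have H := dN (@dcomp _ J (fun y => pi / 2 - atan y) t _ _ d2 d1); nref (deq H _).
  by rewrite /f powR_5_4 /= /sqrtsin sinB sin_pihalf cos_pihalf mul1r mul0r subr0; ring.
rewrite /c_0 /Rintegral (@ge0_symfun_integralT _ f)//; last first.
  by move=> t; rewrite /f /= sqrrN.
rewrite -set_itvcy (@ge0_continuous_FTC2y _ f (fun t => - J (pi / 2 - atan t)) 0 0).
- by rewrite atan0 subr0 sub0e -EFinN opprK -EFinM.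
- by move=> x _.
- by apply: continuous_subspaceT.
- rewrite -[X in _ --> X]oppr0 -J0; apply: cvgN.
  have h : pi / 2 - atan x @[x --> +oo%R] --> (0 : R).
    rewrite -[X in _ --> X](subrr (pi / 2)).
    by apply: cvgB; [exact: cvg_cst|exact: cvgy_atan].
  have c0 : {for 0, continuous (@J R)} by apply: continuous_J; rewrite oppr_lt0.
  exact: (cvg_comp _ _ h c0).
- by move=> x _; have [] := dF x.
- apply: cvg_at_right_filter; exact: dcts (dF 0).
- by move=> x _; exact: d1E.
Qed.

Lemma c_starE : c_star R = (J (pi / 2))^-1.
Proof. by rewrite /c_star c_0E invfM mulrA divff// mul1r. Qed.

End CriticalHeight.

(** * Real-valued integrals *)

Section RealIntegrals.
Context {R : realType}.
Implicit Types (f g : R -> R) (a b c x : R) (D : set R).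
Local Notation mu := (@lebesgue_measure R).

Lemma Rdominated_cvg D (f_ : nat -> R -> R) f g : measurable D ->
  (forall n, measurable_fun D (f_ n)) -> measurable_fun D f ->
  (forall x, D x -> f_ n x @[n --> \oo] --> f x) ->
  mu.-integrable D (EFin \o g) ->
  (forall n x, D x -> `|f_ n x| <= g x) ->
  (\int[mu]_(x in D) f_ n x) @[n --> \oo] --> \int[mu]_(x in D) f x.
Proof.
move=> mD mf_ mf ff ig fg.
have [||||| ifE _ cvgE] := @dominated_convergence _ _ R mu D mD
  (fun n => EFin \o f_ n) (EFin \o f) (EFin \o g).
- by move=> n; apply/measurable_EFinP; exact: mf_.
- exact/measurable_EFinP.
- by apply: aeW => x Dx; apply: cvg_EFin; [exact: nearW|exact: ff].
- exact: ig.
- by apply: aeW => x n Dx /=; rewrite lee_fin; exact: fg.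
move=> h; apply: fine_cvg; rewrite fineK//.
by apply: integrable_fin_num.
Qed.

Lemma Rintegral_support D B f : B `<=` D ->
  (forall x, D x -> ~ B x -> f x = 0) ->
  \int[mu]_(x in D) f x = \int[mu]_(x in B) f x.
Proof.
move=> BD f0; rewrite Rintegral_mkcond [RHS]Rintegral_mkcond.
congr fine; apply: eq_integral => x _ /=; congr EFin; rewrite !patchE.
have [Dx|Dx] := boolP (x \in D); have [Bx|Bx] := boolP (x \in B) => //.
  by rewrite f0//; [exact/set_mem|move/mem_set; exact/negP].
by move: (BD _ (set_mem Bx)) => /mem_set; rewrite (negbTE Dx).
Qed.

Lemma Rintegral_derive F f a b : a <= b ->
  (forall x, a <= x <= b -> is_derive x 1 F (f x)) ->
  {within `[a, b], continuous f} ->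
  \int[mu]_(x in `[a, b]) f x = F b - F a.
Proof.
rewrite le_eqVlt => /predU1P[<- _ _|ab dF cf].
  by rewrite set_itv1 Rintegral_set1 subrr.
rewrite /Rintegral (@continuous_FTC2 R f F a b)//=.
- have h x : x \in `]a, b[ -> derivable F x 1.
    by rewrite in_itv/= => /andP[xa xb]; have [] := dF x; rewrite ?(ltW xa) ?(ltW xb).
  split => //.
  + apply: cvg_at_right_filter; apply: dcts (dF a _) => //.
    by rewrite lexx ltW.
  + apply: cvg_at_left_filter; apply: dcts (dF b _) => //.
    by rewrite lexx ltW.
- move=> x; rewrite in_itv/= => /andP[xa xb]; apply: d1E; apply: dF.
  by rewrite !ltW.
Qed.

Lemma locally_integrable_itv f a b :
  locally_integrable (`]0, 1[%classic : set R) f -> 0 < a -> b < 1 ->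
  mu.-integrable `[a, b] (EFin \o f).
Proof.
move=> [mf _ fK] a0 b1; have sub : `[a, b] `<=` (`]0, 1[%classic : set R).
  by apply: subset_itv; rewrite bnd_simp.
apply/integrableP; split.
  by apply/measurable_EFinP; exact: measurable_funS mf.
have := fK _ sub (@segment_compact R a b). exact.
Qed.

Lemma integrable_mul_bounded D f g M : measurable D ->
  mu.-integrable D (EFin \o f) -> measurable_fun D g ->
  (forall x, D x -> `|g x| <= M) ->
  mu.-integrable D (EFin \o (fun x => f x * g x)).
Proof.
move=> mD fi mg gM.
have [M0|M0] := leP 0 M; last first.
  have -> : D = set0.
    rewrite -subset0 => x /gM /le_lt_trans => /(_ _ M0).
    by rewrite normr_lt0.
  exact: integrable_set0.
apply: (@le_integrable _ _ _ mu D mD _ (fun x => (M%:E * (EFin \o f) x)%E)).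
- apply/measurable_EFinP; apply: measurable_funM => //.
  by apply/measurable_EFinP; exact: measurable_int fi.
- move=> x Dx /=; rewrite lee_fin normrM [leRHS]normrM mulrC.
  by rewrite ler_wpM2r// (le_trans (gM _ Dx))// ler_norm.
- exact: integrableZl.
Qed.

Lemma continuous_measurable D f : measurable D -> continuous f ->
  measurable_fun D f.
Proof.
by move=> mD cf; apply: measurable_funTS; exact: continuous_measurable_fun.
Qed.

End RealIntegrals.

(** * Test functions approximating indicators of intervals *)

Section TestFunctions.
Context {R : realType}.
Implicit Types (a b e t x : R).
Local Notation mu := (@lebesgue_measure R).
Local Notation I01 := (`]0, 1[%classic : set R).

(** A C^1 step that rises from [0] to [1] between [0] and [2]; its derivative is
    the tent [hat]. *)
Definition ramp t : R := (possq t - 2 * possq (t - 1) + possq (t - 2)) / 2.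
Definition hat t : R := Num.max 0 t - 2 * Num.max 0 (t - 1) + Num.max 0 (t - 2).

Lemma is_derive_possq_sub c t :
  is_derive t 1 (fun t => possq (t - c)) (2 * Num.max 0 (t - c)).
Proof.
have d2 : is_derive t 1 (fun t => t - c) 1.
  by nref (deq _ _); [derives|rewrite /=; ring].
have H := @dcomp _ _ (fun t => t - c) _ _ _ (is_derive_possq (t - c)) d2.
by nref (deq H _); rewrite mulr1.
Qed.

Lemma is_derive_ramp t : is_derive t 1 ramp (hat t).
Proof.
have d0 := is_derive_possq t.
have d1 := is_derive_possq_sub 1 t.
have d2 := is_derive_possq_sub 2 t.
rewrite /ramp; nref (deq _ _); first by derives.
by rewrite /hat /=; field.
Qed.

Lemma ramp0 t : t <= 0 -> ramp t = 0.
Proof. by move=> t0; rewrite /ramp !possq0//; [ring|lra|lra]. Qed.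

Lemma ramp1 t : 2 <= t -> ramp t = 1.
Proof. by move=> t0; rewrite /ramp !possqE//; [field|lra|lra|lra]. Qed.

Lemma ramp_itv t : 0 <= ramp t <= 1.
Proof.
have [t0|t0] := leP t 0; first by rewrite ramp0// lexx ler01.
have [t2|t2] := leP 2 t; first by rewrite ramp1// ler01 lexx.
rewrite /ramp (@possqE _ t) ?(ltW t0)// (@possq0 _ (t - 2)); last by lra.
have [t1|t1] := leP t 1.
  rewrite possq0; last by lra.
  by apply/andP; split; nra.
rewrite possqE; last by lra.
by apply/andP; split; nra.
Qed.

Lemma hat0 t : t <= 0 -> hat t = 0.
Proof. by move=> t0; rewrite /hat !max_l; lra. Qed.

Lemma hat2 t : 2 <= t -> hat t = 0.
Proof. by move=> t0; rewrite /hat !max_r; lra. Qed.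

Lemma hat_itv t : 0 <= hat t <= 1.
Proof.
have [t0|t0] := leP t 0; first by rewrite hat0// lexx ler01.
have [t2|t2] := leP 2 t; first by rewrite hat2// lexx ler01.
rewrite /hat (@max_r _ _ 0 t) ?(ltW t0)// (@max_l _ _ 0 (t - 2)); last by lra.
have [t1|t1] := leP t 1.
  by rewrite max_l; [apply/andP; split; lra|lra].
by rewrite max_r; [apply/andP; split; lra|lra].
Qed.

Lemma continuous_max0 : continuous (fun t : R => Num.max 0 t).
Proof. by move=> t; apply: continuous_max => //; exact: cvg_cst. Qed.

Lemma continuous_hat : continuous hat.
Proof.
have h (c : R) : continuous (fun t : R => Num.max 0 (t - c)).
  move=> t; apply: (@continuous_comp _ _ _ (fun t => t - c) (Num.max 0)).
    by apply: continuousB => //; exact: cvg_cst.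
  exact: continuous_max0.
move=> t; have c2 : (2 : R) @[_ --> t] --> (2 : R) by exact: cvg_cst.
apply: cvgD; last exact: h.
by apply: cvgB; [exact: continuous_max0|apply: cvgM => //; exact: h].
Qed.

Definition ramp_at a e x : R := ramp ((x - a) / e).
Definition hat_at a e x : R := hat ((x - a) / e) / e.

Lemma is_derive_ramp_at a e x : is_derive x 1 (ramp_at a e) (hat_at a e x).
Proof.
have d2 : is_derive x 1 (fun x => (x - a) / e) e^-1.
  by nref (deq _ _); [derives|rewrite /=; ring].
have H := @dcomp _ _ (fun x => (x - a) / e) _ _ _ (is_derive_ramp _) d2.
by nref (deq H _).
Qed.

Lemma continuous_hat_at a e : continuous (hat_at a e).
Proof.
move=> x; have c2 : {for x, continuous (fun t : R => (t - a) / e)}.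
  apply: cvgM; last exact: cvg_cst.
  by apply: cvgB => //; exact: cvg_cst.
apply: cvgM; last exact: cvg_cst.
exact: (@continuous_comp _ _ _ (fun t : R => (t - a) / e) hat x c2 (continuous_hat (x := _))).
Qed.

Lemma hat_at_out a e x : 0 < e -> ~ (a <= x <= a + 2 * e) -> hat_at a e x = 0.
Proof.
move=> e0 /negP; rewrite negb_and -!ltNge => /orP[xa|xa]; rewrite /hat_at.
  by rewrite hat0 ?mul0r// ler_pdivrMr//; lra.
by rewrite hat2 ?mul0r// ler_pdivlMr//; lra.
Qed.

Lemma hat_at_itv a e x : 0 < e -> 0 <= hat_at a e x <= e^-1.
Proof.
move=> e0; have /andP[h0 h1] := hat_itv ((x - a) / e).
by rewrite divr_ge0 ?(ltW e0)//= ler_pdivrMr// mulVf ?gt_eqF.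
Qed.

(** The difference of two ramps is a C^1 approximation of the indicator of
    [`]a, b]]. *)
Lemma test_bump a b e : 0 < a -> a < b -> 0 < e -> b + 2 * e < 1 ->
  test_function (fun x => ramp_at a e x - ramp_at b e x).
Proof.
move=> a0 ab e0 b1.
have dE x : is_derive x 1 (fun x => ramp_at a e x - ramp_at b e x)
    (hat_at a e x - hat_at b e x).
  by nref (dD _ (dN _)); exact: is_derive_ramp_at.
split.
- by move=> x; have [] := dE x.
- rewrite (_ : derive1 _ = fun x => hat_at a e x - hat_at b e x).
    by move=> x; apply: continuousB; exact: continuous_hat_at.
  by apply/funext => x; exact: d1E.
- exists `[a, b + 2 * e]%classic; split.
  + exact: segment_compact.
  + by apply: subset_itv; rewrite bnd_simp.
  + move=> x; rewrite /= in_itv/= => /negP; rewrite negb_and -!ltNge.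
    rewrite /ramp_at => /orP[xa|xa].
      by rewrite !ramp0 ?subrr// ler_pdivrMr//; lra.
    by rewrite !ramp1 ?subrr// ler_pdivlMr//; lra.
Qed.

Lemma derive1_bump a b e x :
  derive1 (fun x => ramp_at a e x - ramp_at b e x) x =
  hat_at a e x - hat_at b e x.
Proof. by apply: d1E; nref (dD _ (dN _)); exact: is_derive_ramp_at. Qed.

Lemma integral_hat_at a e : 0 < e ->
  \int[mu]_(x in `[a, a + 2 * e]) hat_at a e x = 1.
Proof.
move=> e0; have ae : a <= a + 2 * e by rewrite lerDl mulr_ge0// ltW.
have h x : a <= x <= a + 2 * e -> is_derive x 1 (ramp_at a e) (hat_at a e x).
  by move=> _; exact: is_derive_ramp_at.
have ch : {within `[a, a + 2 * e], continuous (hat_at a e)}.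
  by apply: continuous_subspaceT; exact: continuous_hat_at.
rewrite (Rintegral_derive ae h ch) /ramp_at ramp1 ?ramp0 ?subr0 ?subrr ?mul0r//.
by rewrite ler_pdivlMr//; lra.
Qed.

End TestFunctions.

(** * Weak derivatives at Lebesgue points *)

Section WeakDerivatives.
Context {R : realType}.
Implicit Types (u f g : R -> R) (a b d e x : R).
Local Notation mu := (@lebesgue_measure R).
Local Notation I01 := (`]0, 1[%classic : set R).

Lemma Rintegral_norm_ge0 f (D : set R) : 0 <= \int[mu]_(x in D) `|f x|.
Proof. by apply: Rintegral_ge0. Qed.

Lemma Rintegral_subset_le f (B D : set R) : measurable B -> measurable D ->
  B `<=` D -> mu.-integrable D (EFin \o f) -> (forall x, D x -> 0 <= f x) ->
  \int[mu]_(x in B) f x <= \int[mu]_(x in D) f x.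
Proof.
move=> mB mD BD fi f0; have fiB : mu.-integrable B (EFin \o f) by apply: integrableS fi.
apply: fine_le; [exact: integrable_fin_num|exact: integrable_fin_num|].
apply: ge0_subset_integral => //; first exact: measurable_int fi.
Qed.

(** [hat_at a e] is a probability density bounded by [1 / e] and supported in the
    ball of radius [3 e], whose measure is [6 e]; averaging against it therefore
    errs by at most six times the mean oscillation [davg]. *)
Lemma hat_average u a e : locally_integrable I01 u -> 0 < e ->
  0 < a - 3 * e -> a + 3 * e < 1 ->
  `|\int[mu]_(x in I01) (u x * hat_at a e x) - u a| <=
  6 * fine (davg u a (3 * e)).
Proof.
move=> lu e0 ae0 ae1; set C := `[a, a + 2 * e]%classic.
have mC : measurable C by exact: measurable_itv.
have uC : mu.-integrable C (EFin \o u) by apply: locally_integrable_itv => //; lra.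
have hC x : C x -> `|hat_at a e x| <= e^-1.
  by move=> _; have /andP[h0 h1] := hat_at_itv a x e0; rewrite ger0_norm.
have mh (D : set R) : measurable D -> measurable_fun D (hat_at a e).
  by move=> mD; apply: continuous_measurable => //; exact: continuous_hat_at.
have ci (c : R) : mu.-integrable C (EFin \o cst c).
  by apply: continuous_integrable; exact: cst_continuous.
have uchi c : mu.-integrable C (EFin \o (fun x => (u x - c) * hat_at a e x)).
  apply: (@integrable_mul_bounded _ C (fun x => u x - c) _ e^-1) => //.
  - have h : mu.-integrable C ((EFin \o u) \- (EFin \o cst c))%E by exact: integrableB.
    by apply: eq_integrable h.
  - exact: mh.
have chi c : mu.-integrable C (EFin \o (fun x => c * hat_at a e x)).
  by apply: (@integrable_mul_bounded _ C (fun=> c) _ e^-1) => //; [exact: ci|exact: mh].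
have hiC : mu.-integrable C (EFin \o hat_at a e).
  by apply: eq_integrable (chi 1) => // x _; rewrite /= mul1r.
rewrite (@Rintegral_support _ _ C); last 2 first.
- by apply: subset_itv; rewrite bnd_simp; lra.
- by move=> x _ xC; rewrite hat_at_out ?mulr0.
have -> : \int[mu]_(x in C) (u x * hat_at a e x) - u a =
    \int[mu]_(x in C) ((u x - u a) * hat_at a e x).
  have -> : \int[mu]_(x in C) ((u x - u a) * hat_at a e x) =
    \int[mu]_(x in C) (u x * hat_at a e x - u a * hat_at a e x).
    by apply: eq_Rintegral => x _; rewrite mulrBl.
  rewrite RintegralB//; last first.
    by apply: eq_integrable (uchi 0) => // x _; rewrite /= subr0.
  by rewrite RintegralZl// integral_hat_at// mulr1.
apply: (le_trans (le_normr_Rintegral _ (uchi _))) => //.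
set B := ball a (3 * e) : set R.
have mB : measurable B by exact: measurable_ball.
have BE : B = `]a - 3 * e, a + 3 * e[%classic by rewrite /B ball_itv.
have uB : mu.-integrable B (EFin \o (fun x => `|u x - u a|)).
  have uD : mu.-integrable `[a - 3 * e, a + 3 * e] (EFin \o (fun x => u x - u a)).
    have cD : mu.-integrable `[a - 3 * e, a + 3 * e] (EFin \o (fun=> u a)).
      by apply: continuous_integrable; exact: cst_continuous.
    have uD := locally_integrable_itv lu ae0 ae1.
    have h : mu.-integrable `[a - 3 * e, a + 3 * e] ((EFin \o u) \- (EFin \o cst (u a)))%E by exact: integrableB.
    by apply: eq_integrable h.
  have uDn : mu.-integrable `[a - 3 * e, a + 3 * e] (EFin \o (fun x => `|u x - u a|)).
    exact: integrable_norm.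
  apply: integrableS uDn => //.
  by rewrite BE; apply: subset_itv; rewrite bnd_simp.
have CB : C `<=` B by rewrite BE; apply: subset_itv; rewrite bnd_simp; lra.
have uCn : mu.-integrable C (EFin \o (fun x => `|u x - u a|)).
  exact: integrableS uB.
apply: (@le_trans _ _ (\int[mu]_(x in C) (e^-1 * `|u x - u a|))).
  apply: le_Rintegral => //.
  - exact: integrable_norm.
  - have h : mu.-integrable C (fun x => (e^-1)%:E * `|u x - u a|%:E)%E by exact: integrableZl.
    by apply: eq_integrable h.
  - by move=> x Cx; rewrite normrM mulrC ler_wpM2r// hC.
rewrite RintegralZl//.
have -> : davg u a (3 * e) =
    ((6 * e)^-1 * \int[mu]_(x in B) `|u x - u a|)%:E.
  rewrite /davg /iavg -/B (lebesgue_measure_ball _ _); last by lra.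
  rewrite inver mulrn_eq0/= mulf_eq0 pnatr_eq0/= (gt_eqF e0).
  rewrite EFinM (_ : (6 * e)^-1 = (3 * e *+ 2)^-1); last by congr (_^-1); ring.
  by congr (_ * _)%E; rewrite /Rintegral fineK//; exact: integrable_fin_num.
rewrite /= (_ : 6 * _ = e^-1 * \int[mu]_(x in B) `|u x - u a|); last first.
  by field; rewrite gt_eqF.
rewrite ler_pM2l ?invr_gt0//.
exact: Rintegral_subset_le.
Qed.

Lemma hat_average_cvg u a (e_ : nat -> R) : locally_integrable I01 u ->
  (forall n, 0 < e_ n) -> (forall n, 0 < a - 3 * e_ n) ->
  (forall n, a + 3 * e_ n < 1) -> e_ @ \oo --> 0 -> lebesgue_pt u a ->
  \int[mu]_(x in I01) (u x * hat_at a (e_ n) x) @[n --> \oo] --> u a.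
Proof.
move=> lu e0 ae0 ae1 e_0 lua.
have e3 : 3 * e_ n @[n --> \oo] --> (0 : R)^'+.
  have h : 3 * e_ n @[n --> \oo] --> (0 : R).
    by rewrite -[X in _ --> X](mulr0 3); apply: cvgM => //; exact: cvg_cst.
  move=> P P0; suff H : \forall n \near \oo, P (3 * e_ n) by exact: H.
  have Q : \forall n \near \oo, 0 < 3 * e_ n -> P (3 * e_ n) := h _ P0.
  by apply: filterS Q => n; apply; rewrite mulr_gt0.
have h1 : fine (davg u a (3 * e_ n)) @[n --> \oo] --> (0 : R).
  by apply: fine_cvg; exact: (cvg_comp _ _ e3 lua).
have h2 : 6 * fine (davg u a (3 * e_ n)) @[n --> \oo] --> (0 : R).
  by rewrite -[X in _ --> X](mulr0 6); apply: cvgM => //; exact: cvg_cst.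
apply/subr_cvg0/norm_cvg0P; apply: (squeeze_cvgr _ (cvg_cst 0) h2).
by apply: nearW => n; rewrite normr_ge0/= hat_average.
Qed.

(** A weak derivative is tested against C^1 approximations of the indicator
    of [`]a, b]]; their derivatives concentrate at [a] and at [b], where [u] is
    recovered by averaging. *)
Lemma weak_deriv_FTC_lebesgue_pt u g a b : is_weak_deriv u g ->
  0 < a -> a < b -> b < 1 -> lebesgue_pt u a -> lebesgue_pt u b ->
  \int[mu]_(x in `[a, b]) g x = u b - u a.
Proof.
move=> [lu lg ug] a0 ab b1 ua ub.
(* The supports and the averaging balls stay inside the unit interval. *)
pose m := Num.min a (1 - b) / 4.
have m0 : 0 < m by rewrite divr_gt0// lt_min a0 subr_gt0.
have ma : 4 * m <= a by rewrite mulrC divfK// ge_min lexx.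
have mb : 4 * m <= 1 - b by rewrite mulrC divfK// ge_min lexx orbT.
pose e_ n : R := m / n.+1%:R.
have e0 n : 0 < e_ n by rewrite divr_gt0.
have em n : e_ n <= m.
  by rewrite ler_pdivrMr// ler_peMr// ?ler1n// ltW.
have e_0 : e_ @ \oo --> 0.
  rewrite -[X in _ --> X](mulr0 m); apply: cvgM; first exact: cvg_cst.
  exact: cvg_harmonic.
pose phi n x := ramp_at a (e_ n) x - ramp_at b (e_ n) x.
have tphi n : test_function (phi n).
  by apply: test_bump => //; have := em n; have := e0 n; lra.
pose D := `[a, b + 2 * m]%classic.
have mD : measurable D by exact: measurable_itv.
have gD : mu.-integrable D (EFin \o g) by apply: locally_integrable_itv => //; lra.
have DI : D `<=` I01 by apply: subset_itv; rewrite bnd_simp; lra.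
have phi1 n x : `|phi n x| <= 1.
  have /andP[h1 h2] := ramp_itv ((x - a) / e_ n).
  have /andP[h3 h4] := ramp_itv ((x - b) / e_ n).
  by rewrite /phi /ramp_at ler_norml; apply/andP; split; lra.
have mphi n : measurable_fun D (phi n).
  apply: continuous_measurable => // x.
  by apply: cvgB; apply: dcts (is_derive_ramp_at _ _ _).
have mg : measurable_fun D g by apply/measurable_EFinP; exact: measurable_int gD.
pose chi x : R := if a < x <= b then 1 else 0.
have mchi : measurable_fun D chi.
  rewrite (_ : chi = \1_(`]a, b]%classic)); first exact: measurable_indic.
  apply/funext => x; rewrite /chi indicE; case: ifPn => xab.
    by rewrite mem_set//= in_itv.
  by rewrite memNset//= in_itv/=; apply/negP.
have phichi x : phi n x @[n --> \oo] --> chi x.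
  apply: (@cvg_trans _ (chi x @[n --> \oo])); last exact: cvg_cst.
  apply: near_eq_cvg.
  have eN d : 0 < d -> \forall n \near \oo, 2 * e_ n <= d.
    move=> d0; have : \forall n \near \oo, e_ n < d / 2.
      move/cvgrPdist_lt : e_0 => /(_ (d / 2)); rewrite divr_gt0// => /(_ isT).
      by apply: filterS => n; rewrite sub0r normrN gtr0_norm.
    by apply: filterS => n; rewrite ltr_pdivlMr// mulrC => /ltW.
  rewrite /chi /phi /ramp_at; have [xa|xa] := leP x a => /=.
    apply: nearW => n; rewrite !ramp0 ?subrr//.
      by rewrite ler_pdivrMr// mul0r; lra.
    by rewrite ler_pdivrMr// mul0r; lra.
  have [xb|xb] := leP x b.
    have xa0 : 0 < x - a by lra.
    apply: filterS (eN _ xa0) => n en; rewrite ramp1 ?ramp0 ?subr0//.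
      by rewrite ler_pdivrMr// mul0r; lra.
    by rewrite ler_pdivlMr.
  have xb0 : 0 < x - b by lra.
  apply: filterS (eN _ xb0) => n en; rewrite !ramp1 ?subrr//.
    by rewrite ler_pdivlMr.
  by rewrite ler_pdivlMr//; lra.
have lim1 : \int[mu]_(x in I01) (g x * phi n x) @[n --> \oo] -->
    \int[mu]_(x in `[a, b]) g x.
  have -> : \int[mu]_(x in `[a, b]) g x = \int[mu]_(x in D) (g x * chi x).
    rewrite [RHS](@Rintegral_support _ _ (`]a, b]%classic)); last 2 first.
    - by apply: subset_itv; rewrite bnd_simp; lra.
    - by move=> x _; rewrite /= in_itv/= /chi => /negP/negbTE->; rewrite mulr0.
    rewrite -Rintegral_itv_obnd_cbnd; last first.
      apply: integrableS gD => //.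
      by apply: subset_itv; rewrite bnd_simp; lra.
    apply: eq_Rintegral => x; rewrite inE/= in_itv/= /chi => ->.
    by rewrite mulr1.
  have -> : (fun n => \int[mu]_(x in I01) (g x * phi n x)) =
      (fun n => \int[mu]_(x in D) (g x * phi n x)).
    apply/funext => n; apply: Rintegral_support => // x _.
    rewrite /D /= in_itv/= => /negP; rewrite negb_and -!ltNge /phi /ramp_at.
    move=> /orP[xa|xa].
      rewrite !ramp0 ?subrr ?mulr0//; rewrite ler_pdivrMr// mul0r; lra.
    have := em n; have := e0 n => ? ?.
    rewrite !ramp1 ?subrr ?mulr0//; rewrite ler_pdivlMr//; lra.
  apply: (@Rdominated_cvg _ D _ _ (fun x => `|g x|)) => //.
  - by move=> n; exact: measurable_funM.
  - exact: measurable_funM.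
  - by move=> x _; apply: cvgM; [exact: cvg_cst|exact: phichi].
  - exact: integrable_norm.
  - by move=> n x _; rewrite normrM ler_piMr.
have uhi c n : 0 < c - 3 * e_ n -> c + 3 * e_ n < 1 ->
    mu.-integrable I01 (EFin \o (fun x => u x * hat_at c (e_ n) x)).
  move=> c0 c1; have en0 := e0 n.
  have uC : mu.-integrable `[c, c + 2 * e_ n] (EFin \o u).
    by apply: locally_integrable_itv => //; lra.
  have sub : `[c, c + 2 * e_ n] `<=` I01 by apply: subset_itv; rewrite bnd_simp; lra.
  have : mu.-integrable `[c, c + 2 * e_ n] (EFin \o (fun x => u x * hat_at c (e_ n) x)).
    apply: (@integrable_mul_bounded _ _ _ _ (e_ n)^-1) => //.
      by apply: continuous_measurable => //; exact: continuous_hat_at.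
    move=> x _; have /andP[h0 h1] := hat_at_itv c x en0.
    by rewrite ger0_norm.
  rewrite integrable_mkcond// => h; rewrite integrable_mkcond//.
  apply: eq_integrable h => // x _; rewrite !patchE.
  have [xC|xC] := boolP (x \in `[c, c + 2 * e_ n]%classic).
    by rewrite mem_set//; apply: sub; exact: set_mem.
  case: ifPn => // _; rewrite /= hat_at_out ?mulr0// => h'.
  by move/negP: xC; apply; apply: mem_set; rewrite /= in_itv.
have lim2 : \int[mu]_(x in I01) (u x * derive1 (phi n) x) @[n --> \oo] -->
    u a - u b.
  have -> : (fun n => \int[mu]_(x in I01) (u x * derive1 (phi n) x)) =
      (fun n => \int[mu]_(x in I01) (u x * hat_at a (e_ n) x) -
                \int[mu]_(x in I01) (u x * hat_at b (e_ n) x)).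
    apply/funext => n; have en := em n; have en0 := e0 n.
    rewrite -RintegralB//.
    - by apply: eq_Rintegral => x _; rewrite derive1_bump mulrBr.
    - by apply: uhi; lra.
    - by apply: uhi; lra.
  apply: cvgB; apply: hat_average_cvg => //;
    by move=> n; have en := em n; have en0 := e0 n; lra.
have lim3 : (- \int[mu]_(x in I01) (g x * phi n x)) @[n --> \oo] --> u a - u b.
  by under eq_fun do rewrite -(ug _ (tphi _)).
have E := cvg_unique (@Rhausdorff R) (cvgN lim1) lim3.
by apply: oppr_inj; rewrite opprB; exact: E.
Qed.

End WeakDerivatives.

(** * Square integrable functions and weak derivatives *)

Section SobolevRepresentation.
Context {R : realType}.
Implicit Types (u v f g : R -> R) (a b e x : R).
Local Notation mu := (@lebesgue_measure R).
Local Notation I01 := (`]0, 1[%classic : set R).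

Lemma Lnorm2E w :
  ('N[mu]_2%:E[EFin \o (w \_ I01)] `^ 2 = \int[mu]_(x in I01) (w x ^+ 2)%:E)%E.
Proof.
rewrite powR_Lnorm// [RHS]integral_mkcond/=; apply: eq_integral => x _.
rewrite /= !patchE; case: ifP => _ /=.
  by rewrite powR_mulrn// real_normK// num_real.
by rewrite normr0 powR0// pnatr_eq0.
Qed.

Lemma L2_measurable u : L2 u -> measurable_fun I01 u.
Proof.
rewrite /L2 inE => /andP[mu _]; move: mu; rewrite inE/= => mu.
by apply/(measurable_restrictT _ _).2.
Qed.

Lemma L2_sqr u : L2 u -> mu.-integrable I01 (EFin \o (fun x => u x ^+ 2)).
Proof.
move=> /Lfun2_integrable_sqr h; rewrite integrable_mkcond//.
apply: eq_integrable h => // x _; rewrite /= !patchE.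
by case: ifP => //; rewrite expr0n.
Qed.

Lemma integrable_cst (D : set R) c : measurable D -> (mu D < +oo)%E ->
  mu.-integrable D (EFin \o cst c).
Proof.
move=> mD Dy; apply/integrableP; split; first exact/measurable_EFinP.
by rewrite /= integral_cst// lte_mul_pinfty.
Qed.

Lemma integrable_sqr_integrable (D : set R) u : measurable D -> (mu D < +oo)%E ->
  measurable_fun D u -> mu.-integrable D (EFin \o (fun x => u x ^+ 2)) ->
  mu.-integrable D (EFin \o u).
Proof.
move=> mD Dy mu' u2; have c1 := integrable_cst 1 mD Dy.
apply: (@le_integrable _ _ _ mu D mD _ ((EFin \o cst 1%R) \+ (EFin \o (fun x => u x ^+ 2)%R))%E) => //.
- exact/measurable_EFinP.
- move=> x Dx /=; rewrite lee_fin ler_norml.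
  have h := sqr_ge0 (u x); rewrite [in X in _ && X]ger0_norm ?addr_ge0//.
  rewrite ger0_norm ?addr_ge0//.
  by case: (ger0P (u x)) => ?; apply/andP; split; nra.
- exact: integrableD.
Qed.

Lemma mu_I01_lty : (mu I01 < +oo)%E.
Proof. by rewrite lebesgue_measure_itv/= lte_fin ltr01 -EFinD ltry. Qed.

Lemma L2_integrable u : L2 u -> mu.-integrable I01 (EFin \o u).
Proof.
move=> Lu; apply: integrable_sqr_integrable => //.
- exact: mu_I01_lty.
- exact: L2_measurable.
- exact: L2_sqr.
Qed.

Lemma L2_of_sqr u : measurable_fun I01 u ->
  (\int[mu]_(x in I01) (u x ^+ 2)%:E < +oo)%E -> L2 u.
Proof.
move=> mu'; rewrite -Lnorm2E => h; rewrite /L2 inE; apply/andP; split; rewrite inE/=.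
  by apply/(measurable_restrictT _ _).1.
exact: lty_poweRy h.
Qed.

Lemma L2_bounded u (M : R) : measurable_fun I01 u ->
  (forall x, I01 x -> `|u x| <= M) -> L2 u.
Proof.
move=> mu' uM; have cM := integrable_cst (M ^+ 2) (measurable_itv _) mu_I01_lty.
apply: L2_of_sqr => //; apply: le_lt_trans (integrable_lty _ cM) => //.
apply: ge0_le_integral => //=.
- by move=> x _; rewrite lee_fin sqr_ge0.
- by apply/measurable_EFinP; exact: measurable_funX.
- exact/measurable_EFinP.
- move=> x; rewrite ?inE => xI; rewrite /= lee_fin -[u x ^+ 2]real_normK ?num_real//.
  by rewrite ler_sqr ?nnegrE ?uM// (le_trans _ (uM _ xI)).
Qed.

(** Both sides are recovered almost everywhere by differentiating their
    integrals; the unit interval is exhausted by compact intervals because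
    integrability is only local. *)
Lemma ae_eq_interval_integrals f g :
  locally_integrable I01 f -> locally_integrable I01 g ->
  (forall a b, 0 < a -> a < b -> b < 1 ->
    \int[mu]_(x in `[a, b]) f x = \int[mu]_(x in `[a, b]) g x) ->
  {ae mu, forall x, I01 x -> f x = g x}.
Proof.
move=> lf lg fg; pose h x := f x - g x.
pose a_ n : R := n.+3%:R^-1; pose b_ n : R := 1 - a_ n.
have a0 n : 0 < a_ n by rewrite invr_gt0.
have a3 n : a_ n <= 3^-1 by rewrite lef_pV2 ?posrE// ler_nat.
have ib a b : 0 < a -> b < 1 -> mu.-integrable `[a, b] (EFin \o h).
  move=> a_0 b_1.
  have k : mu.-integrable `[a, b] ((EFin \o f) \- (EFin \o g))%E.
    by apply: integrableB => //; apply: locally_integrable_itv.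
  by apply: eq_integrable k.
have step n : {ae mu, forall x, a_ n < x < b_ n -> f x = g x}.
  pose H := h \_ `[a_ n, b_ n].
  have iH : mu.-integrable setT (EFin \o H).
    have : mu.-integrable `[a_ n, b_ n] (EFin \o h) by apply: ib; rewrite ?ltrBlDr ?ltrDl.
    by rewrite integrable_mkcond// restrict_EFin.
  have lH : locally_integrable setT H by apply: open_integrable_locally => //; exact: openT.
  have := @FTC1 R H (BLeft (a_ n)).
  case=> [y|//|/=].
    by apply: integrableS iH.
  move=> N [mN N0 Nsub]; exists N; split => // x /= /not_implyP[/andP[ax bx] fgx].
  apply: Nsub => /= Hx; apply: fgx.
  have [|_ HE] := Hx; first by rewrite lte_fin.
  apply/eqP; rewrite -subr_eq0; apply/eqP.
  have HxE : H x = h x by rewrite /H patchE mem_set//= in_itv/= !ltW.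
  rewrite -[LHS]HxE -HE; apply: d1E.
  nref (@dnear _ (fun=> 0) _ _ _ _ (dcst _ _)).
  near=> y.
  have ya : a_ n < y by near: y; exact: lt_nbhsr.
  have yb : y < b_ n by near: y; exact: lt_nbhsl.
  have -> : \int[mu]_(t in `[a_ n, y]) H t = \int[mu]_(t in `[a_ n, y]) h t.
    apply: eq_Rintegral => t; rewrite inE/= in_itv/= => /andP[ta ty].
    by rewrite /H patchE mem_set//= in_itv/= ta (le_trans ty)// ltW.
  have y1 : y < 1 by apply: lt_trans yb _; rewrite ltrBlDr ltrDl.
  rewrite RintegralB//; last 2 first.
  - exact: locally_integrable_itv.
  - exact: locally_integrable_itv.
  by rewrite fg// subrr.
have /ae_foralln : forall n, {ae mu, forall x, a_ n < x < b_ n -> f x = g x} by [].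
apply: filterS => x hx; rewrite /= in_itv/= => /andP[x0 x1].
pose n := Num.bound (x^-1 + (1 - x)^-1).
have x'0 : 0 < 1 - x by rewrite subr_gt0.
have nx : x^-1 + (1 - x)^-1 < n.+3%:R.
  apply: (@lt_trans _ _ n%:R); last by rewrite ltr_nat -{1}[n]addn0 -addn3 ltn_add2l.
  by apply: archi_boundP; rewrite addr_ge0// invr_ge0 ltW.
have xi : 0 < x^-1 by rewrite invr_gt0.
have xi' : 0 < (1 - x)^-1 by rewrite invr_gt0.
have an e : 0 < e -> e^-1 < n.+3%:R -> a_ n < e.
  by move=> e0 h1; rewrite -[e]invrK ltf_pV2 ?posrE ?invr_gt0.
have a1 : a_ n < x by apply: an => //; lra.
have a2 : a_ n < 1 - x by apply: an => //; lra.
by apply: (hx n); rewrite a1/= /b_; lra.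
Unshelve. all: by end_near. Qed.

Lemma is_weak_deriv_ae u u' g : {ae mu, forall x, I01 x -> u x = u' x} ->
  locally_integrable I01 u' -> is_weak_deriv u g -> is_weak_deriv u' g.
Proof.
move=> uu' lu' [lu lg ug]; split=> // phi tphi; rewrite -ug//.
congr fine; apply: ae_eq_integral => //.
- apply/measurable_EFinP; apply: measurable_funM; first by case: lu'.
  by apply: continuous_measurable => //; case: tphi.
- apply/measurable_EFinP; apply: measurable_funM; first by case: lu.
  by apply: continuous_measurable => //; case: tphi.
- apply: (@filterS _ _ (ae_filter_ringOfSetsType mu) _ _ _ uu') => x h Ix /=.
  by rewrite (h Ix).
Qed.

Lemma is_weak_deriv_eq u u' g g' : (forall x, I01 x -> u x = u' x) ->
  (forall x, I01 x -> g x = g' x) -> is_weak_deriv u g -> is_weak_deriv u' g'.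
Proof.
move=> uu' gg' [[mu1 o1 k1] [mg1 _ k2] ug].
split.
- split=> //.
    by apply: eq_measurable_fun mu1 => x; rewrite inE => /uu'.
  move=> K KI cK; rewrite (_ : (\int[mu]_(x in K) _)%E = (\int[mu]_(x in K) `|u x|%:E)%E); first exact: k1.
  by apply: eq_integral => x; rewrite inE => /KI/uu' ->.
- split=> //.
    by apply: eq_measurable_fun mg1 => x; rewrite inE => /gg'.
  move=> K KI cK; rewrite (_ : (\int[mu]_(x in K) _)%E = (\int[mu]_(x in K) `|g x|%:E)%E); first exact: k2.
  by apply: eq_integral => x; rewrite inE => /KI/gg' ->.
- move=> phi tphi.
  have -> : \int[mu]_(x in I01) (u' x * derive1 phi x) =
      \int[mu]_(x in I01) (u x * derive1 phi x).
    by apply: eq_Rintegral => x; rewrite inE => /uu' ->.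
  have -> : \int[mu]_(x in I01) (g' x * phi x) = \int[mu]_(x in I01) (g x * phi x).
    by apply: eq_Rintegral => x; rewrite inE => /gg' ->.
  exact: ug.
Qed.

(** Points of continuity are Lebesgue points. *)
Lemma weak_deriv_FTC u g a b : (forall x, I01 x -> {for x, continuous u}) ->
  is_weak_deriv u g -> 0 < a -> a < b -> b < 1 ->
  \int[mu]_(x in `[a, b]) g x = u b - u a.
Proof.
move=> cu ug a0 ab b1; have [[mu1 o1 _] _ _] := ug.
have lp x : 0 < x -> x < 1 -> lebesgue_pt u x.
  move=> x0 x1; have xI : I01 x by rewrite /= in_itv/= x0.
  by apply: (@continuous_lebesgue_pt _ _ _ I01) => //; exact: cu.
by apply: weak_deriv_FTC_lebesgue_pt => //; apply: lp; lra.
Qed.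

End SobolevRepresentation.

(** * Primitives of integrable functions *)

Section Primitives.
Context {R : realType}.
Implicit Types (P u v f g : R -> R) (a b c x y : R).
Local Notation mu := (@lebesgue_measure R).

Lemma Rintegral_chasles f a b c : a <= b -> b <= c ->
  mu.-integrable `[a, c] (EFin \o f) ->
  \int[mu]_(x in `[a, c]) f x =
  \int[mu]_(x in `[a, b]) f x + \int[mu]_(x in `[b, c]) f x.
Proof.
move=> ab bc fi.
have := @Rintegral_itvB _ f (BLeft a) (BRight c) b fi.
rewrite !bnd_simp => /(_ ab bc) => E.
rewrite -(@Rintegral_itv_obnd_cbnd _ b); last first.
  by apply: integrableS fi => //; apply: subset_itv; rewrite bnd_simp.
by rewrite -E addrC subrK.
Qed.

(** [P] is absolutely continuous with density [f]. *)
Definition primitive_on a b P f : Prop :=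
  mu.-integrable `[a, b] (EFin \o f) /\
  forall x y, a <= x -> x <= y -> y <= b ->
    \int[mu]_(t in `[x, y]) f t = P y - P x.

Lemma primitive_on_sub a b c d P f : a <= c -> d <= b ->
  primitive_on a b P f -> primitive_on c d P f.
Proof.
move=> ac db [fi fP]; split.
  by apply: integrableS fi => //; apply: subset_itv; rewrite bnd_simp.
by move=> x y cx xy yd; apply: fP => //; [exact: le_trans cx|exact: le_trans db].
Qed.

Lemma primitive_within a b P f : a <= b -> primitive_on a b P f ->
  {within `[a, b], continuous P}.
Proof.
move=> ab [fi fP].
have := parameterized_integral_continuous ab fi.
move=> h; apply: (@subspace_eq_continuous _ _ _
    (fun x => P a + parameterized_integral mu a x f)); last first.
  by move=> x; apply: cvgD; [exact: cvg_cst|exact: h].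
move=> x; rewrite inE/= in_itv/= => /andP[ax xb].
by rewrite /parameterized_integral fP// addrC subrK.
Qed.

Lemma primitive_itv a b P f x : primitive_on a b P f -> a < x -> x < b ->
  {for x, continuous P}.
Proof.
move=> /[dup] Pf [_ _] ax xb; have ab := lt_trans ax xb.
apply: (within_continuous_continuous ab (primitive_within (ltW ab) Pf)).
by rewrite in_itv/= ax.
Qed.

Lemma primitive_of_integral a b c f :
  mu.-integrable `[a, b] (EFin \o f) ->
  primitive_on a b (fun x => c + \int[mu]_(t in `[a, x]) f t) f.
Proof.
move=> fi; split=> // x y ax xy yb.
rewrite (@Rintegral_chasles _ a x y)//; first by ring.
by apply: integrableS fi => //; apply: subset_itv; rewrite bnd_simp.
Qed.

Lemma primitive_continuous_derive a b P f x :
  primitive_on a b P f -> {for x, continuous f} -> a < x -> x < b ->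
  is_derive x 1 P (f x).
Proof.
move=> [fi fP] fx ax xb.
have [dF FE] := @continuous_FTC1_closed R f a x b xb fi ax fx.
 apply: (@dnear _ (fun y => P a + \int[mu]_(t in `[a, y]) f t)).
  near=> y; rewrite fP ?lexx//; first by rewrite addrC subrK.
    by apply/ltW; near: y; exact: lt_nbhsr.
  by apply/ltW; near: y; exact: lt_nbhsl.
nref (deq (dD (dcst _ _) (DeriveDef dF _)) _); first by reflexivity.
by rewrite add0r -derive1E FE.
Unshelve. all: by end_near. Qed.

End Primitives.

(** * Functions in H^2 as iterated primitives *)

Section H2Representation.
Context {R : realType}.
Implicit Types (P u v f g : R -> R) (a b e x : R).
Local Notation mu := (@lebesgue_measure R).
Local Notation I01 := (`]0, 1[%classic : set R).

Lemma wderivP u : (exists g, is_weak_deriv u g) -> is_weak_deriv u (wderiv u).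
Proof. exact: xgetPex. Qed.

Lemma ae_exists_I01 (Q : R -> Prop) : {ae mu, forall x, Q x} ->
  exists2 x, I01 x & Q x.
Proof.
move=> [N [mN N0 QN]]; apply: contrapT => h.
have IN : I01 `<=` N.
  by move=> x Ix; apply: QN => /= Qx; apply: h; exists x.
have : (mu I01 <= mu N)%E by apply: le_measure => //; rewrite inE.
by rewrite N0 lebesgue_measure_itv/= lte_fin ltr01 -EFinD lee_fin subr0 ler10.
Qed.

Lemma I01_cc : I01 `<=` `[0, 1].
Proof. by apply: subset_itv; rewrite bnd_simp. Qed.

Lemma integrable_I01_cc f : mu.-integrable I01 (EFin \o f) ->
  mu.-integrable `[0, 1] (EFin \o (f \_ I01)).
Proof.
move=> fi; have : mu.-integrable setT (EFin \o (f \_ I01)).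
  by rewrite -restrict_EFin -integrable_mkcond.
by move=> h; apply: integrableS h.
Qed.

(** Almost every point is a Lebesgue point; one of them fixes the constant of
    integration and the others then follow. *)
Lemma weak_deriv_primitive g f : mu.-integrable I01 (EFin \o g) ->
  mu.-integrable I01 (EFin \o f) -> is_weak_deriv g f ->
  exists2 P, primitive_on 0 1 P (f \_ I01) &
    {ae mu, forall x, I01 x -> g x = P x}.
Proof.
move=> gi fi gf; set f1 := f \_ I01; pose g1 := g \_ I01.
have f1i := integrable_I01_cc fi.
have lg1 : locally_integrable setT g1 by exact: integrable_locally_restrict.
have g1f : is_weak_deriv g1 f1.
  by apply: is_weak_deriv_eq gf => x Ix; rewrite /g1 /f1 patchE mem_set.
have leb := lebesgue_differentiation lg1.
have [a0 Ia0 la0] := ae_exists_I01 leb.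
have [a00 a01] : 0 < a0 /\ a0 < 1 by move: Ia0; rewrite /= in_itv/= => /andP[].
pose P x := (g1 a0 - \int[mu]_(t in `[0, a0]) f1 t) + \int[mu]_(t in `[0, x]) f1 t.
have Pf : primitive_on 0 1 P f1 by exact: primitive_of_integral.
exists P => //; apply: (@filterS _ _ (ae_filter_ringOfSetsType mu) _ _ _ leb) => x lx Ix.
have [x0 x1] : 0 < x /\ x < 1 by move: Ix; rewrite /= in_itv/= => /andP[].
have -> : g x = g1 x by rewrite /g1 patchE mem_set.
have Pa0 : P a0 = g1 a0 by rewrite /P subrK.
have [xa|xa|->//] := ltgtP x a0.
  have := weak_deriv_FTC_lebesgue_pt g1f x0 xa a01 lx la0.
  by rewrite (Pf.2 _ _ (ltW x0) (ltW xa) (ltW a01)) Pa0 => /addrI/oppr_inj.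
have := weak_deriv_FTC_lebesgue_pt g1f a00 xa x1 la0 lx.
by rewrite (Pf.2 _ _ (ltW a00) (ltW xa) (ltW x1)) Pa0 => /addIr.
Qed.

Lemma weak_deriv_uniq u g1 g2 : (forall x, I01 x -> {for x, continuous u}) ->
  is_weak_deriv u g1 -> is_weak_deriv u g2 ->
  {ae mu, forall x, I01 x -> g1 x = g2 x}.
Proof.
move=> cu ug1 ug2; apply: ae_eq_interval_integrals.
- by case: ug1.
- by case: ug2.
- by move=> a b a0 ab b1; rewrite (weak_deriv_FTC cu ug1)// (weak_deriv_FTC cu ug2).
Qed.

(** Continuity carries the identity from the compact subintervals to the closed
    interval. *)
Lemma primitive_closure v P : {within `[0, 1], continuous v} ->
  {within `[0, 1], continuous P} ->
  (forall a b, 0 < a -> a < b -> b < 1 ->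
    \int[mu]_(x in `[a, b]) P x = v b - v a) ->
  primitive_on 0 1 v P.
Proof.
move=> cv cP vP.
have Pi : mu.-integrable `[0, 1] (EFin \o P) by exact: continuous_integrable.
split => // x y x0; rewrite le_eqVlt => /predU1P[->|xy] y1.
  by rewrite set_itv1 Rintegral_set1 subrr.
pose V := fun x => v x - \int[mu]_(t in `[0, x]) P t.
have cV : {within `[0, 1], continuous V}.
  move=> t; apply: cvgB; first exact: cv.
  exact: (parameterized_integral_continuous ler01 Pi).
have prim := primitive_of_integral 0 Pi.
have Veq a b : 0 < a -> a < b -> b < 1 -> V a = V b.
  move=> a0 ab b1; have := prim.2 _ _ (ltW a0) (ltW ab) (ltW b1).
  by rewrite vP// /V !add0r; lra.
have VE : V x = V y.
  apply: cst_is_derive (ltW xy) _ _; last first.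
    apply: continuous_subspaceW cV.
    by apply: subset_itv; rewrite bnd_simp.
  move=> t /andP[xt ty].
  have t0 : 0 < t by apply: le_lt_trans xt.
  have t1 : t < 1 by apply: lt_le_trans y1.
  nref (@dnear _ (fun=> V t) _ _ _ _ (dcst _ _)).
  near=> s.
  have s0 : 0 < s by near: s; exact: lt_nbhsr.
  have s1 : s < 1 by near: s; exact: lt_nbhsl.
  by have [st|st|->//] := ltgtP s t; [rewrite (@Veq s t)|rewrite (@Veq t s)].
have := prim.2 _ _ x0 (ltW xy) y1; rewrite !add0r => ->.
by move: VE; rewrite /V; lra.
Unshelve. all: by end_near. Qed.

Lemma powR_3_2 (t : R) : (1 + t ^+ 2) `^ (3 / 2) = speed t ^+ 3.
Proof.
have t1 : 0 <= 1 + t ^+ 2 by rewrite addr_ge0// sqr_ge0.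
by rewrite mulrC powRrM powR12_sqrt// powR_mulrn ?sqrtr_ge0.
Qed.

Lemma energy_densityE (z t : R) : (z / (1 + t ^+ 2) `^ (3 / 2)) ^+ 2 *
  Num.sqrt (1 + t ^+ 2) = z ^+ 2 * (speed t)^-1 ^+ 5.
Proof.
by rewrite powR_3_2 -/(speed t); field; rewrite gt_eqF// speed_gt0.
Qed.

Lemma invspeed_itv (t : R) : 0 < (speed t)^-1 <= 1.
Proof.
rewrite invr_gt0 speed_gt0/= invf_le1 ?speed_gt0//.
by rewrite -[leLHS]sqrtr1 ler_wsqrtr// lerDl sqr_ge0.
Qed.

Lemma continuous_invspeed5 : continuous (fun t : R => (speed t)^-1 ^+ 5).
Proof.
move=> t; apply: (@continuous_comp _ _ _ (fun t => (speed t)^-1) (fun x => x ^+ 5)).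
  by apply: cvgV; [rewrite gt_eqF// speed_gt0|exact: continuous_speed].
exact: exprn_continuous.
Qed.

Lemma measurable_energy_density (D : set R) f P : measurable D ->
  measurable_fun D f -> measurable_fun D P ->
  measurable_fun D (fun x => f x ^+ 2 * (speed (P x))^-1 ^+ 5).
Proof.
move=> mD mf mP; apply: measurable_funM; first exact: measurable_funX.
apply: (@measurableT_comp _ _ _ _ _ _ (fun t : R => (speed t)^-1 ^+ 5)) => //.
exact: continuous_measurable_fun continuous_invspeed5.
Qed.

Lemma integrable_energy_density (D : set R) f P : measurable D ->
  measurable_fun D P ->
  mu.-integrable D (EFin \o (fun x => f x ^+ 2)) ->
  mu.-integrable D (EFin \o (fun x => f x ^+ 2 * (speed (P x))^-1 ^+ 5)).
Proof.
move=> mD mP f2; apply: (@integrable_mul_bounded _ D (fun x => f x ^+ 2) _ 1) => //.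
  apply: (@measurableT_comp _ _ _ _ _ _ (fun t : R => (speed t)^-1 ^+ 5)) => //.
  exact: continuous_measurable_fun continuous_invspeed5.
move=> x _; have /andP[s0 s1] := invspeed_itv (P x).
by rewrite ger0_norm ?exprn_ge0 ?(ltW s0)// exprn_ile1// ltW.
Qed.

(** The weak derivatives selected by [wderiv] agree almost everywhere with [P]
    and [f], so the energy can be computed from these. *)
Lemma elastic_energyE v P f : (forall x, I01 x -> {for x, continuous v}) ->
  (forall x, I01 x -> {for x, continuous P}) -> is_weak_deriv v P ->
  is_weak_deriv P f -> mu.-integrable I01 (EFin \o (fun x => f x ^+ 2)) ->
  elastic_energy v =
    (\int[mu]_(x in I01) (f x ^+ 2 * (speed (P x))^-1 ^+ 5))%:E.
Proof.
move=> cvI cPI vP Pf f2.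
have vw : is_weak_deriv v (wderiv v) by apply: wderivP; exists P.
have wP := weak_deriv_uniq cvI vP vw.
have wf : is_weak_deriv (wderiv v) f.
  by apply: (is_weak_deriv_ae wP) => //; case: vw.
have ww : is_weak_deriv (wderiv v) (wderiv (wderiv v)) by apply: wderivP; exists f.
have wP' : {ae mu, forall x, I01 x -> wderiv v x = P x}.
  by apply: (@filterS _ _ (ae_filter_ringOfSetsType mu) _ _ _ wP) => x h Ix; rewrite (h Ix).
have wwf : {ae mu, forall x, I01 x -> wderiv (wderiv v) x = f x}.
  have lP : locally_integrable I01 P by case: vP.
  exact: (weak_deriv_uniq cPI (is_weak_deriv_ae wP' lP ww) Pf).
have mP : measurable_fun (I01 : set R) P by case: vP => _ [].
have ei := integrable_energy_density (measurable_itv _) mP f2.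
rewrite /Rintegral fineK; last exact: integrable_fin_num.
apply: ae_eq_integral => //.
- apply/measurable_EFinP.
  rewrite (_ : (fun x => _) = (fun x => wderiv (wderiv v) x ^+ 2 * (speed (wderiv v x))^-1 ^+ 5)); last first.
    by apply/funext => x; exact: energy_densityE.
  apply: measurable_energy_density => //; first by case: ww => _ [].
  by case: vw => _ [].
- exact: (measurable_int _ ei).
- apply: (@filterS2 _ _ (ae_filter_ringOfSetsType mu) _ _ _ _ wP' wwf) => x h1 h2 Ix /=.
  by rewrite energy_densityE (h1 Ix) (h2 Ix).
Qed.

(** The weak derivative of [v] is weakly differentiable in its turn, hence agrees
    almost everywhere with the primitive [P] of the second one, and [v] is then a
    primitive of the continuous function [P]. *)
Lemma H2_repr v : {within `[0, 1], continuous v} -> Hsob 2 v ->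
  exists P f, [/\ primitive_on 0 1 v P, primitive_on 0 1 P f,
    mu.-integrable `[0, 1] (EFin \o (fun x => f x ^+ 2)) &
    elastic_energy v =
      (\int[mu]_(x in `[0, 1]) (f x ^+ 2 * (speed (P x))^-1 ^+ 5))%:E].
Proof.
move=> cv [_ [g vg [Lg [f gf Lf]]]].
have cvI x : I01 x -> {for x, continuous v}.
  exact: (within_continuous_continuous ltr01 cv).
have [P Pf gP] := weak_deriv_primitive (L2_integrable Lg) (L2_integrable Lf) gf.
have cP := primitive_within ler01 Pf.
have cPI x : I01 x -> {for x, continuous P}.
  exact: (within_continuous_continuous ltr01 cP).
have Pi : mu.-integrable `[0, 1] (EFin \o P) by exact: continuous_integrable.
have PI : mu.-integrable I01 (EFin \o P) by apply: integrableS Pi => //; exact: I01_cc.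
have lP : locally_integrable I01 P.
  by apply: open_integrable_locally => //; exact: interval_open.
have vP : is_weak_deriv v P.
  have [lv lg vg'] := vg; split => // phi tphi; rewrite vg'//; congr (- _).
  congr fine; apply: ae_eq_integral => //.
  - apply/measurable_EFinP; apply: measurable_funM; first by case: lg.
    apply: continuous_measurable => // x; case: tphi => dphi _ _.
    exact/differentiable_continuous/derivable1_diffP.
  - apply/measurable_EFinP; apply: measurable_funM; first by case: lP.
    apply: continuous_measurable => // x; case: tphi => dphi _ _.
    exact/differentiable_continuous/derivable1_diffP.
  - apply: (@filterS _ _ (ae_filter_ringOfSetsType mu) _ _ _ gP) => x h Ix /=.
    by rewrite (h Ix).
have f2 : mu.-integrable `[0, 1] (EFin \o (fun x => (f \_ I01) x ^+ 2)).
  have h := integrable_I01_cc (L2_sqr Lf).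
  apply: eq_integrable h => // x _; rewrite /= !patchE.
  by case: ifP => //; rewrite expr0n.
exists P, (f \_ I01); split => //.
- apply: primitive_closure => // a b a0 ab b1.
  exact: (weak_deriv_FTC cvI vP).
- have Pf' : is_weak_deriv P f by exact: (is_weak_deriv_ae gP).
  rewrite (elastic_energyE cvI cPI vP Pf' (L2_sqr Lf)).
  have mP := subspace_continuous_measurable_fun (measurable_itv _) cP.
  have ei := integrable_energy_density (measurable_itv _) mP f2.
  congr (_%:E); rewrite [RHS]/Rintegral integral_itv_bndoo; last first.
    apply: measurable_funS (measurable_int _ ei) => //; exact: I01_cc.
  by congr fine; apply: eq_integral => x Ix; rewrite patchE Ix.
Qed.

End H2Representation.

(** * Integrability of combinations *)

Section RealIntegrability.
Context {R : realType}.
Implicit Types (f g : R -> R) (c : R) (D : set R).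
Local Notation mu := (@lebesgue_measure R).

Lemma rintegrableZ D c f : measurable D -> mu.-integrable D (EFin \o f) ->
  mu.-integrable D (EFin \o (fun x => c * f x)).
Proof.
move=> mD fi; have k : mu.-integrable D (fun x => c%:E * (EFin \o f) x)%E.
  exact: integrableZl.
by apply: eq_integrable k.
Qed.

Lemma rintegrableD D f g : measurable D -> mu.-integrable D (EFin \o f) ->
  mu.-integrable D (EFin \o g) -> mu.-integrable D (EFin \o (fun x => f x + g x)).
Proof.
move=> mD fi gi; have k : mu.-integrable D ((EFin \o f) \+ (EFin \o g))%E.
  exact: integrableD.
by apply: eq_integrable k.
Qed.

Lemma rintegrableB D f g : measurable D -> mu.-integrable D (EFin \o f) ->
  mu.-integrable D (EFin \o g) -> mu.-integrable D (EFin \o (fun x => f x - g x)).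
Proof.
move=> mD fi gi; have k : mu.-integrable D ((EFin \o f) \- (EFin \o g))%E.
  exact: integrableB.
by apply: eq_integrable k.
Qed.

Lemma rintegrable_eq D f g : measurable D -> (forall x, D x -> f x = g x) ->
  mu.-integrable D (EFin \o f) -> mu.-integrable D (EFin \o g).
Proof.
move=> mD fg fi; apply: eq_integrable fi => // x; rewrite inE => Dx /=.
by rewrite fg.
Qed.

End RealIntegrability.

(** * The chain rule for absolutely continuous functions *)

Section ChainRule.
Context {R : realType}.
Implicit Types (P Q f d : R -> R) (a b c x y z p q e : R).
Local Notation mu := (@lebesgue_measure R).

(** Real induction: the supremum of the points that can be reached from [a] can
    itself be passed unless it is [b]. *)
Lemma interval_induction (T : R -> R -> Prop) a b : a <= b ->
  (forall x y z, T x y -> T y z -> T x z) ->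
  (forall x, a <= x <= b -> exists2 e, 0 < e & forall y z, a <= y -> y <= x ->
    x <= z -> z <= b -> x - e < y -> z < x + e -> T y z) ->
  T a b.
Proof.
move=> ab Ttr loc.
pose A := [set x | a <= x <= b /\ T a x].
have Aa : A a.
  split; first by rewrite lexx ab.
  have [|e e0 h] := loc a; first by rewrite lexx ab.
  by apply: h => //; rewrite ?ltrBlDr ltrDl.
have Aub : has_ubound A by exists b => x [/andP[]].
have hs : has_sup A by split; [exists a|].
pose s := sup A.
have sa : a <= s by exact: ub_le_sup.
have sb : s <= b by apply: ge_sup; [exists a|move=> x [/andP[]]].
have [|e e0 h] := loc s; first by rewrite sa sb.
have [y Ay ye] := sup_adherent e0 hs.
have ys : y <= s by exact: ub_le_sup.
have [/andP[ay yb] Tay] := Ay.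
have ext z : s <= z -> z <= b -> z < s + e -> A z.
  move=> sz zb ze; split; first by rewrite (le_trans sa) ?zb.
  by apply: (Ttr _ y) => //; apply: h.
have [sb'|sb'] := leP b s.
  have sE : s = b by apply/eqP; rewrite eq_le sb sb'.
  by have [_] := ext b ltac:(by rewrite sE) (lexx b) ltac:(by rewrite sE ltrDl).
pose z := Num.min b (s + e / 2).
have sz : s < z by rewrite lt_min sb' ltrDl divr_gt0.
have [] : ~ (z <= s) by apply/negP; rewrite -ltNge.
apply: ub_le_sup => //; apply: ext; first exact: ltW.
- by rewrite ge_min lexx.
- by rewrite gt_min; apply/orP; right; lra.
Qed.

Lemma MVT_between Q d p q : (forall p, is_derive p 1 Q (d p)) ->
  exists2 c, Num.min p q <= c <= Num.max p q & Q q - Q p = d c * (q - p).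
Proof.
move=> dQ; have cQ a b : {within `[a, b], continuous Q}.
  by apply: continuous_subspaceT => t; exact: dcts (dQ t).
have [pq|qp|->] := ltgtP p q.
- have [c /andP[pc cq] E] := MVT_is_derive pq (fun x _ => dQ x) (cQ p q).
  by exists c; rewrite // (ltW pc) ltW.
- have [c /andP[pc cq] E] := MVT_is_derive qp (fun x _ => dQ x) (cQ q p).
  by exists c; [rewrite (ltW pc) ltW|rewrite -opprB E -mulrN opprB].
- by exists q; rewrite ?lexx// !subrr mulr0.
Qed.

Lemma within_bounded f a b : a <= b -> {within `[a, b], continuous f} ->
  exists M, forall x, a <= x <= b -> `|f x| <= M.
Proof.
move=> ab cf.
have [c1 _ h1] := EVT_max ab cf; have [c2 _ h2] := EVT_min ab cf.
exists (Num.max `|f c1| `|f c2|) => x xab.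
have := h1 x; have := h2 x; rewrite in_itv/= xab => /(_ isT) m1 /(_ isT) m2.
rewrite le_max !ler_norml.
have [fx0|fx0] := leP 0 (f x).
  apply/orP; left; apply/andP; split.
    by apply: le_trans fx0; rewrite oppr_le0.
  by apply: le_trans m2 _; exact: ler_norm.
apply/orP; right; apply/andP; split.
  by apply: le_trans m1; rewrite lerNl -normrN; exact: ler_norm.
by apply: le_trans (ltW fx0) _.
Qed.

Lemma within_measurable f a b : {within `[a, b], continuous f} ->
  measurable_fun `[a, b] f.
Proof. by move=> cf; exact: subspace_continuous_measurable_fun. Qed.

Lemma within_comp d P a b : continuous d -> {within `[a, b], continuous P} ->
  {within `[a, b], continuous (d \o P)}.
Proof.
move=> cd cP x; apply: (@continuous_comp (subspace `[a, b]) R R P d x (cP x)).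
exact: cd.
Qed.

Lemma primitive_chain_integrable a b P f d : a <= b -> primitive_on a b P f ->
  continuous d ->
  mu.-integrable `[a, b] (EFin \o (fun t => d (P t) * f t)).
Proof.
move=> ab Pf cd; have cP := primitive_within ab Pf.
have cdP := within_comp cd cP.
have [M hM] := within_bounded ab cdP.
have [fi _] := Pf; have mg := within_measurable cdP.
have hb x : `[a, b]%classic x -> `|(d \o P) x| <= M.
  by move=> xab; apply: hM; move: xab; rewrite /= in_itv.
have := integrable_mul_bounded (measurable_itv _) fi mg hb.
by apply: eq_integrable => // x _; rewrite /= mulrC.
Qed.

(** The chain rule for absolutely continuous functions: on a short interval the
    mean value theorem compares the two sides up to [e] times the integral of
    the norm of [f], and these errors add up. *)
Lemma primitive_chain a b P f Q d : a <= b -> primitive_on a b P f ->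
  (forall p, is_derive p 1 Q (d p)) -> continuous d ->
  \int[mu]_(t in `[a, b]) (d (P t) * f t) = Q (P b) - Q (P a).
Proof.
move=> ab Pf dQ cd; have cP := primitive_within ab Pf.
have dfi := primitive_chain_integrable ab Pf cd.
have fi : mu.-integrable `[a, b] (EFin \o f) by case: Pf.
have fni : mu.-integrable `[a, b] (EFin \o (fun x => `|f x|)) by exact: integrable_norm.
have sub x y : a <= x -> y <= b -> `[x, y] `<=` (`[a, b]%classic : set R).
  by move=> ax yb; apply: subset_itv; rewrite bnd_simp.
suff key e : 0 < e ->
    `|\int[mu]_(t in `[a, b]) (d (P t) * f t) - (Q (P b) - Q (P a))| <=
    e * \int[mu]_(t in `[a, b]) `|f t|.
  apply/eqP; rewrite -subr_eq0 -normr_le0; apply/ler_addgt0Pl => e e0.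
  rewrite addr0; set N := \int[mu]_(t in `[a, b]) `|f t| in key *.
  have N0 : 0 <= N by exact: Rintegral_norm_ge0.
  apply: le_trans (key (e / (1 + N)) _) _.
    by rewrite divr_gt0// ltr_pwDl.
  rewrite mulrAC ler_pdivrMr ?ltr_pwDl// ler_pM2l//; lra.
move=> e0.
pose T x y := [/\ a <= x, x <= y, y <= b &
  `|\int[mu]_(t in `[x, y]) (d (P t) * f t) - (Q (P y) - Q (P x))| <=
    e * \int[mu]_(t in `[x, y]) `|f t|].
suff [] : T a b by [].
apply: interval_induction => //.
- move=> x y z [ax xy yb h1] [ay yz zb h2]; split => //; first exact: le_trans yz.
  rewrite (@Rintegral_chasles _ _ x y z)//; last first.
    by apply: integrableS dfi => //; exact: sub.
  rewrite (@Rintegral_chasles _ _ x y z)//; last first.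
    by apply: integrableS fni => //; exact: sub.
  rewrite mulrDr; apply: le_trans (lerD h1 h2).
  by apply: le_trans (ler_normD _ _); rewrite le_eqVlt; apply/orP; left; apply/eqP; congr `|_|; ring.
- move=> x /andP[ax xb].
  have e20 : 0 < e / 2 by rewrite divr_gt0.
  have [/= eta eta0 hd] : exists2 eta, 0 < eta &
      forall p, `|p - P x| < eta -> `|d p - d (P x)| <= e / 2.
    have /cvgrPdist_le /(_ _ e20) [eta /= eta0 h] := cd (P x).
    by exists eta => // p; rewrite distrC => hp; rewrite distrC; exact: h.
  have [dl dl0 hP] : exists2 dl, 0 < dl &
      forall t, a <= t <= b -> `|t - x| < dl -> `|P t - P x| < eta.
    have /subspace_continuousP /(_ x) := cP.
    rewrite /= in_itv/= ax xb => /(_ isT) /cvgrPdist_lt /(_ _ eta0) [dl /= dl0 h].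
    exists dl => // t tab tx; rewrite distrC; apply: (h t).
      by rewrite /= distrC.
    by rewrite in_itv.
  exists dl => // y z ay yx xz zb xy zx.
  have yz := le_trans yx xz.
  split => //.
  have [c /andP[c1 c2] ->] := MVT_between (P y) (P z) dQ.
  have Py : `|P y - P x| < eta.
    apply: hP; first by rewrite ay (le_trans yx).
    by rewrite distrC ger0_norm ?subr_ge0//; lra.
  have Pz : `|P z - P x| < eta.
    apply: hP; first by rewrite zb (le_trans ax).
    by rewrite ger0_norm ?subr_ge0//; lra.
  have dc : `|d c - d (P x)| <= e / 2.
    apply: hd; move: Py Pz; rewrite !ltr_norml => /andP[y1 y2] /andP[z1 z2].
    move: c1 c2; rewrite ge_min le_max => /orP[c1|c1] /orP[c2|c2];
      by apply/andP; split; clear -c1 c2 y1 y2 z1 z2; lra.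
  have [_ fP] := Pf; rewrite -fP//.
  have fyz : mu.-integrable `[y, z] (EFin \o f) by apply: integrableS fi => //; exact: sub.
  have dfyz : mu.-integrable `[y, z] (EFin \o (fun t => d (P t) * f t)).
    by apply: integrableS dfi => //; exact: sub.
  rewrite -RintegralZl// -RintegralB//; last first.
    exact: rintegrableZ.
  have ii : mu.-integrable `[y, z] (EFin \o (fun t => d (P t) * f t - d c * f t)).
    by apply: rintegrableB => //; exact: rintegrableZ.
  apply: (le_trans (le_normr_Rintegral _ ii)) => //.
  have fnyz : mu.-integrable `[y, z] (EFin \o (fun t => `|f t|)) by exact: integrable_norm.
  rewrite -RintegralZl//; apply: le_Rintegral => //.
  + exact: integrable_norm.
  + exact: rintegrableZ.
  + move=> t; rewrite /= in_itv/= => /andP[yt tz].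
    rewrite -mulrBl normrM ler_wpM2r//.
    have dt : `|d (P t) - d (P x)| <= e / 2.
      apply: hd; apply: hP; first by rewrite (le_trans ay) ?(le_trans tz).
      by rewrite ltr_norml; apply/andP; split; lra.
    rewrite (_ : d (P t) - d c = (d (P t) - d (P x)) - (d c - d (P x))); last by ring.
    by apply: le_trans (ler_normB _ _) _; lra.
Qed.

End ChainRule.

(** * Completing the square *)

Section EnergyBound.
Context {R : realType}.
Implicit Types (P f : R -> R) (a b c d x p phi M sg : R).
Local Notation mu := (@lebesgue_measure R).

Lemma Rintegral_cst_itv a b c : a <= b ->
  \int[mu]_(x in `[a, b]) c = c * (b - a).
Proof.
move=> ab; have dF x : a <= x <= b -> is_derive x 1 (fun x => c * x) c.
  by move=> _; compute_deriv; rewrite /=; ring.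
rewrite (Rintegral_derive ab dF) ?mulrBr//.
by apply: continuous_subspaceT; exact: cst_continuous.
Qed.

Lemma cos_atanE p : cos (atan p) = (speed p)^-1.
Proof. exact: cos_atan. Qed.

Lemma sin_atanE p : sin (atan p) = p / speed p.
Proof.
have c0 : cos (atan p) != 0 by rewrite cos_atanE invr_eq0 gt_eqF ?speed_gt0.
by rewrite -{2}[p]atanK /tan -cos_atanE divfK.
Qed.

Lemma speed_sinB phi p :
  speed p * sin (phi - atan p) = sin phi - p * cos phi.
Proof.
rewrite sinB sin_atanE cos_atanE; field.
by rewrite gt_eqF ?speed_gt0.
Qed.

(** The curvature, up to the factor [M], of the elastica whose initial tangent
    has angle [phi], as a function of its slope [p]. *)
Definition elastica_curv phi p : R := sqrtsin (phi - atan p).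

Lemma continuous_elastica_curv phi : continuous (elastica_curv phi).
Proof.
move=> p; apply: (@continuous_comp _ _ _ (fun p => phi - atan p) sqrtsin).
  by apply: cvgB; [exact: cvg_cst|exact: continuous_atan].
exact: continuous_sqrtsin.
Qed.

Lemma sqr_elastica_curv phi p : phi < pi / 2 -> p <= tan phi -> 0 < phi ->
  elastica_curv phi p ^+ 2 * speed p = sin phi - p * cos phi.
Proof.
move=> p2 pp p0; rewrite -speed_sinB sqr_sqrtsin; first by rewrite mulrC.
have : atan p <= phi.
  rewrite -[phi]tanK; first exact: le_atan.
  by rewrite in_itv/= p2 (lt_trans _ p0)// oppr_lt0 divr_gt0// pi_gt0.
have := atan_gtNpi2 p => ? ?; apply/andP; split; first by lra.
by have := pi_gt0 R; lra.
Qed.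

Definition curv_density phi p : R := elastica_curv phi p * (speed p)^-1 ^+ 2.

Lemma continuous_curv_density phi : continuous (curv_density phi).
Proof.
move=> p; apply: cvgM; first exact: continuous_elastica_curv.
apply: (@continuous_comp _ _ _ (fun t => (speed t)^-1) (fun x => x ^+ 2)).
  by apply: cvgV; [rewrite gt_eqF// speed_gt0|exact: continuous_speed].
exact: exprn_continuous.
Qed.

Lemma is_derive_J_atan phi p : 0 < phi ->
  is_derive p 1 (fun p => - J (phi - atan p)) (curv_density phi p).
Proof.
move=> p0.
have d1 := dD (dcst phi p) (dN (is_derive1_atan p)).
have d2 : is_derive (phi - atan p) 1 J (sqrtsin (phi - atan p)).
  by apply: is_derive_J; have := atan_ltpi2 p; have := pihalf_lt2 R; lra.
have H := dN (@dcomp _ J (fun y => phi - atan y) p _ _ d2 d1); nref (deq H _).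
by rewrite /curv_density /elastica_curv exprVn sqr_speed; ring.
Qed.

(** It vanishes where the curvature [f / speed ^ 3] is that of an elastica of scale
    [M]. *)
Definition deviation P f M phi x : R :=
  speed (P x) * (f x * (speed (P x))^-1 ^+ 3 + M * elastica_curv phi (P x)) ^+ 2.

Lemma deviation_ge0 P f M phi x : 0 <= deviation P f M phi x.
Proof. by rewrite mulr_ge0 ?sqr_ge0// ltW ?speed_gt0. Qed.

Lemma integral_deviation_ge0 (D : set R) P f M phi :
  0 <= \int[mu]_(x in D) deviation P f M phi x.
Proof. by apply: fine_ge0; apply: integral_ge0 => x _; rewrite lee_fin deviation_ge0. Qed.

(** Completing the square against the elastica with initial angle [phi]: the
    cross term is an exact derivative, and [sin phi - p cos phi] integrates to a
    quantity that depends on the height only. *)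
Lemma energy_lower_bound a b P f phi M sg xm x0 :
  a <= xm <= b -> a <= x0 <= b -> 0 < phi -> phi < pi / 2 ->
  primitive_on a b P f ->
  mu.-integrable `[a, b] (EFin \o (fun x => f x ^+ 2)) ->
  (forall x, a <= x <= b -> P x <= tan phi) -> P xm = tan phi -> P x0 = 0 ->
  (xm <= x0 /\ sg = 1) \/ (x0 <= xm /\ sg = -1) -> 0 <= M ->
  mu.-integrable `[a, b] (EFin \o deviation P f (sg * M) phi) /\
  2 * M * J phi + 2^-1 * \int[mu]_(x in `[a, b]) deviation P f (sg * M) phi x <=
  \int[mu]_(x in `[a, b]) (f x ^+ 2 * (speed (P x))^-1 ^+ 5) +
  M ^+ 2 * (sin phi * (b - a) - cos phi * \int[mu]_(x in `[a, b]) P x).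
Proof.
move=> /andP[axm xmb] /andP[ax0 x0b] p0 p2 Pf f2 Pphi Pm P0 sgP M0.
have ab : a <= b by exact: le_trans xmb.
have cP := primitive_within ab Pf.
have Pi := continuous_integrable cP.
have mP := within_measurable cP.
have ei := integrable_energy_density (measurable_itv _) mP f2.
have chi := primitive_chain_integrable ab Pf (@continuous_curv_density phi).
set e := fun x => f x ^+ 2 * (speed (P x))^-1 ^+ 5.
set X := fun x => curv_density phi (P x) * f x.
set w := deviation P f (sg * M) phi.
pose g x := e x + (M ^+ 2 * sin phi - M ^+ 2 * cos phi * P x).
have c1i : mu.-integrable `[a, b] (EFin \o (fun=> M ^+ 2 * sin phi)).
  by apply: continuous_integrable; exact: cst_continuous.
have c2i : mu.-integrable `[a, b] (EFin \o (fun x => M ^+ 2 * cos phi * P x)).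
  exact: rintegrableZ.
have c3i := rintegrableB (measurable_itv _) c1i c2i.
have gi : mu.-integrable `[a, b] (EFin \o g) by exact: rintegrableD.
have sg2 : sg ^+ 2 = 1 by case: sgP => -[_ ->]; ring.
have wE x : a <= x <= b -> w x = g x + 2 * sg * M * X x.
  move=> xab; have s0 : speed (P x) != 0 by rewrite gt_eqF// speed_gt0.
  have hq := sqr_elastica_curv p2 (Pphi _ xab) p0.
  rewrite /w /deviation /g /e /X /curv_density.
  have -> : M ^+ 2 * sin phi - M ^+ 2 * cos phi * P x =
      M ^+ 2 * (elastica_curv phi (P x) ^+ 2 * speed (P x)) by rewrite hq; ring.
  move: s0; set q := elastica_curv _ _; set s := speed _ => s0.
  rewrite [LHS](_ : _ = f x ^+ 2 * s^-1 ^+ 5 + sg ^+ 2 * (M ^+ 2 * (q ^+ 2 * s)) +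
      2 * sg * M * (q * s^-1 ^+ 2 * f x)); last by field.
  by rewrite sg2 mul1r.
have wi : mu.-integrable `[a, b] (EFin \o w).
  have k := rintegrableD (measurable_itv _) gi
    (rintegrableZ (2 * sg * M) (measurable_itv _) chi).
  apply: rintegrable_eq k => // x; rewrite /= in_itv/= => xab.
  by rewrite wE.
split => //.
have w0 x : 0 <= w x by exact: deviation_ge0.
have -> : \int[mu]_(x in `[a, b]) e x +
    M ^+ 2 * (sin phi * (b - a) - cos phi * \int[mu]_(x in `[a, b]) P x) =
    \int[mu]_(x in `[a, b]) g x.
  have E1 : \int[mu]_(x in `[a, b]) g x = \int[mu]_(x in `[a, b]) e x +
      \int[mu]_(x in `[a, b]) (M ^+ 2 * sin phi - M ^+ 2 * cos phi * P x).
    exact: RintegralD.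
  have E2 : \int[mu]_(x in `[a, b]) (M ^+ 2 * sin phi - M ^+ 2 * cos phi * P x) =
      \int[mu]_(x in `[a, b]) (M ^+ 2 * sin phi) -
      \int[mu]_(x in `[a, b]) (M ^+ 2 * cos phi * P x).
    exact: RintegralB.
  have E3 : \int[mu]_(x in `[a, b]) (M ^+ 2 * cos phi * P x) =
      M ^+ 2 * cos phi * \int[mu]_(x in `[a, b]) P x by exact: RintegralZl.
  have E4 : \int[mu]_(x in `[a, b]) (M ^+ 2 * sin phi) = M ^+ 2 * sin phi * (b - a).
    exact: Rintegral_cst_itv.
  by rewrite E1 E2 E3 E4; ring.
have hi : mu.-integrable `[a, b] (EFin \o (fun x => g x - 2^-1 * w x)).
  by apply: rintegrableB => //; exact: rintegrableZ.
(* Half of the square with the opposite sign remains. *)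
have h0 x : a <= x <= b -> 0 <= g x - 2^-1 * w x.
  move=> xab; have s0 : speed (P x) != 0 by rewrite gt_eqF// speed_gt0.
  rewrite (_ : _ - _ = 2^-1 * (speed (P x) * (f x * (speed (P x))^-1 ^+ 3 -
      sg * M * elastica_curv phi (P x)) ^+ 2)).
    by rewrite mulr_ge0 ?invr_ge0// mulr_ge0 ?sqr_ge0// ltW ?speed_gt0.
  have := wE _ xab; rewrite /w /deviation /X /curv_density.
  set q := elastica_curv _ _; set s := speed _ in s0 * => h.
  have -> : g x = s * (f x * s^-1 ^+ 3 + sg * M * q) ^+ 2
      - 2 * sg * M * (q * s^-1 ^+ 2 * f x) by rewrite h; ring.
  by field.
have -> : \int[mu]_(x in `[a, b]) g x =
    \int[mu]_(x in `[a, b]) (g x - 2^-1 * w x) +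
    2^-1 * \int[mu]_(x in `[a, b]) w x.
  by rewrite RintegralB ?RintegralZl// ?subrK//; exact: rintegrableZ.
rewrite lerD2r.
(* Outside the stretch from the largest slope to the zero slope, positivity suffices. *)
have main c d : a <= c -> c <= d -> d <= b ->
    - sg * (J (phi - atan (P c)) - J (phi - atan (P d))) = J phi ->
    2 * M * J phi <= \int[mu]_(x in `[a, b]) (g x - 2^-1 * w x).
  move=> ac cd db HJ.
  have sub : `[c, d] `<=` (`[a, b]%classic : set R) by apply: subset_itv; rewrite bnd_simp.
  have Xi : mu.-integrable `[c, d] (EFin \o X) by apply: integrableS chi.
  have wcd : mu.-integrable `[c, d] (EFin \o w) by apply: integrableS wi.
  apply: (@le_trans _ _ (\int[mu]_(x in `[c, d]) (g x - 2^-1 * w x))); last first.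
    apply: Rintegral_subset_le => // x; rewrite /= in_itv/=; exact: h0.
  have -> : \int[mu]_(x in `[c, d]) (g x - 2^-1 * w x) =
     \int[mu]_(x in `[c, d]) (2^-1 * w x - 2 * sg * M * X x).
    apply: eq_Rintegral => x; rewrite inE/= in_itv/= => /andP[cx xd].
    by rewrite wE; [field|rewrite (le_trans ac)//= (le_trans xd)].
  rewrite RintegralB//; last 2 first.
  - exact: rintegrableZ.
  - exact: rintegrableZ.
  rewrite !RintegralZl// (primitive_chain cd (primitive_on_sub ac db Pf)
    (fun p => is_derive_J_atan p p0) (@continuous_curv_density phi)).
  have h1 : 0 <= \int[mu]_(x in `[c, d]) w x by exact: integral_deviation_ge0.
  rewrite -HJ; rewrite -subr_ge0.
  rewrite (_ : _ - _ = 2^-1 * \int[mu]_(x in `[c, d]) w x); last by ring.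
  by rewrite mulr_ge0.
have tm : phi - atan (P xm) = 0.
  rewrite Pm tanK ?subrr// in_itv/= p2 (lt_trans _ p0)//.
  by rewrite oppr_lt0 divr_gt0// pi_gt0.
have t0 : phi - atan (P x0) = phi by rewrite P0 atan0 subr0.
case: sgP => -[xx sgE].
- by apply: (main xm x0) => //; rewrite tm t0 J0 sgE; ring.
- by apply: (main x0 xm) => //; rewrite tm t0 J0 sgE; ring.
Qed.

End EnergyBound.

(** * The energy of one half and its equality case *)

Section HalfEnergy.
Context {R : realType}.
Implicit Types (P f : R -> R) (a b h x t z phi M sg : R).
Local Notation mu := (@lebesgue_measure R).

Definition elastica_scale h phi : R := J phi / (sin phi / 2 - h * cos phi).

(** [phi] is the angle of the largest slope. The bound holds for every scale [M]:
    large values show that the denominator of [elastica_energy] is positive, that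
    is, [phi] exceeds [atan (2 h)], and [elastica_scale h phi] is the best
    one. *)
Lemma half_energy a b P f h x0 sg : b = a + 2^-1 -> 0 < h ->
  (x0 = b /\ sg = 1) \/ (x0 = a /\ sg = -1) ->
  primitive_on a b P f ->
  mu.-integrable `[a, b] (EFin \o (fun x => f x ^+ 2)) ->
  P x0 = 0 -> h <= \int[mu]_(x in `[a, b]) P x ->
  exists phi, [/\ atan (2 * h) < phi, phi < pi / 2,
    forall x, a <= x <= b -> P x <= tan phi,
    mu.-integrable `[a, b] (EFin \o deviation P f (sg * elastica_scale h phi) phi) &
    elastica_energy h phi +
      2^-1 * \int[mu]_(x in `[a, b]) deviation P f (sg * elastica_scale h phi) phi x <=
    \int[mu]_(x in `[a, b]) (f x ^+ 2 * (speed (P x))^-1 ^+ 5)].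
Proof.
have aux1 (w d k : R) : 0 <= w -> k <= 0 -> 0 <= d ->
  d + k < 2 * (d + 1) + 2^-1 * w by lra.
have aux2 (e w d k : R) : 2 * e + 2^-1 * w <= d + k -> k <= e ->
  e + 2^-1 * w <= d by lra.
move=> bE h0 x0E Pf f2 Px0 hP.
have ab : a <= b by rewrite bE lerDl invr_ge0.
have baE : b - a = 2^-1 by rewrite bE addrC addKr.
have cP := primitive_within ab Pf.
have Pi := continuous_integrable cP.
have [xm] := EVT_max ab cP; rewrite in_itv/= => /andP[axm xmb] Pm.
have PmE x : a <= x <= b -> P x <= P xm by move=> xab; apply: Pm; rewrite in_itv.
have m2h : 2 * h <= P xm.
  have : \int[mu]_(x in `[a, b]) P x <= \int[mu]_(x in `[a, b]) P xm.
    apply: le_Rintegral => //.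
    by apply: continuous_integrable; exact: cst_continuous.
  by rewrite Rintegral_cst_itv// baE; lra.
have m0 : 0 < P xm by lra.
pose phi := atan (P xm).
have tphi : tan phi = P xm by exact: atanK.
have p0 : 0 < phi by exact: atan_gt0.
have p2 : phi < pi / 2 by exact: atan_ltpi2.
have pi0 := pi_gt0 R.
have Jp : 0 < J phi by apply: J_gt0; apply/andP; split; lra.
have c0 : 0 < cos phi by rewrite cos_gt0_pihalf// p2 andbT; lra.
have Pphi x : a <= x <= b -> P x <= tan phi by rewrite tphi; exact: PmE.
have x0ab : a <= x0 <= b by case: x0E => -[-> _]; rewrite ?lexx ?ab.
have sgE : (xm <= x0 /\ sg = 1) \/ (x0 <= xm /\ sg = -1).
  by case: x0E => -[-> ->]; [left|right].
have xmab : a <= xm <= b by rewrite axm.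
have LB M := @energy_lower_bound R a b P f phi M sg xm x0 xmab x0ab p0 p2 Pf f2
   Pphi (esym tphi) Px0 sgE.
set D := \int[mu]_(x in `[a, b]) (f x ^+ 2 * (speed (P x))^-1 ^+ 5) in LB *.
have hcP : cos phi * h <= cos phi * \int[mu]_(x in `[a, b]) P x by rewrite ler_pM2l.
pose q := sin phi / 2 - h * cos phi.
have LBq M : 0 <= M -> sin phi * (b - a) - cos phi * \int[mu]_(x in `[a, b]) P x <= q.
  by move=> _; rewrite baE /q; lra.
(* Otherwise a large scale would contradict the bound. *)
have q0 : 0 < q.
  rewrite ltNge; apply/negP => q0.
  have D0 : 0 <= D.
    apply: Rintegral_ge0 => x _; rewrite mulr_ge0 ?sqr_ge0// exprn_ge0//.
    by rewrite invr_ge0 ltW ?speed_gt0.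
  pose M := (D + 1) / J phi.
  have M0 : 0 <= M by rewrite divr_ge0 ?(ltW Jp)// addr_ge0.
  have [_ h1] := LB M M0; have h2 := LBq M M0; have h3 := integral_deviation_ge0 `[a, b] P f (sg * M) phi.
  have h4 : M ^+ 2 * (sin phi * (b - a) - cos phi * \int[mu]_(x in `[a, b]) P x) <= 0.
    rewrite pmulr_rle0; first exact: le_trans h2 q0.
    by rewrite exprn_gt0// divr_gt0// ltr_wpDl.
  have : 2 * M * J phi = 2 * (D + 1) by rewrite /M; field; rewrite gt_eqF.
  move=> h5; move: h1; rewrite h5; apply/negP; rewrite -ltNge.
  exact: aux1.
have sc0 : 0 <= elastica_scale h phi by rewrite divr_ge0 ?ltW.
exists phi; split => //.
- by apply: lt_atan; rewrite -tphi /tan ltr_pdivlMr//; rewrite /q in q0; lra.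
- by have [] := LB _ sc0.
- have [_ h1] := LB _ sc0; have h2 := LBq _ sc0.
  have h3 : elastica_scale h phi ^+ 2 * (sin phi * (b - a) -
      cos phi * \int[mu]_(x in `[a, b]) P x) <= elastica_scale h phi ^+ 2 * q.
    by rewrite ler_wpM2l// sqr_ge0.
  have h4 : elastica_scale h phi ^+ 2 * q = elastica_energy h phi.
    by rewrite /elastica_scale /elastica_energy -/q; field; rewrite gt_eqF.
  have h5 : 2 * elastica_scale h phi * J phi = 2 * elastica_energy h phi.
    by rewrite /elastica_scale /elastica_energy -/q; field; rewrite gt_eqF.
  by apply: aux2; [rewrite -h5; exact: h1|rewrite -h4; exact: h3].
Qed.

(** Equality in the bound forces the square to vanish, that is, the curvature
    [f / speed ^ 3] is the one of an elastica. *)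
Lemma half_energy_eq a b P f M phi : a <= b -> primitive_on a b P f ->
  mu.-integrable `[a, b] (EFin \o deviation P f M phi) ->
  \int[mu]_(x in `[a, b]) deviation P f M phi x <= 0 ->
  primitive_on a b P (fun x => - M * elastica_curv phi (P x) * speed (P x) ^+ 3).
Proof.
move=> ab Pf wi w0; set w := deviation _ _ _ _ in wi w0 *.
have cP := primitive_within ab Pf.
have wx0 x : 0 <= w x by exact: deviation_ge0.
have wae : ae_eq mu `[a, b]%classic (EFin \o w) (cst 0%E).
  apply/ae_eq_integral_abs => //; first exact: measurable_int wi.
  have -> : (\int[mu]_(x in `[a, b]) `|(EFin \o w) x| = \int[mu]_(x in `[a, b]) (w x)%:E)%E.
    by apply: eq_integral => x _ /=; rewrite ger0_norm.
  have k : (\int[mu]_(x in `[a, b]) (w x)%:E \is a fin_num)%E by exact: integrable_fin_num.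
  rewrite -(fineK k); congr (_%:E); apply/eqP; rewrite eq_le w0/=.
  by apply: fine_ge0; apply: integral_ge0 => x _; rewrite lee_fin.
have cg : continuous (fun p : R => - M * elastica_curv phi p * speed p ^+ 3).
  move=> p; apply: cvgM.
    by apply: cvgM; [exact: cvg_cst|exact: continuous_elastica_curv].
  apply: (@continuous_comp _ _ _ speed (fun x => x ^+ 3)).
    exact: continuous_speed.
  exact: exprn_continuous.
have cgP := within_comp cg cP.
have gi := continuous_integrable cgP.
split; first by apply: eq_integrable gi.
move=> x y ax xy yb; rewrite -(Pf.2 _ _ ax xy yb).
have sub : `[x, y] `<=` (`[a, b]%classic : set R) by apply: subset_itv; rewrite bnd_simp.
congr fine; apply: ae_eq_integral => //.
- by apply: measurable_funS (measurable_int _ gi).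
- by apply: measurable_funS (measurable_int _ Pf.1).
- apply: (@filterS _ _ (ae_filter_ringOfSetsType mu) _ _ _ wae) => t wt txy /=.
  have /= := wt (sub _ txy) => -[] /eqP; rewrite /w /deviation mulf_eq0 sqrf_eq0 gt_eqF ?speed_gt0//=.
  move=> /eqP wt0; congr (_%:E); rewrite [RHS](_ : _ =
    (f t * (speed (P t))^-1 ^+ 3) * speed (P t) ^+ 3); last first.
    by field; rewrite gt_eqF ?speed_gt0.
  by move/eqP : wt0; rewrite addr_eq0 => /eqP ->; ring.
Qed.

(** The coordinate along the horizontal axis of the point of the elastica where
    the tangent has turned by [z] since the inflection point, when the tangent
    there has angle [phi]. *)
Definition elastica_time phi z : R := 2 * sqrtsin z * cos phi + J z * sin phi.

Lemma elastica_time_phi phi : elastica_time phi phi = elastica_x phi.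
Proof. by []. Qed.

Lemma elastica_time0 phi : elastica_time phi 0 = 0.
Proof. by rewrite /elastica_time /sqrtsin sin0 sqrtr0 J0; ring. Qed.

Lemma continuous_elastica_time phi z : -2 < z ->
  {for z, continuous (elastica_time phi)}.
Proof.
move=> z2; apply: continuousD; apply: continuousM; try apply: continuousM.
- exact: cvg_cst.
- exact: continuous_sqrtsin.
- exact: cvg_cst.
- exact: continuous_J.
- exact: cvg_cst.
Qed.

Lemma is_derive_elastica_time phi z : 0 < z < pi ->
  is_derive z 1 (elastica_time phi) (cos (phi - z) / sqrtsin z).
Proof.
move=> z0; have s0 := sqrtsin_gt0 z0.
have d1 := is_derive_sqrtsin z0.
have d2 : is_derive z 1 J (sqrtsin z) by apply: is_derive_J; case/andP: z0; lra.
nref (deq _ _); first by derives.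
rewrite cosB -[X in _ = (_ + _ * X) / _]sqr_sqrtsin; last by case/andP: z0 => /ltW-> /ltW->.
by rewrite /=; field; rewrite gt_eqF.
Qed.

Lemma elastica_time_incr phi z1 z2 : 0 < phi -> phi < pi / 2 ->
  0 <= z1 -> z1 < z2 -> z2 <= phi ->
  elastica_time phi z1 < elastica_time phi z2.
Proof.
move=> p0 p2 z10 z12 z2p; have pp := pi_gt0 R.
apply: (@incr_is_derive _ (elastica_time phi) (fun z => cos (phi - z) / sqrtsin z)) => //.
- move=> z /andP[za zb]; apply: is_derive_elastica_time; apply/andP; split; lra.
- apply: continuous_in_subspaceT => z; rewrite inE/= in_itv/= => /andP[za zb].
  by apply: continuous_elastica_time; lra.
- move=> z /andP[za zb]; rewrite divr_gt0//.
    by rewrite cos_gt0_pihalf//; apply/andP; split; lra.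
  by rewrite sqrtsin_gt0//; apply/andP; split; lra.
Qed.

(** Along an elastica the position is an explicit function of the tangent angle.
    The equation for [P] is not Lipschitz at the inflection point, where
    [phi - atan P] vanishes; there the explicit function replaces uniqueness for
    the Cauchy problem. *)
Lemma elastica_time_slope P phi M x : 0 < phi -> phi < pi / 2 -> 0 < M ->
  M * 2^-1 = elastica_x phi ->
  primitive_on 0 2^-1 P (fun x => - M * elastica_curv phi (P x) * speed (P x) ^+ 3) ->
  P 2^-1 = 0 -> (forall x, 0 <= x <= 2^-1 -> P x <= tan phi) ->
  0 <= x <= 2^-1 ->
  0 <= phi - atan (P x) <= phi /\ elastica_time phi (phi - atan (P x)) = M * x.
Proof.
move=> p0 p2 M0 ME Pf Ph Pphi.
have pi0 := pi_gt0 R.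
pose z t := phi - atan (P t).
have z0 t : 0 <= t <= 2^-1 -> 0 <= z t.
  move=> /Pphi /le_atan; rewrite tanK ?subr_ge0//.
  by rewrite in_itv/= p2 (lt_trans _ p0)// oppr_lt0 divr_gt0.
(* The slope decreases, so the turning angle increases. *)
have zmono s t : 0 <= s -> s <= t -> t <= 2^-1 -> z s <= z t.
  move=> s0 st th; rewrite lerD2l lerN2; apply: le_atan.
  rewrite -subr_le0 -(Pf.2 _ _ s0 st th) -oppr_ge0.
  rewrite -mulN1r -RintegralZl//; last first.
    apply: integrableS (Pf.1) => //; apply: subset_itv; rewrite bnd_simp//.
  apply: Rintegral_ge0 => y _; rewrite mulN1r -!mulrA mulNr opprK.
  by rewrite mulr_ge0 ?(ltW M0)// mulr_ge0 ?sqrtr_ge0// exprn_ge0// ltW ?speed_gt0.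
have zh : z 2^-1 = phi by rewrite /z Ph atan0 subr0.
have h0 : 0 <= 2^-1 :> R by rewrite invr_ge0.
have cP := primitive_within h0 Pf.
have cz : {within `[0, 2^-1], continuous z}.
  apply: (within_comp (d := fun p => phi - atan p) _ cP) => p.
  by apply: cvgB; [exact: cvg_cst|exact: continuous_atan].
have dP t : 0 < t < 2^-1 ->
    is_derive t 1 P (- M * elastica_curv phi (P t) * speed (P t) ^+ 3).
  move=> /andP[t0 th]; apply: (primitive_continuous_derive Pf) => //.
  have cPt := primitive_itv Pf t0 th.
  apply: cvgM.
    apply: cvgM; first exact: cvg_cst.
    by apply: (@continuous_comp _ _ _ P); [|exact: continuous_elastica_curv].
  apply: (@continuous_comp _ _ _ P (fun p => speed p ^+ 3)) => //.
  apply: (@continuous_comp _ _ _ speed (fun x => x ^+ 3)).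
    exact: continuous_speed.
  exact: exprn_continuous.
have timeE t : 0 <= t <= 2^-1 -> 0 < z t -> elastica_time phi (z t) = M * t.
  move=> /andP[t0 th] zt.
  pose G s := elastica_time phi (z s) - M * s.
  have dG s : t < s < 2^-1 -> is_derive s 1 G 0.
      move=> /andP[ts sh]; have s0 : 0 < s by apply: le_lt_trans ts.
      have zs0 : 0 < z s by apply: lt_le_trans zt _; apply: zmono => //; exact: ltW.
      have zsp : z s < pi.
        have : z s <= phi by rewrite -zh; apply: zmono => //; exact: ltW.
        by move=> ?; lra.
      have d1 := dP s; rewrite s0 sh in d1; have {}d1 := d1 isT.
      have d2 := @dcomp _ atan P s _ _ (is_derive1_atan _) d1.
      have d3 := dD (dcst phi s) (dN d2).
      have zs : 0 < z s < pi by rewrite zs0.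
      have d4 := @dcomp _ (elastica_time phi) z s _ _ (is_derive_elastica_time phi zs) d3.
      have d5 := dM (dcst M s) (did s).
      nref (deq (dD d4 (dN d5)) _).
      rewrite /= {1}/z (_ : phi - (phi - _) = atan (P s)); last by ring.
      rewrite cos_atanE -/(speed _) -sqr_speed /elastica_curv -/(z s).
      field; rewrite gt_eqF ?speed_gt0//=.
      by rewrite gt_eqF// sqrtsin_gt0.
  have cG : {within `[t, 2^-1], continuous G}.
    have sub : `[t, 2^-1] `<=` (`[0, 2^-1]%classic : set R).
      by apply: subset_itv; rewrite bnd_simp.
    have hid : {within `[t, 2^-1], continuous (fun y : R => y)}.
      by apply: continuous_subspaceT => y; exact: cvg_id.
    move=> s; apply: cvgB; last first.
      by apply: cvgM; [exact: cvg_cst|exact: hid].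
    have czt := continuous_subspaceW sub cz.
    apply: (@continuous_comp (subspace `[t, 2^-1]) R R z _ s (czt s)).
    apply: continuous_elastica_time.
    rewrite /z; have := atan_ltpi2 (P s); have := pihalf_lt2 R; lra.
  have := cst_is_derive th dG cG; rewrite /G zh elastica_time_phi ME subrr.
  by move/eqP; rewrite subr_eq0 => /eqP.
move=> /andP[x0 xh]; split.
  by rewrite z0 ?x0//= -{2}zh; exact: zmono.
(* The formula extends to [z x = 0] only if [x = 0]: a slope that stayed maximal up to
   [x] would have to leave its maximum with a time less than [M x]. *)
have [zx|zx] := ltP 0 (z x); first by apply: timeE => //; rewrite x0.
have zx0 : z x = 0 by apply/eqP; rewrite eq_le zx z0// x0.
rewrite -/(z x) zx0 elastica_time0.
move: x0; rewrite le_eqVlt => /predU1P[<-|x0]; first by rewrite mulr0.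
exfalso.
have Mx : 0 < M * x by rewrite mulr_gt0.
have [dl [dl0 dlp dlM]] : exists dl, [/\ 0 < dl, dl <= phi & elastica_time phi dl < M * x].
  have c0 : {for 0, continuous (elastica_time phi)}.
    by apply: continuous_elastica_time; rewrite oppr_lt0.
  move/cvgrPdist_lt : c0 => /(_ _ Mx) [e /= e0 he].
  exists (Num.min phi (e / 2)); split.
  - by rewrite lt_min p0 divr_gt0.
  - by rewrite ge_min lexx.
  - have m0 : 0 < Num.min phi (e / 2) by rewrite lt_min p0 divr_gt0.
    have me : Num.min phi (e / 2) < e by rewrite gt_min; apply/orP; right; lra.
    have := he (Num.min phi (e / 2)); rewrite /= sub0r normrN gtr0_norm// => /(_ me).
    by rewrite elastica_time0 sub0r normrN; apply: le_lt_trans; exact: ler_norm.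
have czx : {within `[x, 2^-1], continuous z}.
  apply: continuous_subspaceW cz; apply: subset_itv; rewrite bnd_simp//.
  exact: ltW.
have [|t] := @IVT _ z x 2^-1 dl xh czx.
  by rewrite zx0 zh min_l ?max_r ?(ltW dl0)// ltW.
rewrite in_itv/= => /andP[xt th] zt.
have t0 : 0 <= t by apply: le_trans xt; exact: ltW.
have := timeE t; rewrite t0 th zt => /(_ isT dl0) E.
by move: dlM; rewrite E ltr_pM2l// ltNge xt.
Qed.

End HalfEnergy.

(** * A segment followed by an elastica arc, as a graph *)

Section ElasticaProfile.
Context {R : realType}.
Implicit Types (q x z phi M : R).

(** The tangent angle measured from the initial one, as a function of [q], the
    distance to the line through the inflection points up to a factor. It is
    [0] for negative [q], where the curve is a straight segment. *)
Definition turning q : R := asin (possq q).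

Definition elastica_abs phi M q : R :=
  (2 * q * cos phi + J (turning q) * sin phi) / M.
Definition elastica_ord phi M q : R :=
  (2 * q * sin phi - J (turning q) * cos phi) / M.

Lemma possq_itv q : q < 1 -> 0 <= possq q < 1.
Proof.
move=> q1; rewrite possq_ge0/=; have [q0|q0] := leP q 0.
  by rewrite possq0.
by rewrite possqE ?(ltW q0)// exprn_ilt1// ltW.
Qed.

Lemma turning_itv q : q < 1 -> 0 <= turning q < pi / 2.
Proof.
move=> /possq_itv /andP[q0 q1].
have q1' : -1 <= possq q < 1 by rewrite q1 andbT; lra.
rewrite asin_ltpi2// andbT leNgt; apply/negP => a0.
have pi0 := pi_gt0 R.
have : sin (asin (possq q)) < sin 0.
  rewrite ltr_sin// in_itv/=; last by apply/andP; split; lra.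
  by rewrite asin_geNpi2 ?asin_lepi2//; apply/andP; split; lra.
by rewrite sin0 asinK ?in_itv/= 1?ltNge ?q0//; apply/andP; split; lra.
Qed.

Lemma sin_turning q : q < 1 -> sin (turning q) = possq q.
Proof.
move=> /possq_itv /andP[q0 q1]; rewrite asinK// in_itv/=.
by apply/andP; split; lra.
Qed.

Lemma cos_turning_gt0 q : q < 1 -> 0 < cos (turning q).
Proof.
move=> /turning_itv /andP[t0 t1]; apply: cos_gt0_pihalf.
by rewrite t1 andbT; have := pi_gt0 R; lra.
Qed.

Lemma is_derive_turning q : q < 1 ->
  is_derive q 1 turning (2 * Num.max 0 q / cos (turning q)).
Proof.
move=> q1; have /andP[p0 p1] := possq_itv q1.
have h : -1 < possq q < 1 by rewrite p1 andbT; lra.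
have H := @dcomp _ (@asin R) possq q _ _ (is_derive1_asin h) (is_derive_possq q).
nref (deq H _); rewrite /turning cos_asin; first by ring.
by apply/andP; split; lra.
Qed.

Lemma sqrtsin_turning q : q < 1 -> sqrtsin (turning q) = Num.max 0 q.
Proof. by move=> q1; rewrite /sqrtsin sin_turning// sqrt_possq. Qed.

Lemma is_derive_J_turning q : q < 1 ->
  is_derive q 1 (fun q => J (turning q)) (2 * sin (turning q) / cos (turning q)).
Proof.
move=> q1; have /andP[t0 t1] := turning_itv q1.
have d2 : is_derive (turning q) 1 J (sqrtsin (turning q)) by apply: is_derive_J; lra.
have H := @dcomp _ J turning q _ _ d2 (is_derive_turning q1).
nref (deq H _); rewrite sqrtsin_turning// sin_turning//.
have [q0|q0] := leP q 0; first by rewrite possq0//; ring.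
by rewrite possqE ?(ltW q0)//; ring.
Qed.

Lemma is_derive_elastica_abs phi M q : M != 0 -> q < 1 ->
  is_derive q 1 (elastica_abs phi M)
    (2 * cos (phi - turning q) / (M * cos (turning q))).
Proof.
move=> M0 q1; have d1 := is_derive_J_turning q1.
have c0 : cos (turning q) != 0 by rewrite gt_eqF// cos_turning_gt0.
nref (deq _ _); first by derives.
by rewrite cosB /=; field; rewrite M0 c0.
Qed.

Lemma is_derive_elastica_ord phi M q : M != 0 -> q < 1 ->
  is_derive q 1 (elastica_ord phi M)
    (2 * sin (phi - turning q) / (M * cos (turning q))).
Proof.
move=> M0 q1; have d1 := is_derive_J_turning q1.
have c0 : cos (turning q) != 0 by rewrite gt_eqF// cos_turning_gt0.
nref (deq _ _); first by derives.
by rewrite sinB /=; field; rewrite M0 c0.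
Qed.

Lemma elastica_abs_incr phi M q1 q2 : 0 < phi -> phi < pi / 2 -> 0 < M ->
  q1 < q2 -> q2 < 1 -> elastica_abs phi M q1 < elastica_abs phi M q2.
Proof.
move=> p0 p2 M0 q12 q21.
apply: (@incr_is_derive _ (elastica_abs phi M) (fun q =>
   (2 * cos (phi - turning q) / (M * cos (turning q))))) => //.
- move=> q /andP[qa qb]; apply: is_derive_elastica_abs; first by rewrite gt_eqF.
  exact: lt_trans q21.
- apply: continuous_in_subspaceT => q; rewrite inE/= in_itv/= => /andP[qa qb].
  apply: dcts; apply: is_derive_elastica_abs; first by rewrite gt_eqF.
  exact: le_lt_trans q21.
- move=> q /andP[qa qb]; have q_1 := lt_trans qb q21.
  have /andP[t0 t1] := turning_itv q_1.
  rewrite divr_gt0 ?mulr_gt0 ?cos_turning_gt0// cos_gt0_pihalf//.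
  by apply/andP; split; lra.
Qed.

Definition elastica_param phi M x : R :=
  xget 0 [set q | q < 1 /\ elastica_abs phi M q = x].

Lemma elastica_absK phi M q : 0 < phi -> phi < pi / 2 -> 0 < M -> q < 1 ->
  elastica_param phi M (elastica_abs phi M q) = q.
Proof.
move=> p0 p2 M0 q1.
have [|r1 rE] := @xgetPex _ 0
    [set r | r < 1 /\ elastica_abs phi M r = elastica_abs phi M q].
  by exists q.
rewrite /elastica_param; set r := xget _ _ in r1 rE *.
have [rq|qr|//] := ltgtP r q.
  by have := elastica_abs_incr p0 p2 M0 rq q1; rewrite rE ltxx.
by have := elastica_abs_incr p0 p2 M0 qr r1; rewrite rE ltxx.
Qed.

Lemma is_derive_elastica_param phi M q : 0 < phi -> phi < pi / 2 -> 0 < M ->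
  q < 1 -> is_derive (elastica_abs phi M q) 1 (elastica_param phi M)
    (M * cos (turning q) / (2 * cos (phi - turning q))).
Proof.
move=> p0 p2 M0 q1.
have /andP[t0 t1] := turning_itv q1.
have c1 := cos_turning_gt0 q1.
have c2 : 0 < cos (phi - turning q).
  by rewrite cos_gt0_pihalf//; apply/andP; split; lra.
have M0' : M != 0 by rewrite gt_eqF.
have h := is_derive_elastica_abs phi M0' q1.
have H : is_derive (elastica_abs phi M q) 1 (elastica_param phi M)
    (2 * cos (phi - turning q) / (M * cos (turning q)))^-1.
  apply: is_derive_inverse h _.
  - near=> r; apply: elastica_absK => //; near: r; exact: lt_nbhsl.
  - near=> r; apply: dcts; apply: is_derive_elastica_abs => //.
    by near: r; exact: lt_nbhsl.
  - by rewrite mulf_neq0 ?invr_eq0 ?mulf_neq0 ?gt_eqF.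
nref (deq H _); field.
by rewrite M0' !gt_eqF.
Unshelve. all: by end_near. Qed.

Lemma sqrtsin_lt1 phi : 0 < phi -> phi < pi / 2 -> sqrtsin phi < 1.
Proof.
move=> p0 p2; rewrite -sqrtr1 ltr_sqrt// -sin_pihalf ltr_sin// in_itv/=;
  by apply/andP; split; lra.
Qed.

Lemma turning_sqrtsin phi : 0 < phi -> phi < pi / 2 -> turning (sqrtsin phi) = phi.
Proof.
move=> p0 p2; have pi0 := pi_gt0 R.
rewrite /turning possqE ?sqrtr_ge0// sqr_sqrtsin; last by apply/andP; split; lra.
by rewrite sinK// in_itv/=; apply/andP; split; lra.
Qed.

Lemma turning_npos q : q <= 0 -> turning q = 0.
Proof.
move=> q0; rewrite /turning possq0// -[X in asin X]sin0 sinK// in_itv/=.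
by have := pi_gt0 R => ?; apply/andP; split; lra.
Qed.

Lemma elastica_abs_surj phi M x : 0 < phi -> phi < pi / 2 -> 0 < M ->
  x <= elastica_x phi / M ->
  exists q, [/\ q <= sqrtsin phi, q < 1 & elastica_abs phi M q = x].
Proof.
move=> p0 p2 M0 xM.
have s1 := sqrtsin_lt1 p0 p2; have pi0 := pi_gt0 R.
have c0 : 0 < cos phi by rewrite cos_gt0_pihalf//; apply/andP; split; lra.
have sE : elastica_abs phi M (sqrtsin phi) = elastica_x phi / M.
  by rewrite /elastica_abs turning_sqrtsin.
pose qm := Num.min 0 (M * x / (2 * cos phi)).
have qm0 : qm <= 0 by rewrite ge_min lexx.
have qmx : elastica_abs phi M qm <= x.
  rewrite /elastica_abs turning_npos// J0 mul0r addr0 ler_pdivrMr//.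
  have : qm * (2 * cos phi) <= M * x.
    by rewrite -ler_pdivlMr ?mulr_gt0// /qm ge_min lexx orbT.
  by lra.
have qs : qm <= sqrtsin phi by apply: le_trans qm0 _; exact: sqrtr_ge0.
have cA : {within `[qm, sqrtsin phi], continuous (elastica_abs phi M)}.
  apply: continuous_in_subspaceT => q; rewrite inE/= in_itv/= => /andP[_ qb].
  apply: dcts; apply: is_derive_elastica_abs; first by rewrite gt_eqF.
  exact: le_lt_trans s1.
have [|q] := @IVT _ _ _ _ x qs cA.
  by rewrite sE ge_min qmx le_max xM orbT.
rewrite in_itv/= => /andP[_ qb] qE; exists q; split => //.
exact: le_lt_trans s1.
Qed.

(** Since the parameter [q] takes negative values too, where the curve is a
    segment, one formula covers the segment and the arc; the shift [a0] makes the
    arc end at the midpoint. *)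
Lemma elastica_profile phi M : 0 < phi -> phi < pi / 2 -> 0 < M ->
  elastica_x phi <= M / 2 ->
  exists u theta : R -> R,
  [/\ (forall x, x <= 2^-1 -> is_derive x 1 u (tan (theta x))),
      (forall x, x <= 2^-1 -> is_derive x 1 theta
         (- M * sqrtsin (phi - theta x) / cos (theta x))),
      (forall x, x <= 2^-1 -> 0 <= theta x <= phi) &
      [/\ theta 2^-1 = 0,
      u 2^-1 = tan phi / 2 - J phi / (M * cos phi),
      (forall x, x <= 0 -> u x = tan phi * x) &
      (elastica_x phi = M / 2 -> forall x, 0 < x -> x <= 2^-1 -> theta x < phi)]].
Proof.
move=> p0 p2 M0 xM; have pi0 := pi_gt0 R.
have M0' : M != 0 by rewrite gt_eqF.
have c0 : 0 < cos phi by rewrite cos_gt0_pihalf//; apply/andP; split; lra.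
pose a0 := 2^-1 - elastica_x phi / M.
have a00 : 0 <= a0 by rewrite subr_ge0 ler_pdivrMr// mulrC.
pose S x := elastica_param phi M (x - a0).
have SE x : x <= 2^-1 ->
    [/\ S x <= sqrtsin phi, S x < 1 & elastica_abs phi M (S x) = x - a0].
  move=> xh; have [|q [q1 q2 q3]] := @elastica_abs_surj phi M (x - a0) p0 p2 M0.
    by rewrite /a0; lra.
  by rewrite /S -q3 elastica_absK.
have dS x : x <= 2^-1 -> is_derive x 1 S
    (M * cos (turning (S x)) / (2 * cos (phi - turning (S x)))).
  move=> xh; have [s1 s2 s3] := SE _ xh.
  have d1 := is_derive_elastica_param p0 p2 M0 s2; rewrite s3 in d1.
  have d2 : is_derive x 1 (fun x => x - a0) 1 by compute_deriv; rewrite /=; ring.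
  have H := @dcomp _ (elastica_param phi M) (fun x => x - a0) x _ _ d1 d2.
  by nref (deq H _); rewrite mulr1.
have tS x : x <= 2^-1 -> 0 <= turning (S x) <= phi.
  move=> xh; have [s1 s2 s3] := SE _ xh.
  have /andP[t0 t1] := turning_itv s2; rewrite t0/= leNgt; apply/negP => pt.
  have : sin phi < sin (turning (S x)).
    by rewrite ltr_sin// in_itv/=; apply/andP; split; lra.
  rewrite sin_turning// -sqr_sqrtsin; last by apply/andP; split; lra.
  have [q0|q0] := leP (S x) 0; first by rewrite possq0// ltNge sqr_ge0.
  by rewrite possqE ?(ltW q0)// ltr_sqr ?nnegrE ?(ltW q0) ?sqrtr_ge0// ltNge s1.
have ct x : x <= 2^-1 -> 0 < cos (phi - turning (S x)).
  move=> /tS /andP[? ?]; rewrite cos_gt0_pihalf//; by apply/andP; split; lra.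
have aE : a0 = 2^-1 - elastica_x phi / M by [].
have Sh : S 2^-1 = sqrtsin phi.
  rewrite /S (_ : 2^-1 - a0 = elastica_abs phi M (sqrtsin phi)).
    by rewrite elastica_absK// sqrtsin_lt1.
  by rewrite /elastica_abs turning_sqrtsin// /a0 opprB addrC subrK.
exists (fun x => tan phi * a0 + elastica_ord phi M (S x)).
exists (fun x => phi - turning (S x)).
split; last split.
- move=> x xh; have [s1 s2 s3] := SE _ xh.
  have d1 := @dcomp _ (elastica_ord phi M) S x _ _
    (is_derive_elastica_ord phi M0' s2) (dS _ xh).
  nref (deq (dD (dcst _ _) d1) _); rewrite /tan; field.
  by rewrite M0' !gt_eqF ?ct ?cos_turning_gt0.
- move=> x xh; have [s1 s2 s3] := SE _ xh.
  have d1 := @dcomp _ turning S x _ _ (is_derive_turning s2) (dS _ xh).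
  nref (deq (dD (dcst _ _) (dN d1)) _).
  rewrite (_ : phi - (phi - turning (S x)) = turning (S x)); last by ring.
  rewrite sqrtsin_turning//; field.
  by rewrite !gt_eqF ?ct ?cos_turning_gt0.
- by move=> x xh; have /andP[? ?] := tS _ xh; apply/andP; split; lra.
- by rewrite Sh turning_sqrtsin// subrr.
- rewrite Sh /elastica_ord turning_sqrtsin// /a0 /elastica_x /tan.
  rewrite -[X in _ = _ - X / _]mulr1 -(cos2Dsin2 phi).
  by field; rewrite M0' cos2Dsin2 oner_eq0 gt_eqF.
- move=> x x0; have xh : x <= 2^-1 by apply: le_trans x0 _; rewrite invr_ge0.
  pose q := M * (x - a0) / (2 * cos phi).
  have q0 : q <= 0.
    rewrite /q -mulrA mulrCA pmulr_lle0; first by lra.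
    by rewrite mulr_gt0// invr_gt0 mulr_gt0.
  have qE : elastica_abs phi M q = x - a0.
    rewrite /elastica_abs turning_npos// J0 /q; field.
    by rewrite M0' gt_eqF.
  have -> : S x = q by rewrite /S -qE elastica_absK//; lra.
  rewrite /elastica_ord turning_npos// J0 /q /tan. field.
  by rewrite M0' gt_eqF.
- move=> xE x x0 xh; have [s1 s2 s3] := SE _ xh.
  have a0E : a0 = 0 by rewrite /a0 xE; field.
  rewrite ltrBlDr ltrDl lt_neqAle eq_sym; have /andP[-> _] := tS _ xh.
  rewrite andbT; apply/eqP => t0.
  have Sx0 : S x <= 0.
    rewrite leNgt; apply/negP => Sx.
    have := sin_turning s2; rewrite t0 sin0 possqE ?(ltW Sx)// => /esym/eqP.
    by rewrite sqrf_eq0 gt_eqF.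
  move: s3; rewrite /elastica_abs t0 J0 a0E subr0 mul0r addr0 => xE'.
  move: x0; rewrite -xE' ltNge => /negP; apply.
  rewrite -mulrA -mulrA pmulr_rle0// pmulr_lle0//.
  by rewrite mulr_gt0// invr_gt0.
Unshelve. all: by end_near. Qed.

End ElasticaProfile.

(** * Functions given by two formulas *)

Section PiecewiseC1.
Context {R : realType}.
Implicit Types (u g w phi : R -> R) (a b c d e x : R).
Local Notation mu := (@lebesgue_measure R).
Local Notation I01 := (`]0, 1[%classic : set R).

Lemma FTC_within (F f : R -> R) a b : a < b ->
  (forall x, a < x < b -> is_derive x 1 F (f x)) ->
  {within `[a, b], continuous F} -> {within `[a, b], continuous f} ->
  \int[mu]_(x in `[a, b]) f x = F b - F a.
Proof.
move=> ab dF cF cf; rewrite /Rintegral (@continuous_FTC2 R f F a b)//=.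
- have [_ ra lb] := (continuous_within_itvP F ab).1 cF.
  split => // x; rewrite in_itv/= => xab.
  by have [] := dF x xab.
- move=> x; rewrite in_itv/= => xab; apply: d1E; exact: dF.
Qed.

Definition halves (g1 g2 : R -> R) x := if x <= 2^-1 then g1 x else g2 x.

Lemma halves_integral g1 g2 : {within `[0, 2^-1], continuous g1} ->
  {within `[2^-1, 1], continuous g2} ->
  mu.-integrable I01 (EFin \o halves g1 g2) /\
  \int[mu]_(x in I01) halves g1 g2 x =
  \int[mu]_(x in `[0, 2^-1]) g1 x + \int[mu]_(x in `[2^-1, 1]) g2 x.
Proof.
move=> c1 c2; have h2 : 0 < 2^-1 :> R by rewrite invr_gt0.
have h21 : 2^-1 < 1 :> R by rewrite invf_lt1// ltr1n.
have i1 := continuous_integrable c1; have i2 := continuous_integrable c2.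
have i2' : mu.-integrable `]2^-1, 1] (EFin \o g2).
  by apply: integrableS i2 => //; apply: subset_itv; rewrite bnd_simp.
have [l1 l2] : mu.-integrable setT (EFin \o (g1 \_ `[0, 2^-1])) /\
    mu.-integrable setT (EFin \o (g2 \_ `]2^-1, 1])).
  by split; rewrite -restrict_EFin -integrable_mkcond.
have E x : `[0, 1]%classic x -> halves g1 g2 x =
    (g1 \_ `[0, 2^-1]) x + (g2 \_ `]2^-1, 1]) x.
  rewrite /= in_itv/= => /andP[x0 x1]; rewrite /halves !patchE.
  have [xh|xh] := leP x 2^-1.
    rewrite mem_set; last by rewrite /= in_itv/= x0.
    by rewrite memNset ?addr0//= in_itv/= ltNge xh.
  rewrite memNset; last by rewrite /= in_itv/= x0/= leNgt xh.
  by rewrite mem_set ?add0r//= in_itv/= xh.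
have k1 : mu.-integrable `[0, 1] (EFin \o (g1 \_ `[0, 2^-1])) by exact: integrableS l1.
have k2 : mu.-integrable `[0, 1] (EFin \o (g2 \_ `]2^-1, 1])) by exact: integrableS l2.
have ih : mu.-integrable `[0, 1] (EFin \o halves g1 g2).
  have k := rintegrableD (measurable_itv _) k1 k2.
  by apply: rintegrable_eq k => // x xI; rewrite E.
have ihI : mu.-integrable I01 (EFin \o halves g1 g2).
  by apply: integrableS ih => //; exact: I01_cc.
split => //.
have -> : \int[mu]_(x in I01) halves g1 g2 x = \int[mu]_(x in `[0, 1]) halves g1 g2 x.
  by rewrite /Rintegral [in RHS]integral_itv_bndoo//; exact: (measurable_int _ ihI).
rewrite (@Rintegral_chasles _ _ 0 2^-1 1) ?ltW//; congr (_ + _).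
  apply: eq_Rintegral => x; rewrite inE/= in_itv/= => /andP[_ xh].
  by rewrite /halves xh.
have ih2 : mu.-integrable `]2^-1, 1] (EFin \o halves g1 g2).
  by apply: integrableS ih => //; apply: subset_itv; rewrite bnd_simp// ltW.
rewrite -Rintegral_itv_obnd_cbnd// -[RHS]Rintegral_itv_obnd_cbnd//.
apply: eq_Rintegral => x; rewrite inE/= in_itv/= => /andP[xh _].
by rewrite /halves leNgt xh.
Qed.

Lemma test_function_is_derive phi : test_function phi ->
  [/\ forall x, is_derive x 1 phi (derive1 phi x), continuous phi,
      continuous (derive1 phi), phi 0 = 0 & phi 1 = 0].
Proof.
move=> [dphi cphi [K [cK KI phi0]]].
have h x : is_derive x 1 phi (derive1 phi x).
  by apply: DeriveDef => //; rewrite derive1E.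
split => //.
- by move=> x; exact: dcts (h x).
- by apply: phi0 => /KI; rewrite /= in_itv/= ltxx.
- by apply: phi0 => /KI; rewrite /= in_itv/= ltxx andbF.
Qed.

(** Integrating by parts on each half leaves the jump at the midpoint. *)
Lemma halves_by_parts u1 u2 g1 g2 phi : test_function phi ->
  {within `[0, 2^-1], continuous u1} -> {within `[2^-1, 1], continuous u2} ->
  {within `[0, 2^-1], continuous g1} -> {within `[2^-1, 1], continuous g2} ->
  (forall x, 0 < x < 2^-1 -> is_derive x 1 u1 (g1 x)) ->
  (forall x, 2^-1 < x < 1 -> is_derive x 1 u2 (g2 x)) ->
  \int[mu]_(x in I01) (halves u1 u2 x * derive1 phi x) =
  (u1 2^-1 - u2 2^-1) * phi 2^-1 - \int[mu]_(x in I01) (halves g1 g2 x * phi x).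
Proof.
move=> /test_function_is_derive[dphi cphi cdphi phi0 phi1] cu1 cu2 cg1 cg2 du1 du2.
have h2 : 0 < 2^-1 :> R by rewrite invr_gt0.
have h21 : 2^-1 < 1 :> R by rewrite invf_lt1// ltr1n.
have wM (v w : R -> R) a b : {within `[a, b], continuous v} -> continuous w ->
    {within `[a, b], continuous (fun x => v x * w x)}.
  move=> cv cw x; apply: cvgM; first exact: cv.
  exact: (continuous_subspaceT cw).
have hM (v1 v2 w : R -> R) : (fun x => halves v1 v2 x * w x) =
    halves (fun x => v1 x * w x) (fun x => v2 x * w x).
  by apply/funext => x; rewrite /halves; case: ifP.
have [_ ->] : mu.-integrable I01 (EFin \o halves (fun x => u1 x * derive1 phi x) (fun x => u2 x * derive1 phi x)) /\
  \int[mu]_(x in I01) (halves u1 u2 x * derive1 phi x) =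
  \int[mu]_(x in `[0, 2^-1]) (u1 x * derive1 phi x) +
  \int[mu]_(x in `[2^-1, 1]) (u2 x * derive1 phi x).
  by rewrite hM; apply: halves_integral; apply: wM.
have [_ ->] : mu.-integrable I01 (EFin \o halves (fun x => g1 x * phi x) (fun x => g2 x * phi x)) /\
  \int[mu]_(x in I01) (halves g1 g2 x * phi x) =
  \int[mu]_(x in `[0, 2^-1]) (g1 x * phi x) +
  \int[mu]_(x in `[2^-1, 1]) (g2 x * phi x).
  by rewrite hM; apply: halves_integral; apply: wM.
have part a b (v g : R -> R) : a < b -> {within `[a, b], continuous v} ->
    {within `[a, b], continuous g} ->
    (forall x, a < x < b -> is_derive x 1 v (g x)) ->
    \int[mu]_(x in `[a, b]) (v x * derive1 phi x) =
    v b * phi b - v a * phi a - \int[mu]_(x in `[a, b]) (g x * phi x).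
  move=> ab cv cg dv.
  have iv := continuous_integrable (wM _ _ _ _ cv cdphi).
  have ig := continuous_integrable (wM _ _ _ _ cg cphi).
  have : \int[mu]_(x in `[a, b]) (g x * phi x + v x * derive1 phi x) =
      v b * phi b - v a * phi a.
    apply: (@FTC_within (fun x => v x * phi x)) => //.
    - by move=> x xab; have dvx := dv x xab; have dpx := dphi x; exact: dM.
    - exact: wM.
    - by move=> x; apply: cvgD; apply: wM.
  by rewrite RintegralD// => <-; rewrite addrC addKr.
by rewrite (part _ _ _ _ h2 cu1 cg1 du1) (part _ _ _ _ h21 cu2 cg2 du2) phi0 phi1; ring.
Qed.

Lemma halves_weak_deriv u g1 g2 : {within `[0, 1], continuous u} ->
  {within `[0, 2^-1], continuous g1} -> {within `[2^-1, 1], continuous g2} ->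
  (forall x, 0 < x < 2^-1 -> is_derive x 1 u (g1 x)) ->
  (forall x, 2^-1 < x < 1 -> is_derive x 1 u (g2 x)) ->
  is_weak_deriv u (halves g1 g2).
Proof.
move=> cu cg1 cg2 du1 du2.
have h2 : 0 <= 2^-1 :> R by rewrite invr_ge0.
have h21 : 2^-1 <= 1 :> R by rewrite invf_le1// ler1n.
have cu1 : {within `[0, 2^-1], continuous u}.
  by apply: continuous_subspaceW cu; apply: subset_itv; rewrite bnd_simp.
have cu2 : {within `[2^-1, 1], continuous u}.
  by apply: continuous_subspaceW cu; apply: subset_itv; rewrite bnd_simp.
have ui : mu.-integrable I01 (EFin \o u).
  by apply: integrableS (continuous_integrable cu) => //; exact: I01_cc.
have [gi _] := halves_integral cg1 cg2.
split.
- by apply: open_integrable_locally => //; exact: interval_open.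
- by apply: open_integrable_locally => //; exact: interval_open.
- move=> phi tphi.
  have := halves_by_parts tphi cu1 cu2 cg1 cg2 du1 du2.
  rewrite subrr mul0r sub0r => <-.
  by apply: eq_Rintegral => x _; rewrite /halves; case: ifP.
Qed.

(** The jump and the integral of the derivative bound the variation. *)
Lemma halves_BV (g1 g2 k1 k2 : R -> R) :
  {within `[0, 2^-1], continuous g1} -> {within `[2^-1, 1], continuous g2} ->
  {within `[0, 2^-1], continuous k1} -> {within `[2^-1, 1], continuous k2} ->
  (forall x, 0 < x < 2^-1 -> is_derive x 1 g1 (k1 x)) ->
  (forall x, 2^-1 < x < 1 -> is_derive x 1 g2 (k2 x)) ->
  BV01 (halves g1 g2).
Proof.
move=> cg1 cg2 ck1 ck2 dg1 dg2.
have [gi _] := halves_integral cg1 cg2.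
have [ki _] := halves_integral ck1 ck2.
split => //.
exists (`|g1 2^-1 - g2 2^-1| + \int[mu]_(x in I01) `|halves k1 k2 x|).
move=> phi tphi phi1; rewrite (halves_by_parts tphi cg1 cg2 ck1 ck2 dg1 dg2).
have [_ cphi _ _ _] := test_function_is_derive tphi.
apply: lerD.
  apply: le_trans (ler_norm _) _; rewrite normrM ler_piMr//.
have kphi : mu.-integrable I01 (EFin \o (fun x => halves k1 k2 x * phi x)).
  apply: (@integrable_mul_bounded _ _ _ _ 1) => //.
  exact: continuous_measurable.
apply: le_trans (ler_norm _) _; rewrite normrN.
apply: (le_trans (le_normr_Rintegral _ kphi)) => //.
apply: le_Rintegral => //.
- exact: integrable_norm.
- exact: integrable_norm.
- by move=> x _; rewrite normrM ler_piMr.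
Qed.

Lemma Lnorm2_lt w d : 0 < d -> (\int[mu]_(x in I01) (w x ^+ 2)%:E < (d ^+ 2)%:E)%E ->
  ('N[mu]_2%:E[EFin \o (w \_ I01)] < d%:E)%E.
Proof.
move=> d0; rewrite -Lnorm2E; set N := ('N[mu]_ _ [_])%E => Nd.
have N0 : (0 <= N)%E by exact: Lnorm_ge0.
have : (N < +oo)%E.
  by apply: (@lty_poweRy _ _ 2) => //; exact: lt_trans Nd (ltry _).
move: N N0 Nd => [r| |]//= r0.
rewrite lte_fin powR_mulrn// !lte_fin => h _.
by rewrite -ltr_sqr ?nnegrE// ltW.
Qed.

End PiecewiseC1.

(** * Positive C^1 functions belong to H^1_0 *)

Section H10.
Context {R : realType}.
Implicit Types (u p : R -> R) (e s x : R).
Local Notation mu := (@lebesgue_measure R).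
Local Notation I01 := (`]0, 1[%classic : set R).

Lemma L2_continuous u : continuous u -> L2 u.
Proof.
move=> cu; have cu' : {within `[0, 1], continuous u} by exact: continuous_subspaceT.
have [M hM] := within_bounded ler01 cu'.
apply: (@L2_bounded _ _ M); first exact: continuous_measurable.
by move=> x; rewrite /= in_itv/= => /andP[x0 x1]; apply: hM; rewrite !ltW.
Qed.

Lemma C1_weak_deriv u p : (forall x, is_derive x 1 u (p x)) -> continuous p ->
  is_weak_deriv u p.
Proof.
move=> up cp; rewrite (_ : p = halves p p); last first.
  by apply/funext => x; rewrite /halves; case: ifP.
apply: halves_weak_deriv => //; try exact: continuous_subspaceT.
by apply: continuous_subspaceT => x; exact: (dcts (up x)).
Qed.

(** A C^1 truncation: zero below [e], close to the identity above. *)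
Definition trunc e s : R := if s <= e then 0 else (s - e) ^+ 2 / s.
Definition dtrunc e s : R := if s <= e then 0 else 1 - (e / s) ^+ 2.

Lemma is_derive_trunc e s : 0 < e -> is_derive s 1 (trunc e) (dtrunc e s).
Proof.
move=> e0; rewrite /dtrunc.
have h (t : R) : 0 < t -> is_derive t 1 (fun s => (s - e) ^+ 2 / s) (1 - (e / t) ^+ 2).
  move=> t0; have t0' : t != 0 by rewrite gt_eqF.
  by compute_deriv; rewrite /=; field.
have [se|se|se] := ltgtP s e.
- nref (@dnear _ (fun=> 0) _ _ _ _ (dcst _ _)).
  near=> t; rewrite /trunc ifT//; apply/ltW; near: t; exact: lt_nbhsl.
- nref (@dnear _ (fun s => (s - e) ^+ 2 / s) _ _ _ _ (h _ (lt_trans e0 se))).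
  near=> t; rewrite /trunc ifF//; apply/negbTE; rewrite -ltNge; near: t.
  exact: lt_nbhsr.
- rewrite se; nref (@dglue _ (fun=> 0) (fun s => (s - e) ^+ 2 / s) e 0 _ (dcst _ _) _).
    by rewrite subrr expr0n mul0r.
  by nref (deq (h _ e0) _); rewrite divff ?gt_eqF// expr1n subrr.
Unshelve. all: by end_near. Qed.

Lemma cglue (f g : R -> R) c : f c = g c -> {for c, continuous f} ->
  {for c, continuous g} -> {for c, continuous (fun x => if x <= c then f x else g x)}.
Proof.
move=> fg /cvgrPdist_lt cf /cvgrPdist_lt cg; apply/cvgrPdist_lt => e e0.
rewrite /= lexx; have [/= d1 d10 h1] := cf _ e0.
have := cg _ e0; rewrite -fg => -[/= d2 d20 h2].
exists (Num.min d1 d2) => /=; first by rewrite lt_min d10.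
move=> t /=; rewrite lt_min => /andP[t1 t2].
by case: ifP => _; [exact: h1|exact: h2].
Qed.

Lemma cts_near (f g : R -> R) x : (\near x, f x = g x) ->
  {for x, continuous f} -> {for x, continuous g}.
Proof.
move=> fg cf; have fgx : f x = g x := nbhs_singleton fg.
rewrite /prop_for /continuous_at -fgx; apply: cvg_trans cf.
apply: near_eq_cvg; apply: filterS fg => y <-//.
Qed.

Lemma continuous_halves (f g : R -> R) : f 2^-1 = g 2^-1 ->
  (forall x, x <= 2^-1 -> {for x, continuous f}) ->
  (forall x, 2^-1 <= x -> {for x, continuous g}) -> continuous (halves f g).
Proof.
move=> fg cf cg x; have [xh|xh|->] := ltgtP x 2^-1.
- apply: (@cts_near f); last by apply: cf; exact: ltW.
  near=> y; rewrite /halves ifT//; apply/ltW; near: y; exact: lt_nbhsl.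
- apply: (@cts_near g); last by apply: cg; exact: ltW.
  near=> y; rewrite /halves ifF//; apply/negbTE.
  by rewrite -ltNge; near: y; exact: lt_nbhsr.
- by apply: cglue => //; [exact: cf|exact: cg].
Unshelve. all: by end_near. Qed.

Lemma continuous_dtrunc e : 0 < e -> continuous (dtrunc e).
Proof.
move=> e0 s.
have h (t : R) : 0 < t -> {for t, continuous (fun s => 1 - (e / s) ^+ 2)}.
  move=> t0; have t0' : t != 0 by rewrite gt_eqF.
  have d : is_derive t 1 (fun s => 1 - (e / s) ^+ 2) (2 * e ^+ 2 / t ^+ 3).
    by compute_deriv; rewrite /=; field.
  exact: dcts d.
have [se|se|->] := ltgtP s e.
- apply: (@cts_near (fun=> 0)); last exact: cst_continuous.
  near=> y; rewrite /dtrunc ifT//; apply/ltW; near: y; exact: lt_nbhsl.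
- apply: (@cts_near (fun s => 1 - (e / s) ^+ 2)); last by apply: h; exact: lt_trans se.
  near=> y; rewrite /dtrunc ifF//; apply/negbTE.
  by rewrite -ltNge; near: y; exact: lt_nbhsr.
- apply: cglue; first by rewrite divff ?gt_eqF// expr1n subrr.
    exact: cst_continuous.
  exact: h.
Unshelve. all: by end_near. Qed.

Lemma dtrunc_itv e s : 0 < e -> 0 <= 1 - dtrunc e s <= 1.
Proof.
move=> e0; rewrite /dtrunc; have [se|se] := leP s e; first by rewrite subr0 ler01 lexx.
have s0 := lt_trans e0 se.
rewrite opprB addrC subrK sqr_ge0/= expr_le1// ?divr_ge0 ?ltW//.
by rewrite ltr_pdivrMr// mul1r.
Qed.

Lemma trunc_itv e s : 0 < e -> 0 <= s -> 0 <= s - trunc e s <= 2 * e.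
Proof.
move=> e0 s0; rewrite /trunc; have [se|se] := leP s e.
  by apply/andP; split; lra.
have s1 := lt_trans e0 se.
rewrite (_ : s - (s - e) ^+ 2 / s = 2 * e - e ^+ 2 / s); last first.
  by field; rewrite gt_eqF.
have h1 : 0 <= e ^+ 2 / s by rewrite divr_ge0 ?sqr_ge0.
have h2 : e ^+ 2 / s <= e by rewrite ler_pdivrMr// expr2 ler_pM2l// ltW.
by apply/andP; split; lra.
Qed.

(** The truncations of [u] at small levels are test functions, because [u] is
    positive only inside the interval; they and their derivatives converge
    pointwise and boundedly. *)
Lemma H10_of_C1 u p : (forall x, is_derive x 1 u (p x)) -> continuous p ->
  (forall x, I01 x -> 0 < u x) -> (forall x, ~ I01 x -> u x <= 0) -> H10 u.
Proof.
move=> du cp u0 uN.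
have cu : continuous u by move=> x; exact: dcts (du x).
have cpw (v : R -> R) : continuous v -> {within `[0, 1], continuous v}.
  by move=> cv; exact: continuous_subspaceT.
have [Mp hMp] : exists M, forall x, I01 x -> `|p x| <= M.
  have [M hM] := within_bounded ler01 (cpw _ cp).
  by exists M => x; rewrite /= in_itv/= => /andP[x0 x1]; apply: hM; rewrite !ltW.
split; first exact: L2_continuous.
exists p; split; [exact: C1_weak_deriv|exact: L2_continuous|].
move=> e e0.
pose d n : R := n.+1%:R^-1.
have d0 n : 0 < d n by rewrite invr_gt0.
have dlim : d @ \oo --> (0 : R) by exact: cvg_harmonic.
have dp n x : is_derive x 1 (trunc (d n) \o u) (dtrunc (d n) (u x) * p x).
  exact: (dcomp (is_derive_trunc (u x) (d0 n)) (du x)).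
have d1p n : derive1 (trunc (d n) \o u) = fun x => dtrunc (d n) (u x) * p x.
  by apply/funext => x; exact: d1E.
have cdt n : continuous (fun x => dtrunc (d n) (u x)).
  move=> x; apply: (@continuous_comp _ _ _ u (dtrunc (d n))); first exact: cu.
  exact: continuous_dtrunc.
have test n : test_function (trunc (d n) \o u).
  split.
  - by move=> x; have [] := dp n x.
  - by rewrite d1p => x; apply: cvgM; [exact: cdt|exact: cp].
  - exists (`[0, 1]%classic `&` (u @^-1` [set s | d n <= s])); split.
    + apply: compact_closedI; first exact: segment_compact.
      by apply: closed_comp; [move=> x _; exact: cu|exact: closed_ge].
    + move=> x [_ /= dx]; apply: contrapT => /uN; rewrite leNgt => /negP; apply.
      exact: lt_le_trans dx.
    + move=> x xK; rewrite /trunc/=; have [//|dx] := leP (u x) (d n); exfalso; apply: xK.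
      split; last exact: ltW.
      have : I01 x by apply: contrapT => /uN; rewrite leNgt (lt_trans _ dx).
      exact: I01_cc.
pose g1 n x := (u x - trunc (d n) (u x)) ^+ 2.
pose g2 n x := (p x - dtrunc (d n) (u x) * p x) ^+ 2.
have ct n : continuous (trunc (d n) \o u) by move=> x; exact: dcts (dp n x).
have cg1 n : continuous (g1 n).
  move=> x; apply: (@continuous_comp _ _ _ (fun x => u x - trunc (d n) (u x)) (fun t => t ^+ 2)).
    by apply: cvgB; [exact: cu|exact: ct].
  exact: exprn_continuous.
have cg2 n : continuous (g2 n).
  move=> x; apply: (@continuous_comp _ _ _ (fun x => p x - dtrunc (d n) (u x) * p x) (fun t => t ^+ 2)).
    apply: cvgB; first exact: cp.
    by apply: cvgM; [exact: cdt|exact: cp].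
  exact: exprn_continuous.
have l1 : \int[mu]_(x in I01) g1 n x @[n --> \oo] --> (0 : R).
  suff : \int[mu]_(x in I01) g1 n x @[n --> \oo] --> \int[mu]_(x in I01) (0 : R).
    by rewrite Rintegral_cst// mul0r.
  apply: (@Rdominated_cvg _ _ _ _ (fun=> 4)) => //.
  - by move=> n; exact: continuous_measurable.
  - move=> x Ix.
    have dlim2 : 4 * d n ^+ 2 @[n --> \oo] --> (0 : R).
      suff : 4 * (d n * d n) @[n --> \oo] --> 4 * (0 * 0 : R).
        by rewrite !mulr0; under eq_fun do rewrite -expr2.
      by apply: cvgM; [exact: cvg_cst|exact: cvgM].
    apply: (squeeze_cvgr _ (cvg_cst 0) dlim2).
    apply: nearW => n; rewrite sqr_ge0/=.
    have /andP[t0 t1] := trunc_itv (d0 n) (ltW (u0 _ Ix)).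
    rewrite (_ : 4 * d n ^+ 2 = (2 * d n) ^+ 2); last by ring.
    by rewrite ler_sqr ?nnegrE// (le_trans t0).
  - by apply: integrable_cst => //; exact: mu_I01_lty.
  - move=> n x Ix; rewrite ger0_norm ?sqr_ge0//.
    have /andP[t0 t1] := trunc_itv (d0 n) (ltW (u0 _ Ix)).
    have dn1 : d n <= 1 by rewrite invf_le1// ler1n.
    by rewrite /g1; nra.
have l2 : \int[mu]_(x in I01) g2 n x @[n --> \oo] --> (0 : R).
  suff : \int[mu]_(x in I01) g2 n x @[n --> \oo] --> \int[mu]_(x in I01) (0 : R).
    by rewrite Rintegral_cst// mul0r.
  apply: (@Rdominated_cvg _ _ _ _ (fun=> Mp ^+ 2)) => //.
  - by move=> n; exact: continuous_measurable.
  - move=> x Ix; have ux := u0 _ Ix.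
    have dlim2 : (d n / u x) ^+ 2 * p x @[n --> \oo] --> (0 : R).
      suff : (d n / u x) * (d n / u x) * p x @[n --> \oo] --> (0 / u x) * (0 / u x) * p x.
        by rewrite !mul0r; under eq_fun do rewrite -expr2.
      have k : d n / u x @[n --> \oo] --> 0 / u x.
        by apply: cvgM => //; exact: cvg_cst.
      by apply: cvgM; [exact: cvgM|exact: cvg_cst].
    have dlim3 : ((d n / u x) ^+ 2 * p x) ^+ 2 @[n --> \oo] --> (0 : R).
      suff : ((d n / u x) ^+ 2 * p x) * ((d n / u x) ^+ 2 * p x) @[n --> \oo] --> (0 * 0 : R).
        by rewrite !mul0r; under eq_fun do rewrite -expr2.
      exact: cvgM.
    apply: cvg_trans dlim3; apply: near_eq_cvg.
    move/cvgrPdist_lt : dlim => /(_ _ ux).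
    apply: filterS => n; rewrite sub0r normrN gtr0_norm// => dn.
    by rewrite /g2 /dtrunc leNgt dn /=; congr (_ ^+ 2); ring.
  - by apply: integrable_cst => //; exact: mu_I01_lty.
  - move=> n x Ix; rewrite ger0_norm ?sqr_ge0//.
    have /andP[t0 t1] := dtrunc_itv (u x) (d0 n).
    have := hMp _ Ix; rewrite /g2 (_ : _ - _ = (1 - dtrunc (d n) (u x)) * p x); last by ring.
    move=> h; rewrite exprMn -[p x ^+ 2]real_normK ?num_real//.
    rewrite -[leRHS]mul1r ler_pM ?sqr_ge0//; first by rewrite expr_le1.
    by rewrite ler_sqr ?nnegrE// (le_trans _ h).
have e20 : 0 < (e / 2) ^+ 2 by rewrite exprn_gt0// divr_gt0.
have fin (g : R -> R) : continuous g ->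
    (\int[mu]_(x in I01) (g x)%:E = (\int[mu]_(x in I01) g x)%:E)%E.
  move=> cg; rewrite /Rintegral fineK//; apply: integrable_fin_num => //.
  by apply: integrableS (continuous_integrable (cpw _ cg)) => //; exact: I01_cc.
have n1 : \forall n \near \oo, \int[mu]_(x in I01) g1 n x < (e / 2) ^+ 2.
  move/cvgrPdist_lt : l1 => /(_ _ e20); apply: filterS => n.
  by rewrite sub0r normrN; apply: le_lt_trans; exact: ler_norm.
have n2 : \forall n \near \oo, \int[mu]_(x in I01) g2 n x < (e / 2) ^+ 2.
  move/cvgrPdist_lt : l2 => /(_ _ e20); apply: filterS => n.
  by rewrite sub0r normrN; apply: le_lt_trans; exact: ler_norm.
have [n _ hn] := filterI n1 n2; have [h1 h2] := hn n (leqnn n).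
exists (trunc (d n) \o u) => //.
have -> : e%:E = ((e / 2)%:E + (e / 2)%:E)%E by rewrite -EFinD; congr (_%:E); field.
apply: lteD; apply: Lnorm2_lt; rewrite ?divr_gt0//.
- by rewrite -[X in (X < _)%E]/(\int[mu]_(x in I01) (g1 n x)%:E)%E fin// lte_fin.
- rewrite d1p -[X in (X < _)%E]/(\int[mu]_(x in I01) (g2 n x)%:E)%E fin// lte_fin.
Qed.

End H10.

(** * Boundary values in H^1_0 *)

Section H10Boundary.
Context {R : realType}.
Implicit Types (u g w : R -> R) (a b d e x y : R).
Local Notation mu := (@lebesgue_measure R).
Local Notation I01 := (`]0, 1[%classic : set R).

Lemma Lnorm2_lt_integral w d : 0 < d ->
  ('N[mu]_2%:E[EFin \o (w \_ I01)] < d%:E)%E ->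
  (\int[mu]_(x in I01) (w x ^+ 2)%:E < (d ^+ 2)%:E)%E.
Proof.
move=> d0; rewrite -Lnorm2E; set N := ('N[mu]_ _ [_])%E.
have N0 : (0 <= N)%E by exact: Lnorm_ge0.
move: N N0 => [r| |]//= r0; rewrite !lte_fin => rd.
by rewrite powR_mulrn// ltr_sqr ?nnegrE// ltW.
Qed.

(** Integrate [2 d |w| <= w ^ 2 + d ^ 2] over the interval, whose measure is one. *)
Lemma integral_norm_le w d : 0 < d -> L2 w ->
  ('N[mu]_2%:E[EFin \o (w \_ I01)] < d%:E)%E ->
  \int[mu]_(x in I01) `|w x| <= d.
Proof.
move=> d0 Lw /(Lnorm2_lt_integral d0) wd.
have w2 := L2_sqr Lw; have w1 := L2_integrable Lw.
have ci := integrable_cst (d / 2) (measurable_itv _) mu_I01_lty.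
have wd' : \int[mu]_(x in I01) (w x ^+ 2) < d ^+ 2.
  rewrite -lte_fin /Rintegral fineK//; exact: integrable_fin_num.
have k : mu.-integrable I01 (EFin \o (fun x => (2 * d)^-1 * w x ^+ 2)).
  exact: rintegrableZ.
apply: (@le_trans _ _ (\int[mu]_(x in I01) ((2 * d)^-1 * w x ^+ 2 + d / 2))).
  apply: le_Rintegral => //.
  - exact: integrable_norm.
  - exact: rintegrableD.
  - move=> x _; rewrite -[w x ^+ 2]real_normK ?num_real//.
    rewrite -subr_ge0 (_ : _ - _ = (2 * d)^-1 * (`|w x| - d) ^+ 2).
      by rewrite mulr_ge0 ?sqr_ge0// invr_ge0 mulr_ge0// ltW.
    by field; rewrite gt_eqF.
have E : \int[mu]_(x in I01) ((2 * d)^-1 * w x ^+ 2 + d / 2) =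
    (2 * d)^-1 * \int[mu]_(x in I01) (w x ^+ 2) + \int[mu]_(x in I01) (d / 2).
  have E1 : \int[mu]_(x in I01) ((2 * d)^-1 * w x ^+ 2) =
      (2 * d)^-1 * \int[mu]_(x in I01) (w x ^+ 2) by exact: RintegralZl.
  by rewrite -E1; exact: RintegralD.
have E2 : \int[mu]_(x in I01) (d / 2) = d / 2.
  have muI : mu I01 = 1%E.
    by rewrite lebesgue_measure_itv/= lte_fin ltr01 -EFinD subr0.
  by rewrite Rintegral_cst// [X in _ * X](_ : _ = 1) ?mulr1//; exact: (congr1 fine muI).
rewrite E E2 -lerBrDr (_ : d - d / 2 = (2 * d)^-1 * d ^+ 2); last first.
  by field; rewrite gt_eqF.
by rewrite ler_pM2l ?invr_gt0 ?mulr_gt0// ltW.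
Qed.

(** If [u 0] were not zero, then for a test function [phi] close to [u] the
    difference [u - phi] would start at [u 0] and vary little, its derivative
    being small in L^1; it would stay too large to be small in L^2. *)
Lemma H10_boundary u : {within `[0, 1], continuous u} -> H10 u -> u 0 = 0.
Proof.
move=> cu [Lu [g [ug Lg app]]]; apply/eqP; apply/negPn/negP => u00.
pose e := `|u 0| / 4; have e0 : 0 < e by rewrite divr_gt0// normr_gt0.
have [phi tphi Ne] := app e e0.
have [dphi cphi cdphi phi0 _] := test_function_is_derive tphi.
have N1 : ('N[mu]_2%:E[EFin \o ((u \- phi)%R \_ I01)] < e%:E)%E.
  by apply: le_lt_trans Ne; rewrite leeDl// Lnorm_ge0.
have N2 : ('N[mu]_2%:E[EFin \o ((g \- derive1 phi)%R \_ I01)] < e%:E)%E.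
  by apply: le_lt_trans Ne; rewrite leeDr// Lnorm_ge0.
have LB (v w : R -> R) : L2 v -> L2 w -> L2 (v \- w)%R.
  move=> Lv Lw; have mv := L2_measurable Lv; have mw := L2_measurable Lw.
  apply: L2_of_sqr; first exact: measurable_funB.
  have k := rintegrableD (measurable_itv _)
    (rintegrableZ 2 (measurable_itv _) (L2_sqr Lv))
    (rintegrableZ 2 (measurable_itv _) (L2_sqr Lw)).
  apply: le_lt_trans (integrable_lty _ k) => //.
  apply: ge0_le_integral => //=.
  - by move=> x _; rewrite lee_fin sqr_ge0.
  - by apply/measurable_EFinP; apply: measurable_funX; exact: measurable_funB.
  - exact: (measurable_int _ k).
  - move=> x _; rewrite lee_fin /= -subr_ge0 [X in 0 <= X](_ : _ = (v x + w x) ^+ 2) ?sqr_ge0//.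
    by ring.
have Lgp := LB _ _ Lg (L2_continuous cdphi).
have h1 := integral_norm_le e0 Lgp N2.
pose w x := u x - phi x.
have cuI x : I01 x -> {for x, continuous u}.
  exact: (within_continuous_continuous ltr01 cu).
have gi := L2_integrable Lg.
have di := L2_integrable (L2_continuous cdphi).
have gpi := L2_integrable Lgp.
have wd x y : 0 < x -> x < y -> y < 1 -> `|w y - w x| <= e.
  move=> x0 xy y1; have sub : `[x, y] `<=` I01 by apply: subset_itv; rewrite bnd_simp.
  have E1 := weak_deriv_FTC cuI ug x0 xy y1.
  have E2 : \int[mu]_(t in `[x, y]) derive1 phi t = phi y - phi x.
    have c' : {within `[x, y], continuous (derive1 phi)} by exact: continuous_subspaceT.
    exact: (Rintegral_derive (ltW xy) (fun t _ => dphi t) c').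
  have gi' : mu.-integrable `[x, y] (EFin \o g) by apply: integrableS gi.
  have di' : mu.-integrable `[x, y] (EFin \o derive1 phi) by apply: integrableS di.
  have gp' : mu.-integrable `[x, y] (EFin \o (g \- derive1 phi)%R) by apply: integrableS gpi.
  rewrite (_ : w y - w x = \int[mu]_(t in `[x, y]) (g t - derive1 phi t)); last first.
    by rewrite RintegralB// E1 E2 /w; ring.
  apply: (le_trans (le_normr_Rintegral _ gp')) => //.
  apply: le_trans h1; apply: Rintegral_subset_le => //.
  exact: integrable_norm.
have cw : {within `[0, 1], continuous w}.
  move=> t; apply: cvgB; first exact: cu.
  exact: (continuous_subspaceT cphi).
have [x [x0 xh xw]] : exists x, [/\ 0 < x, x < 1 & `|w 0 - w x| < e].
  have /subspace_continuousP /(_ 0) := cw.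
  rewrite /= in_itv/= lexx ler01 => /(_ isT) /cvgrPdist_lt /(_ _ e0) [dl /= dl0 h].
  pose x := Num.min (dl / 2) 2^-1.
  have x0 : 0 < x by rewrite lt_min divr_gt0//= invr_gt0.
  have xd : x <= dl / 2 by rewrite ge_min lexx.
  have x2 : x <= 2^-1 by rewrite ge_min lexx orbT.
  have x1 : x < 1 by apply: le_lt_trans x2 _; rewrite invf_lt1// ltr1n.
  exists x; split => //; apply: h.
    by rewrite /= sub0r normrN gtr0_norm//; lra.
  by rewrite in_itv/= !ltW.
have w0 : `|w 0| = 4 * e by rewrite /w phi0 subr0 /e; field.
have wy y : I01 y -> 2 * e <= `|w y|.
  rewrite /= in_itv/= => /andP[y0 y1].
  have wxy : `|w x - w y| <= e.
    have [xy|yx|->] := ltgtP x y; last by rewrite subrr normr0 ltW.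
      by rewrite distrC; exact: wd.
    exact: wd.
  have := ler_normD (w 0 - w x) (w x - w y); rewrite subrKA => k1.
  have := lerB_normD (w 0) (- w y); rewrite normrN => k2.
  have k3 : `|w 0| - `|w y| <= `|w 0 - w y| by [].
  by move: k1 k3; rewrite w0; lra.
have h2 := Lnorm2_lt_integral e0 N1.
have : ((e ^+ 2)%:E <= \int[mu]_(x in I01) (w x ^+ 2)%:E)%E.
  have Lw : L2 w by exact: (LB _ _ Lu (L2_continuous cphi)).
  have i2 := integrable_cst (e ^+ 2) (measurable_itv _) mu_I01_lty.
  have <- : (\int[mu]_(x in I01) (e ^+ 2)%:E)%E = (e ^+ 2)%:E.
    have muI : mu I01 = 1%E.
      by rewrite lebesgue_measure_itv/= lte_fin ltr01 -EFinD subr0.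
    rewrite integral_cst// -[RHS]mule1; congr (_ * _)%E; exact: muI.
  apply: ge0_le_integral => //.
  - by move=> t _; rewrite lee_fin sqr_ge0.
  - exact: (measurable_int _ (L2_sqr Lw)).
  - move=> t It; rewrite lee_fin -[w t ^+ 2]real_normK ?num_real//.
    rewrite ler_sqr ?nnegrE ?(ltW e0)//.
    by have := wy _ It; lra.
by rewrite leNgt h2.
Qed.

End H10Boundary.

(** * Even extension about the midpoint *)

Section SymmetricExtension.
Context {R : realType}.
Implicit Types (f g u p : R -> R) (x : R).
Local Notation mu := (@lebesgue_measure R).
Local Notation I01 := (`]0, 1[%classic : set R).

Lemma is_derive_reflect f a x : is_derive (1 - x) 1 f a ->
  is_derive x 1 (fun y => f (1 - y)) (- a).
Proof.
move=> fa; have H := @dcomp _ f (fun y : R => 1 - y) x _ _ fa (dD (dcst 1 x) (dN (did x))).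
by nref (deq H _); ring.
Qed.

Lemma continuous_reflect f x : {for 1 - x, continuous f} ->
  {for x, continuous (fun y : R => f (1 - y))}.
Proof.
move=> fc; apply: (@continuous_comp _ _ _ (fun y : R => 1 - y) f) => //.
exact: (dcts (dD (dcst 1 x) (dN (did x)))).
Qed.

Lemma halves_derive_left f g a x : x < 2^-1 -> is_derive x 1 f a ->
  is_derive x 1 (halves f g) a.
Proof.
move=> xl; apply: dnear; near=> y; rewrite /halves ifT//; apply: ltW; near: y.
exact: lt_nbhsl.
Unshelve. all: by end_near.
Qed.

Lemma halves_derive_right f g a x : 2^-1 < x -> is_derive x 1 g a ->
  is_derive x 1 (halves f g) a.
Proof.
move=> xr; apply: dnear; near=> y; rewrite /halves leNgt ifF//.
apply/negbTE; rewrite negbK; near: y; exact: lt_nbhsr.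
Unshelve. all: by end_near.
Qed.

Lemma halves_is_derive f g df dg : f 2^-1 = g 2^-1 -> df 2^-1 = dg 2^-1 ->
  (forall x, x <= 2^-1 -> is_derive x 1 f (df x)) ->
  (forall x, 2^-1 <= x -> is_derive x 1 g (dg x)) ->
  forall x, is_derive x 1 (halves f g) (halves df dg x).
Proof.
move=> fg dfg hf hg x; rewrite [X in is_derive _ _ _ X]/halves.
have [xl|xr|->] := ltgtP x 2^-1.
- exact: halves_derive_left (hf _ (ltW xl)).
- exact: halves_derive_right (hg _ (ltW xr)).
- by apply: dglue => //; [exact: hf|rewrite dfg; exact: hg].
Qed.

Lemma halves_sym f x :
  halves f (fun y => f (1 - y)) (1 - x) = halves f (fun y => f (1 - y)) x.
Proof.
have half : 1 - 2^-1 = 2^-1 :> R by lra.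
rewrite /halves opprB addrCA subrr addr0.
by case: (ltgtP x 2^-1) => [xl|xr|->];
  rewrite ?half ?lexx//; [rewrite ifF//|rewrite ifT//];
  apply/negbTE || idtac; lra.
Qed.

Lemma left_derivative_unique f g c a b : (forall x, x <= c -> f x = g x) ->
  is_derive c 1 f a -> is_derive c 1 g b -> a = b.
Proof.
move=> fg fa gb; apply/eqP; rewrite -subr_eq0; apply/negPn/negP => ab.
pose w x := f x - g x.
have dw : is_derive c 1 w (a - b) by exact: (dD fa (dN gb)).
have w0 x : x <= c -> w x = 0 by move=> xc; rewrite /w fg// subrr.
have [dr dv] := dw.
have e0 : 0 < `|a - b| by rewrite normr_gt0.
move/cvgrPdist_lt: dr => /(_ _ e0).
rewrite /= -/(derive _ _ _) dv => -[d /= d0 H].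
have d2 : 0 < d / 2 by rewrite divr_gt0.
have d2' : d / 2 < d by lra.
have := H (- (d / 2)); rewrite /= sub0r opprK gtr0_norm// oppr_eq0 gt_eqF//.
move=> /(_ d2' isT).
rewrite [w (_ + c)]w0 ?[w c]w0//.
  by rewrite subrr scaler0 subr0 ltxx.
by rewrite /GRing.scale/=; lra.
Qed.

End SymmetricExtension.

(** * Elastica competitors *)

Section ElasticaCompetitor.
Context {R : realType}.
Implicit Types (psi u theta : R -> R) (h x M phi : R).
Local Notation mu := (@lebesgue_measure R).
Local Notation I01 := (`]0, 1[%classic : set R).

(** The left half of a competitor: [theta] is the angle of its tangent and [M]
    the factor by which the elastica is shrunk. *)
Definition half_elastica h phi M u theta : Prop :=
  [/\ (forall x, x <= 2^-1 -> is_derive x 1 u (tan (theta x))),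
      (forall x, x <= 2^-1 -> is_derive x 1 theta
         (- M * sqrtsin (phi - theta x) / cos (theta x))),
      (forall x, x <= 2^-1 -> 0 <= theta x <= phi),
      theta 2^-1 = 0 &
      u 2^-1 = h /\ forall x, x <= 0 -> u x = tan phi * x].

Lemma elastica_scale_gt0 h phi : 0 < h -> atan (2 * h) < phi -> phi < pi / 2 ->
  0 < elastica_scale h phi.
Proof.
move=> h0 hphi phi2; apply: divr_gt0; last exact: height_denom_gt0.
apply: J_gt0; rewrite (lt_trans _ hphi) ?atan_gt0 ?mulr_gt0//=.
by rewrite ltW// (lt_trans phi2)// pihalf_lt_pi.
Qed.

(** The width [elastica_x phi / M] of the arc is compared with [1 / 2]; the
    difference is the width of the segment in front of it. *)
Lemma elastica_scale_gap h phi : atan (2 * h) < phi -> phi < pi / 2 ->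
  elastica_scale h phi / 2 - elastica_x phi =
  (2 * h * elastica_x phi - elastica_y phi) * cos phi / (2 * (sin phi / 2 - h * cos phi)).
Proof.
move=> hphi phi2; have D0 := height_denom_gt0 hphi phi2.
have JE : J phi = elastica_x phi * sin phi - elastica_y phi * cos phi.
  rewrite /elastica_x /elastica_y.
  by rewrite -[LHS]mulr1 -(cos2Dsin2 phi); ring.
rewrite /elastica_scale {1}JE; field; apply: lt0r_neq0.
  by rewrite [X in 0 < X](_ : _ = 2 * (sin phi / 2 - h * cos phi)) ?mulr_gt0//; field.
Qed.

Lemma half_elastica_exists h phi : 0 < h -> atan (2 * h) < phi -> phi < pi / 2 ->
  elastica_y phi <= 2 * h * elastica_x phi ->
  exists u theta, half_elastica h phi (elastica_scale h phi) u theta /\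
    (elastica_y phi = 2 * h * elastica_x phi ->
     forall x, 0 < x -> x <= 2^-1 -> theta x < phi).
Proof.
move=> h0 hphi phi2 yx; have M0 := elastica_scale_gt0 h0 hphi phi2.
have D0 := height_denom_gt0 hphi phi2.
have phi0 : 0 < phi by apply: lt_trans hphi; rewrite atan_gt0 ?mulr_gt0.
have c0 : 0 < cos phi by apply: cos_gt0_pihalf; rewrite phi2 andbT; lra.
have HM := elastica_scale_gap hphi phi2.
have xM : elastica_x phi <= elastica_scale h phi / 2.
  rewrite -subr_ge0 HM; apply: divr_ge0; apply: mulr_ge0 => //; last exact: ltW.
    by rewrite subr_ge0.
  exact: ltW.
have [u [theta [du dt ti [t0 uh un crit]]]] := elastica_profile phi0 phi2 M0 xM.
exists u, theta; split.
  split => //; split => //; rewrite uh /elastica_scale /tan; field.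
  have J0 : 0 < J phi.
    by apply: J_gt0; rewrite phi0/= ltW// (lt_trans phi2)// pihalf_lt_pi.
  rewrite (gt_eqF J0) (gt_eqF c0) andbT/=; apply: lt0r_neq0.
  by rewrite [X in 0 < X](_ : _ = 2 * (sin phi / 2 - h * cos phi)) ?mulr_gt0//; field.
move=> yxE; apply: crit; apply/eqP; rewrite eq_sym -subr_eq0 HM yxE subrr.
by rewrite !mul0r.
Qed.

Definition half_bending phi M theta x : R :=
  - M * sqrtsin (phi - theta x) * (cos (theta x))^-1 ^+ 3.

Definition elastica_curve u : R -> R := halves u (fun x => u (1 - x)).
Definition elastica_slope theta : R -> R :=
  halves (fun x => tan (theta x)) (fun x => - tan (theta (1 - x))).
Definition elastica_bending phi M theta : R -> R :=
  halves (half_bending phi M theta) (fun x => half_bending phi M theta (1 - x)).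

Section Properties.
Context (h phi M : R) (u theta : R -> R).
Context (h0 : 0 < h) (phi0 : 0 < phi) (phi2 : phi < pi / 2) (M0 : 0 < M).
Context (ut : half_elastica h phi M u theta).

Let cos_theta x : x <= 2^-1 -> 0 < cos (theta x).
Proof.
have [_ _ ti _ _] := ut; move=> /ti /andP[t0 t1].
apply: cos_gt0_pihalf; have := pi_gt0 R.
by move: phi2 => ? ?; apply/andP; split; lra.
Qed.

Lemma is_derive_tan_theta x : x <= 2^-1 ->
  is_derive x 1 (fun x => tan (theta x)) (half_bending phi M theta x).
Proof.
move=> x2; have [_ dt _ _ _] := ut; have c0 := cos_theta x2.
have H := @dcomp _ (@tan R) theta x _ _ (is_derive_tan (lt0r_neq0 c0)) (dt _ x2).
by nref (deq H _); rewrite /half_bending; field; rewrite gt_eqF.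
Qed.

Let reflect_le x : 2^-1 <= x -> 1 - x <= 2^-1.
Proof. by lra. Qed.

Let half_reflect : 1 - 2^-1 = 2^-1 :> R.
Proof. by lra. Qed.

Lemma elastica_curve_derive x :
  is_derive x 1 (elastica_curve u) (elastica_slope theta x).
Proof.
have [du _ _ t0 _] := ut; apply: halves_is_derive => //.
- by rewrite half_reflect.
- by rewrite half_reflect t0 tan0 oppr0.
- by move=> y /reflect_le y2; nref (is_derive_reflect (du _ y2)).
Qed.

Lemma elastica_slope_derive x :
  is_derive x 1 (elastica_slope theta) (elastica_bending phi M theta x).
Proof.
have [du _ _ t0 _] := ut; apply: halves_is_derive => //.
- by rewrite half_reflect t0 tan0 oppr0.
- by rewrite half_reflect.
- exact: is_derive_tan_theta.
- move=> y /reflect_le y2.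
  nref (deq (dN (is_derive_reflect (is_derive_tan_theta y2))) _).
  by rewrite opprK.
Qed.

Let continuous_theta x : x <= 2^-1 -> {for x, continuous theta}.
Proof. by have [_ dt _ _ _] := ut => x2; exact: (dcts (dt _ x2)). Qed.

Lemma continuous_half_bending x : x <= 2^-1 ->
  {for x, continuous (half_bending phi M theta)}.
Proof.
move=> x2; have ct := continuous_theta x2; rewrite /half_bending.
have c1 : {for x, continuous (fun y => phi - theta y)} by apply: cvgB => //; exact: cvg_cst.
have c2 : {for x, continuous (fun y => sqrtsin (phi - theta y))}.
  exact: (@continuous_comp _ _ _ (fun y => phi - theta y) sqrtsin x c1 (@continuous_sqrtsin _ _)).
have c3 : {for x, continuous (fun y => (cos (theta y))^-1)}.
  apply: cvgV; first by rewrite gt_eqF ?cos_theta.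
  exact: (@continuous_comp _ _ _ theta (@cos R) x ct (@continuous_cos _ _)).
apply: cvgM; first by apply: cvgM => //; exact: cvg_cst.
exact: (@continuous_comp _ _ _ (fun y => (cos (theta y))^-1) (fun z => z ^+ 3) x c3 (@exprn_continuous _ 3 _)).
Qed.

Lemma continuous_elastica_bending : continuous (elastica_bending phi M theta).
Proof.
apply: continuous_halves; rewrite ?half_reflect//.
  exact: continuous_half_bending.
by move=> x /reflect_le x2; apply: continuous_reflect; exact: continuous_half_bending.
Qed.

Lemma elastica_curve_sym x : elastica_curve u (1 - x) = elastica_curve u x.
Proof. exact: halves_sym. Qed.

(** The slope decreases along the half, so the graph is above its chord. *)
Lemma elastica_curve_above x : 0 <= x <= 2^-1 -> 2 * h * x <= elastica_curve u x.
Proof.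
have [du _ _ t0 [uh un]] := ut; move=> /andP[x0 x2].
rewrite /elastica_curve /halves x2.
have u0 : u 0 = 0 by rewrite un// mulr0.
have [->|xn0] := eqVneq x 0; first by rewrite u0 mulr0.
have [->|xn2] := eqVneq x 2^-1; first by rewrite uh; lra.
have {}x0 : 0 < x by rewrite lt_neqAle eq_sym xn0.
have {}x2 : x < 2^-1 by rewrite lt_neqAle xn2.
rewrite leNgt; apply/negP => ux.
(* If the graph went below the chord, the slope would be smaller than [2 h] before
   [x] and larger after it. *)
have mvt (f df : R -> R) (a b : R) : a < b -> b <= 2^-1 ->
    (forall y : R, y <= 2^-1 -> is_derive y 1 f (df y)) ->
    exists2 c, a < c < b & f b - f a = df c * (b - a).
  move=> ab b2 fd; apply: MVT_is_derive => //.
    by move=> y /andP[_ yb]; apply: fd; exact: le_trans (ltW yb) b2.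
  apply: continuous_in_subspaceT => y; rewrite inE/= in_itv/= => /andP[_ yb].
  exact: (dcts (fd _ (le_trans yb b2))).
have [c1 /andP[c10 c1x] E1] := mvt _ _ _ _ x0 (ltW x2) du.
have [c2 /andP[c2x c22] E2] := mvt _ _ _ _ x2 (lexx _) du.
have c12 := lt_trans c1x c2x.
have [c3 /andP[_ c32] E3] := mvt _ _ _ _ c12 (ltW c22) is_derive_tan_theta.
have F0 : half_bending phi M theta c3 <= 0.
  rewrite /half_bending -mulrA mulNr oppr_le0 mulr_ge0 ?(ltW M0)//.
  rewrite mulr_ge0 ?sqrtr_ge0// exprn_ge0// invr_ge0 ltW// cos_theta//.
  exact: ltW (lt_trans c32 c22).
move: E1 E2 E3; rewrite u0 uh !subr0 => E1 E2 E3.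
have k1 : tan (theta c1) < 2 * h.
  by rewrite -(ltr_pM2r x0) -E1.
have k2 : 2 * h < tan (theta c2).
  have x2' : 0 < 2^-1 - x by rewrite subr_gt0.
  by rewrite -(ltr_pM2r x2') -E2; lra.
have : half_bending phi M theta c3 * (c2 - c1) <= 0.
  by rewrite mulr_le0_ge0// subr_ge0 ltW.
by rewrite -E3; lra.
Qed.

(** The obstacle is below the chord because it is negative at [0]. *)
Lemma elastica_curve_Msym psi : SC psi -> psi (1 / 2) = h ->
  Msym psi (elastica_curve u).
Proof.
move=> [psis psi0 psi2 psil] psih.
have [du _ _ t0 [uh un]] := ut.
have cp : continuous (elastica_slope theta).
  by move=> x; exact: (dcts (elastica_slope_derive x)).
have cu : continuous (elastica_curve u).
  by move=> x; exact: (dcts (elastica_curve_derive x)).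
have ab x : 0 <= x <= 1 -> exists y, [/\ 0 <= y <= 2^-1,
    elastica_curve u x = elastica_curve u y, psi x = psi y & (0 < x < 1 -> 0 < y)].
  move=> /andP[x0 x1]; have [xl|xr] := leP x 2^-1.
    by exists x; split => //; [rewrite x0 xl|case/andP].
  exists (1 - x); split; first by lra.
  - by rewrite elastica_curve_sym.
  - by rewrite psis// x0 x1.
  - by case/andP => _; rewrite subr_gt0.
split.
- exact: continuous_subspaceT.
- split; first exact: L2_continuous.
  exists (elastica_slope theta).
    by apply: C1_weak_deriv => //; exact: elastica_curve_derive.
  split; first exact: L2_continuous.
  exists (elastica_bending phi M theta).
    apply: C1_weak_deriv; first exact: elastica_slope_derive.
    exact: continuous_elastica_bending.
  exact: L2_continuous continuous_elastica_bending.
- apply: (H10_of_C1 elastica_curve_derive cp).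
  + move=> x; rewrite /= in_itv/= => xI; have /andP[x0 x1] := xI.
    have [|y [yI -> _ /(_ xI) y0]] := ab x; first by rewrite !ltW.
    apply: lt_le_trans (elastica_curve_above yI).
    by rewrite !mulr_gt0.
  + move=> x; rewrite /= in_itv/= => xI.
    have tp : 0 < tan phi.
      have := pi_gt0 R; move: phi0 phi2 => ? ? ?.
      by rewrite /tan divr_gt0 ?sin_gt0_pi ?cos_gt0_pihalf//; apply/andP; split; lra.
    have neg y : y <= 0 -> elastica_curve u y <= 0.
      move=> y0; rewrite /elastica_curve /halves (le_trans y0) ?invr_ge0//.
      by rewrite un// mulr_ge0_le0// ltW.
    have [x0|x0] := leP x 0; first exact: neg.
    have [x1|x1] := leP 1 x; last by case: xI; rewrite x0 x1.
    by rewrite -elastica_curve_sym; apply: neg; rewrite subr_le0.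
- move=> x xI; have [y [yI -> -> _]] := ab x xI.
  apply: le_trans (elastica_curve_above yI).
  case/andP: yI => y0 y2; rewrite psil; last by rewrite y0; lra.
  rewrite psih; have : (1 - 2 * y) * psi 0 <= 0.
    by rewrite mulr_ge0_le0//; [lra|exact: ltW].
  by lra.
- by move=> x _; rewrite elastica_curve_sym.
Qed.

(** Along the curve the energy density is [M ^ 2 (sin phi - P cos phi)], whose
    integral depends on the height only. *)
Lemma elastica_curve_energy :
  elastic_energy (elastica_curve u) = (2 * M ^+ 2 * (sin phi / 2 - h * cos phi))%:E.
Proof.
have [du _ ti t0 [uh un]] := ut.
have cp : continuous (elastica_slope theta).
  by move=> x; exact: (dcts (elastica_slope_derive x)).
have cu : continuous (elastica_curve u).
  by move=> x; exact: (dcts (elastica_curve_derive x)).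
have cf := continuous_elastica_bending.
have f2 : mu.-integrable I01 (EFin \o (fun x => elastica_bending phi M theta x ^+ 2)).
  exact: L2_sqr (L2_continuous cf).
rewrite (@elastic_energyE _ (elastica_curve u) (elastica_slope theta)
  (elastica_bending phi M theta)) => //; last 4 first.
- by move=> x _; exact: cu.
- by move=> x _; exact: cp.
- by apply: C1_weak_deriv => //; exact: elastica_curve_derive.
- by apply: C1_weak_deriv => //; exact: elastica_slope_derive.
pose d1 x := M ^+ 2 * (sin phi - tan (theta x) * cos phi).
pose d2 x := d1 (1 - x).
have dE x : x <= 2^-1 ->
    half_bending phi M theta x ^+ 2 * (speed (tan (theta x)))^-1 ^+ 5 = d1 x.
  move=> x2; have ct := cos_theta x2; have /andP[ti0 ti1] := ti _ x2.
  have -> : (speed (tan (theta x)))^-1 = cos (theta x).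
    rewrite -cos_atanE tanK// in_itv/=; have := pi_gt0 R.
    by move: phi2 => ? ?; apply/andP; split; lra.
  rewrite /half_bending /d1 !exprMn sqrrN sqr_sqrtsin; last first.
    have p2 : pi / 2 < pi :> R by exact: pihalf_lt_pi.
    move: phi2 => ?.
    by apply/andP; split; lra.
  by rewrite sinB /tan; field; rewrite gt_eqF.
have -> : (fun x => elastica_bending phi M theta x ^+ 2 *
    (speed (elastica_slope theta x))^-1 ^+ 5) = halves d1 d2.
  apply/funext => x; rewrite /elastica_bending /elastica_slope /halves /d2.
  have [x2|x2] := leP x 2^-1; first exact: dE.
  rewrite -(dE (1 - x)) ?reflect_le ?(ltW x2)// /speed sqrrN //.
have ctan x : x <= 2^-1 -> {for x, continuous d1}.
  move=> x2; apply: cvgM; first exact: cvg_cst.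
  apply: cvgB; first exact: cvg_cst.
  apply: cvgM; last exact: cvg_cst.
  exact: (dcts (is_derive_tan_theta x2)).
have c1 : {within `[0, 2^-1], continuous d1}.
  apply: continuous_in_subspaceT => y; rewrite inE/= in_itv/= => /andP[_ y2].
  exact: ctan.
have c2 : {within `[2^-1, 1], continuous d2}.
  apply: continuous_in_subspaceT => y; rewrite inE/= in_itv/= => /andP[y2 _].
  by apply: continuous_reflect; apply: ctan; exact: reflect_le.
have [_ ->] := halves_integral c1 c2; congr EFin.
have -> : \int[mu]_(x in `[0, 2^-1]) d1 x =
    M ^+ 2 * (sin phi * 2^-1 - u 2^-1 * cos phi) -
    M ^+ 2 * (sin phi * 0 - u 0 * cos phi).
  have l2 : 0 <= 2^-1 :> R by rewrite invr_ge0.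
  have D x : 0 <= x <= 2^-1 ->
      is_derive x 1 (fun x => M ^+ 2 * (sin phi * x - u x * cos phi)) (d1 x).
    move=> /andP[_ x2]; have dux := du _ x2.
    by compute_deriv; rewrite /d1; ring.
  exact: (Rintegral_derive l2 D c1).
have -> : \int[mu]_(x in `[2^-1, 1]) d2 x =
    M ^+ 2 * (sin phi * 1 + u (1 - 1) * cos phi) -
    M ^+ 2 * (sin phi * 2^-1 + u (1 - 2^-1) * cos phi).
  have l2 : 2^-1 <= 1 :> R by rewrite invf_le1// ler1n.
  have D x : 2^-1 <= x <= 1 ->
      is_derive x 1 (fun x => M ^+ 2 * (sin phi * x + u (1 - x) * cos phi)) (d2 x).
    move=> /andP[x2 _]; have dux := is_derive_reflect (du _ (reflect_le x2)).
    by compute_deriv; rewrite /d2 /d1; ring.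
  exact: (Rintegral_derive l2 D c2).
rewrite subrr half_reflect uh un// mulr0.
by field.
Qed.

End Properties.
End ElasticaCompetitor.

(** * Third derivative of the minimizer *)

Section ElasticaRegularity.
Context {R : realType}.
Implicit Types (u theta : R -> R) (h x t M phi : R).
Local Notation mu := (@lebesgue_measure R).
Local Notation I01 := (`]0, 1[%classic : set R).

(** The derivative of [half_bending] as a function of the angle: the square root
    in the curvature has disappeared. *)
Definition jerk_of_angle phi M t : R :=
  M ^+ 2 * (3 * (sin (phi - t) * (sin t * (cos t)^-1 ^+ 5))
            - 2^-1 * (cos (phi - t) * (cos t)^-1 ^+ 4)).

Definition djerk_of_angle phi M t : R :=
  M ^+ 2 * (3 * (sin (phi - t) * ((cos t)^-1 ^+ 4 + 5 * sin t ^+ 2 * (cos t)^-1 ^+ 6)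
                 - cos (phi - t) * (sin t * (cos t)^-1 ^+ 5))
            - 2^-1 * (sin (phi - t) * (cos t)^-1 ^+ 4
                      + 4 * (cos (phi - t) * (sin t * (cos t)^-1 ^+ 5)))).

Lemma is_derive_jerk_of_angle phi M t : 0 < cos t ->
  is_derive t 1 (jerk_of_angle phi M) (djerk_of_angle phi M t).
Proof.
move=> c0; have c1 : cos t != 0 by rewrite gt_eqF.
rewrite /jerk_of_angle; by compute_deriv; rewrite /djerk_of_angle /=; field.
Qed.

Lemma continuous_djerk_of_angle phi M t : 0 < cos t ->
  {for t, continuous (djerk_of_angle phi M)}.
Proof.
move=> c0; have c1 : cos t != 0 by rewrite gt_eqF.
rewrite /djerk_of_angle.
have H : exists a, is_derive t 1 (djerk_of_angle phi M) a.
  by eexists; rewrite /djerk_of_angle; derives.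
by case: H => a /dcts.
Qed.

Context (h phi M : R) (u theta : R -> R).
Context (phi0 : 0 < phi) (phi2 : phi < pi / 2) (M0 : 0 < M).
Context (ut : half_elastica h phi M u theta).
Context (theta_lt : forall x, 0 < x -> x <= 2^-1 -> theta x < phi).

Let theta' x := - M * sqrtsin (phi - theta x) / cos (theta x).
Let half_jerk x := jerk_of_angle phi M (theta x).
Let half_djerk x := djerk_of_angle phi M (theta x) * theta' x.
Let jerk := halves half_jerk (fun x => - half_jerk (1 - x)).

Let cos_theta x : x <= 2^-1 -> 0 < cos (theta x).
Proof.
have [_ _ ti _ _] := ut; move=> /ti /andP[t0 t1].
apply: cos_gt0_pihalf; have := pi_gt0 R.
by move: phi2 => ? ?; apply/andP; split; lra.
Qed.

Let dtheta x : x <= 2^-1 -> is_derive x 1 theta (theta' x).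
Proof. by have [_ dt _ _ _] := ut => x2; exact: dt. Qed.

Let half_reflect : 1 - 2^-1 = 2^-1 :> R.
Proof. by lra. Qed.

(** Without a segment in front, the inflection point, where the square root is
    not differentiable, is at [0] only. *)
Lemma is_derive_half_bending x : 0 < x -> x <= 2^-1 ->
  is_derive x 1 (half_bending phi M theta) (half_jerk x).
Proof.
move=> x0 x2; have c0 := cos_theta x2; have c1 := lt0r_neq0 c0.
have [_ _ ti _ _] := ut; have /andP[t0 _] := ti _ x2; have t1 := theta_lt x0 x2.
have s0 : 0 < phi - theta x < pi.
  have := pihalf_lt_pi (R := R); move: phi2 => ? ?.
  by apply/andP; split; lra.
have ss := sqrtsin_gt0 s0.
have sE : sqrtsin (phi - theta x) ^+ 2 = sin (phi - theta x).
  by apply: sqr_sqrtsin; have /andP[? ?] := s0; rewrite !ltW.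
have ds := @dcomp _ (@sqrtsin R) (fun x => phi - theta x) x _ _
  (is_derive_sqrtsin s0) (dD (dcst phi x) (dN (dtheta x2))).
have dt := dtheta x2.
rewrite /half_bending; compute_deriv.
rewrite /half_jerk /jerk_of_angle /theta' -sE; field.
by rewrite c1 gt_eqF.
Qed.

Lemma is_derive_half_jerk x : x <= 2^-1 ->
  is_derive x 1 half_jerk (half_djerk x).
Proof.
move=> x2; nref (@dcomp _ (jerk_of_angle phi M) theta x _ _ _ (dtheta x2)).
exact: is_derive_jerk_of_angle (cos_theta x2).
Qed.

Lemma continuous_half_djerk x : x <= 2^-1 -> {for x, continuous half_djerk}.
Proof.
move=> x2; have ct := dcts (dtheta x2).
have c1 : {for x, continuous (fun y => phi - theta y)} by apply: cvgB => //; exact: cvg_cst.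
have c2 : {for x, continuous (fun y => djerk_of_angle phi M (theta y))}.
  exact: (@continuous_comp _ _ _ theta (djerk_of_angle phi M) x ct
    (continuous_djerk_of_angle (cos_theta x2))).
have c3 : {for x, continuous (fun y => sqrtsin (phi - theta y))}.
  exact: (@continuous_comp _ _ _ (fun y => phi - theta y) sqrtsin x c1 (@continuous_sqrtsin _ _)).
have c4 : {for x, continuous (fun y => (cos (theta y))^-1)}.
  apply: cvgV; first by rewrite gt_eqF ?cos_theta.
  exact: (@continuous_comp _ _ _ theta (@cos R) x ct (@continuous_cos _ _)).
rewrite /half_djerk /theta'; apply: cvgM => //; apply: cvgM => //.
by apply: cvgM => //; exact: cvg_cst.
Qed.

Let left_within (f : R -> R) a : (forall x, x <= 2^-1 -> {for x, continuous f}) ->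
  {within `[a, 2^-1], continuous f}.
Proof.
move=> cf; apply: continuous_in_subspaceT => y; rewrite inE/= in_itv/= => /andP[_ y2].
exact: cf.
Qed.

Let right_within (f : R -> R) b : (forall x, x <= 2^-1 -> {for x, continuous f}) ->
  {within `[2^-1, b], continuous (fun x => - f (1 - x))}.
Proof.
move=> cf; apply: continuous_in_subspaceT => y; rewrite inE/= in_itv/= => /andP[y2 _].
by apply: cvgN; apply: continuous_reflect; apply: cf; lra.
Qed.

Let continuous_half_jerk x : x <= 2^-1 -> {for x, continuous half_jerk}.
Proof. by move=> x2; exact: (dcts (is_derive_half_jerk x2)). Qed.

Let bending_left x : 0 < x -> x < 2^-1 ->
  is_derive x 1 (elastica_bending phi M theta) (half_jerk x).
Proof.
by move=> x0 x2; exact: halves_derive_left (is_derive_half_bending x0 (ltW x2)).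
Qed.

Let bending_right x : 2^-1 < x -> x < 1 ->
  is_derive x 1 (elastica_bending phi M theta) (- half_jerk (1 - x)).
Proof.
move=> x2 x1; have y0 : 0 < 1 - x by lra.
have y2 : 1 - x <= 2^-1 by lra.
exact: halves_derive_right (is_derive_reflect (is_derive_half_bending y0 y2)).
Qed.

Lemma elastica_bending_weak_deriv : is_weak_deriv (elastica_bending phi M theta) jerk.
Proof.
apply: halves_weak_deriv.
- exact/continuous_subspaceT/(continuous_elastica_bending phi2 ut).
- exact: left_within.
- exact: right_within.
- by move=> x /andP[x0 x2]; exact: bending_left.
- by move=> x /andP[x0 x2]; exact: bending_right.
Qed.

Lemma jerk_BV : BV01 jerk.
Proof.
apply: (@halves_BV _ _ _ half_djerk (fun x => half_djerk (1 - x))).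
- exact: left_within.
- exact: right_within.
- exact: left_within continuous_half_djerk.
- apply: continuous_in_subspaceT => y; rewrite inE/= in_itv/= => /andP[y2 _].
  by apply: continuous_reflect; apply: continuous_half_djerk; lra.
- by move=> x /andP[_ x2]; exact: is_derive_half_jerk (ltW x2).
- move=> x /andP[x2 _]; have y2 : 1 - x <= 2^-1 by lra.
  nref (deq (dN (is_derive_reflect (is_derive_half_jerk y2))) _).
  by rewrite opprK.
Qed.

Lemma elastica_curve_third_BV :
  exists2 g, is_weak_derivn 3 (elastica_curve u) g & BV01 g.
Proof.
exists jerk; last exact: jerk_BV.
exists (elastica_slope theta).
  apply: C1_weak_deriv; first exact: (elastica_curve_derive ut).
  by move=> x; exact: (dcts (elastica_slope_derive phi2 ut x)).
exists (elastica_bending phi M theta).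
  apply: C1_weak_deriv; first exact: (elastica_slope_derive phi2 ut).
  exact: (continuous_elastica_bending phi2 ut).
exists jerk; first exact: elastica_bending_weak_deriv.
by apply: aeW.
Qed.

Lemma elastica_curve_C2 : Ck01 2 (elastica_curve u).
Proof.
have cf := continuous_elastica_bending phi2 ut.
split.
  by apply: continuous_subspaceT => x; exact: (dcts (elastica_curve_derive ut x)).
exists (elastica_slope theta); first by move=> x _; exact: (elastica_curve_derive ut).
split.
  by apply: continuous_subspaceT => x; exact: (dcts (elastica_slope_derive phi2 ut x)).
exists (elastica_bending phi M theta).
  by move=> x _; exact: (elastica_slope_derive phi2 ut).
by split => //; exact: continuous_subspaceT.
Qed.

(** The second derivative is even about the midpoint, so its derivative there
    would vanish; from the left it is [- M ^ 2 cos phi / 2]. *)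
Lemma elastica_curve_not_C3 : ~ Ck01 3 (elastica_curve u).
Proof.
move=> [_ [g1 d1 [_ [g2 d2 [_ [g3 d3 _]]]]]].
have E1 x : I01 x -> g1 x = elastica_slope theta x.
  by move=> /d1 H; exact: (duniq H (elastica_curve_derive ut x)).
have E2 x : I01 x -> g2 x = elastica_bending phi M theta x.
  move=> Ix; have H := d2 x Ix.
  apply: (duniq _ (elastica_slope_derive phi2 ut x)).
  nref (@dnear _ g1 _ _ _ _ H); near=> y; apply: E1.
  near: y; exact: (near_in_itvoo Ix).
have I2 : I01 (2^-1 : R) by rewrite /= in_itv/=; apply/andP; split; lra.
have D : is_derive (2^-1 : R) 1 (elastica_bending phi M theta) (g3 2^-1).
  nref (@dnear _ g2 _ _ _ _ (d3 _ I2)); near=> y; apply: E2.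
  near: y; exact: (near_in_itvoo I2).
have sym x : elastica_bending phi M theta (1 - x) = elastica_bending phi M theta x.
  exact: halves_sym.
have D' : is_derive (2^-1 : R) 1 (elastica_bending phi M theta) (- g3 2^-1).
  have : is_derive (1 - 2^-1 : R) 1 (elastica_bending phi M theta) (g3 2^-1).
    by rewrite half_reflect.
  by move=> /is_derive_reflect; exact: dext.
have g30 : g3 2^-1 = 0 by have := duniq D D'; lra.
have i0 : 0 < 2^-1 :> R by rewrite invr_gt0.
have : g3 2^-1 = half_jerk 2^-1.
  apply: (left_derivative_unique _ D (is_derive_half_bending i0 (lexx _))).
  by move=> x x2; rewrite /elastica_bending /halves x2.
have [_ _ _ t0 _] := ut.
rewrite g30 /half_jerk /jerk_of_angle t0 sin0 cos0 subr0 !invr1 !expr1n.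
have c0 : 0 < cos phi by apply: cos_gt0_pihalf; move: phi0 phi2 => ? ?; apply/andP; split; lra.
have : 0 < M ^+ 2 * cos phi by rewrite mulr_gt0// exprn_gt0.
by lra.
Unshelve. all: by end_near.
Qed.

End ElasticaRegularity.

(** * Lower bound, minimizers and uniqueness *)

Section MinimalEnergy.
Context {R : realType}.
Implicit Types (psi u v P f : R -> R) (a b h x M phi p : R).
Local Notation mu := (@lebesgue_measure R).
Local Notation I01 := (`]0, 1[%classic : set R).

Lemma primitive_opp a b P f : primitive_on a b P f ->
  primitive_on a b (fun x => - P x) (fun x => - f x).
Proof.
move=> [fi fP].
have E : (fun x => - f x) = (fun x => -1 * f x) by apply/funext => x; rewrite mulN1r.
have ri c d (i : mu.-integrable `[c, d] (EFin \o f)) :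
    \int[mu]_(t in `[c, d]) (- f t) = - \int[mu]_(t in `[c, d]) f t.
  have E1 : \int[mu]_(t in `[c, d]) (-1 * f t) = -1 * \int[mu]_(t in `[c, d]) f t.
    by exact: RintegralZl.
  by rewrite E E1 mulN1r.
split.
  by rewrite E; exact: (rintegrableZ (-1) (measurable_itv _) fi).
move=> x y ax xy yb; rewrite ri ?fP//; first by ring.
by apply: integrableS fi => //; apply: subset_itv; rewrite bnd_simp.
Qed.

Lemma symmetric_slope_half v P f : primitive_on 0 1 v P -> primitive_on 0 1 P f ->
  (forall x, 0 <= x <= 1 / 2 -> v x = v (1 - x)) -> P 2^-1 = 0.
Proof.
move=> vP Pf vs.
have h0 : 0 < 2^-1 :> R by rewrite invr_gt0.
have h1 : 2^-1 < 1 :> R by rewrite invf_lt1// ltr1n.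
have half : 1 - 2^-1 = 2^-1 :> R by lra.
have D := primitive_continuous_derive vP (primitive_itv Pf h0 h1) h0 h1.
have D' : is_derive (2^-1 : R) 1 v (- P 2^-1).
  have : is_derive (1 - 2^-1 : R) 1 v (P 2^-1) by rewrite half.
  move=> /is_derive_reflect H; nref (@dnear _ (fun y => v (1 - y)) _ _ _ _ H).
  near=> y.
  have y0 : 0 < y by near: y; exact: lt_nbhsr.
  have y1 : y < 1 by near: y; exact: lt_nbhsl.
  have [y2|y2] := leP y 2^-1; first by rewrite -vs// div1r y2 ltW.
  have yI : 0 <= 1 - y <= 1 / 2 by rewrite div1r; apply/andP; split; lra.
  by rewrite (vs _ yI) subKr.
by have := duniq D D'; lra.
Unshelve. all: by end_near.
Qed.

(** The right half is treated with slope [- P], which integrates to the height as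
    well. *)
Lemma Msym_energy psi v : 0 < psi (1 / 2) -> Msym psi v ->
  exists P f phi1 phi2, exists D1 D2 : R,
  [/\ [/\ primitive_on 0 1 v P, v 0 = 0, primitive_on 0 1 P f & P 2^-1 = 0],
      elastic_energy v = (D1 + D2)%:E,
      [/\ atan (2 * psi (1 / 2)) < phi1, phi1 < pi / 2,
          forall x, 0 <= x <= 2^-1 -> P x <= tan phi1,
          mu.-integrable `[0, 2^-1]
            (EFin \o deviation P f (elastica_scale (psi (1 / 2)) phi1) phi1) &
          elastica_energy (psi (1 / 2)) phi1 + 2^-1 * \int[mu]_(x in `[0, 2^-1])
            deviation P f (elastica_scale (psi (1 / 2)) phi1) phi1 x
          <= D1] &
      [/\ atan (2 * psi (1 / 2)) < phi2, phi2 < pi / 2 &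
          elastica_energy (psi (1 / 2)) phi2 <= D2]].
Proof.
set h := psi (1 / 2) => hpos [cv Hv H10v vpsi vs].
have [P [f [vP Pf f2 EE]]] := H2_repr cv Hv.
have v0 := H10_boundary cv H10v.
have v1 : v 1 = 0 by have := vs 0; rewrite subr0 v0 => <- //; rewrite lexx div1r invr_ge0 ler0n.
have P2 := symmetric_slope_half vP Pf vs.
have h0 : 0 <= 2^-1 :> R by rewrite invr_ge0.
have h1 : 2^-1 <= 1 :> R by rewrite invf_le1// ler1n.
have vh : h <= v 2^-1.
  by rewrite /h div1r; apply: vpsi; rewrite h0 h1.
have mP : measurable_fun (`[0, 1]%classic : set R) P.
  exact: within_measurable (primitive_within ler01 Pf).
have di := integrable_energy_density (measurable_itv _) mP f2.
have fl : mu.-integrable `[0, 2^-1] (EFin \o (fun x => f x ^+ 2)).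
  by apply: integrableS f2 => //; apply: subset_itv; rewrite bnd_simp.
have fr : mu.-integrable `[2^-1, 1] (EFin \o (fun x => (- f x) ^+ 2)).
  under [X in EFin \o X]eq_fun do rewrite sqrrN.
  by apply: integrableS f2 => //; apply: subset_itv; rewrite bnd_simp.
have L1 : h <= \int[mu]_(x in `[0, 2^-1]) P x by rewrite vP.2// v0 subr0.
have hl : 2^-1 = 0 + 2^-1 :> R by rewrite add0r.
have [phi1 [a1 b1 t1 i1 e1]] := half_energy hl hpos (or_introl (conj erefl erefl))
  (primitive_on_sub (lexx _) h1 Pf) fl P2 L1.
have L2 : h <= \int[mu]_(x in `[2^-1, 1]) (- P x).
  by rewrite (primitive_opp vP).2// v1 oppr0 sub0r opprK.
have hr : 1 = 2^-1 + 2^-1 :> R by lra.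
have P2' : - P 2^-1 = 0 by rewrite P2 oppr0.
have [phi2 [a2 b2 t2 i2 e2]] := half_energy hr hpos (or_intror (conj erefl erefl))
  (primitive_on_sub h0 (lexx _) (primitive_opp Pf)) fr P2' L2.
exists P, f, phi1, phi2,
  (\int[mu]_(x in `[0, 2^-1]) (f x ^+ 2 * (speed (P x))^-1 ^+ 5)),
  (\int[mu]_(x in `[2^-1, 1]) ((- f x) ^+ 2 * (speed (- P x))^-1 ^+ 5)).
split.
- by [].
- rewrite EE (Rintegral_chasles h0 h1 di); congr (_ + _)%:E.
  apply: eq_Rintegral => x _; rewrite sqrrN; congr (_ * _^-1 ^+ _).
  by rewrite /speed sqrrN.
- by rewrite mul1r in i1 e1.
- split => //; apply: le_trans e2; rewrite lerDl mulr_ge0 ?invr_ge0//.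
  exact: integral_deviation_ge0.
Qed.

(** The critical angle is the only minimum point of [elastica_energy], so a
    minimizer leaves no room for the square in [Msym_energy]. *)
Lemma minimizer_slope psi v phi : 0 < psi (1 / 2) ->
  atan (2 * psi (1 / 2)) < phi -> phi < pi / 2 ->
  elastica_y phi = 2 * psi (1 / 2) * elastica_x phi -> Msym psi v ->
  ((2 * elastica_energy (psi (1 / 2)) phi)%:E <= elastic_energy v)%E /\
  ((elastic_energy v <= (2 * elastica_energy (psi (1 / 2)) phi)%:E)%E ->
   exists P, [/\ primitive_on 0 1 v P, v 0 = 0 &
     forall x, 0 <= x <= 2^-1 -> 0 <= phi - atan (P x) <= phi /\
       elastica_time phi (phi - atan (P x)) = 2 * elastica_x phi * x]).
Proof.
set h := psi (1 / 2) => h0 hphi phi2 crit vM.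
have [P [f [phi1 [phi2' [D1 [D2 [[vP v0 Pf P2] ED [a1 b1 t1 i1 e1] [a2 b2 e2]]]]]]]] :=
  Msym_energy h0 vM.
rewrite -/h in a1 i1 e1 a2 e2.
have phi0 : 0 < phi by apply: lt_trans hphi; rewrite atan_gt0 ?mulr_gt0.
have Emin p : atan (2 * h) < p -> p < pi / 2 -> p != phi ->
    elastica_energy h phi < elastica_energy h p.
  move=> hp p2; have [pp _|pp _|->] := ltgtP p phi; last by [].
    by apply: elastica_energy_decr; rewrite ?crit.
  by apply: elastica_energy_incr; rewrite ?crit.
have Emin' p : atan (2 * h) < p -> p < pi / 2 ->
    elastica_energy h phi <= elastica_energy h p.
  move=> hp p2; have [->//|pp] := eqVneq p phi; apply: ltW; exact: Emin.
have W0 := integral_deviation_ge0 `[0, 2^-1] P f (elastica_scale h phi1) phi1.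
rewrite ED !lee_fin.
have E1 := Emin' _ a1 b1; have E2 := Emin' _ a2 b2.
split; first by move: W0 e1; set W := \int[mu]_(x in _) _; lra.
move=> EE; have phiE : phi1 = phi.
  apply/eqP; apply/negPn/negP => /(Emin _ a1 b1) E1'.
  by move: W0 e1; set W := \int[mu]_(x in _) _; lra.
rewrite {}phiE in t1 i1 e1 W0 E1.
have W : \int[mu]_(x in `[0, 2^-1]) deviation P f (elastica_scale h phi) phi x <= 0.
  by move: W0 e1; set W := \int[mu]_(x in _) _; lra.
have i0 : 0 <= 2^-1 :> R by rewrite invr_ge0.
have i2 : 2^-1 <= 1 :> R by rewrite invf_le1// ler1n.
have prim := half_energy_eq i0 (primitive_on_sub (lexx _) i2 Pf) i1 W.
have ME : elastica_scale h phi * 2^-1 = elastica_x phi.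
  apply/eqP; rewrite -subr_eq0 (elastica_scale_gap hphi phi2) crit subrr.
  by rewrite !mul0r.
have M0 := elastica_scale_gt0 h0 hphi phi2.
exists P; split => // x xI.
have := elastica_time_slope phi0 phi2 M0 ME prim P2 t1 xI.
by rewrite -ME (_ : 2 * (_ * 2^-1) = elastica_scale h phi)//; field.
Qed.

(** The slopes of two minimizers satisfy the same equation
    [elastica_time phi (phi - atan P) = 2 elastica_x phi x], whose left-hand side
    is injective in [P]. *)
Lemma minimizer_unique psi v1 v2 phi x : 0 < psi (1 / 2) ->
  atan (2 * psi (1 / 2)) < phi -> phi < pi / 2 ->
  elastica_y phi = 2 * psi (1 / 2) * elastica_x phi ->
  Msym psi v1 -> Msym psi v2 ->
  (elastic_energy v1 <= (2 * elastica_energy (psi (1 / 2)) phi)%:E)%E ->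
  (elastic_energy v2 <= (2 * elastica_energy (psi (1 / 2)) phi)%:E)%E ->
  0 <= x <= 1 -> v1 x = v2 x.
Proof.
move=> h0 hphi phi2 crit m1 m2 e1 e2 xI.
have phi0 : 0 < phi by apply: lt_trans hphi; rewrite atan_gt0 ?mulr_gt0.
have [_ /(_ e1) [P1 [vP1 v10 T1]]] := minimizer_slope h0 hphi phi2 crit m1.
have [_ /(_ e2) [P2 [vP2 v20 T2]]] := minimizer_slope h0 hphi phi2 crit m2.
have PE t : 0 <= t <= 2^-1 -> P1 t = P2 t.
  move=> tI; have [/andP[r10 r11] s1] := T1 t tI; have [/andP[r20 r21] s2] := T2 t tI.
  have [H|H|/addrI/oppr_inj H] := ltgtP (phi - atan (P1 t)) (phi - atan (P2 t)).
  - by have := elastica_time_incr phi0 phi2 r10 H r21; rewrite s1 s2 ltxx.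
  - by have := elastica_time_incr phi0 phi2 r20 H r11; rewrite s1 s2 ltxx.
  - by rewrite -[LHS]atanK H atanK.
have i2 : 2^-1 <= 1 :> R by rewrite invf_le1// ler1n.
have vE t : 0 <= t <= 2^-1 -> v1 t = v2 t.
  move=> /andP[t0 t2]; have t1 := le_trans t2 i2.
  have := vP1.2 0 t (lexx _) t0 t1; have := vP2.2 0 t (lexx _) t0 t1.
  rewrite v10 v20 !subr0 => <- <-; apply: eq_Rintegral => y.
  rewrite inE/= in_itv/= => /andP[y0 yt]; apply: PE.
  by rewrite y0 (le_trans yt).
have [x2|x2] := leP x 2^-1; first by apply: vE; case/andP: xI => ->.
have yI : 0 <= 1 - x <= 2^-1 by lra.
have yI' : 0 <= 1 - x <= 1 / 2 by rewrite div1r.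
have [_ _ _ _ s1] := m1; have [_ _ _ _ s2] := m2.
have := s1 _ yI'; have := s2 _ yI'; rewrite subKr => <- <-; exact: vE.
Qed.

Lemma elastica_competitor psi phi : SC psi ->
  atan (2 * psi (1 / 2)) < phi -> phi < pi / 2 ->
  elastica_y phi <= 2 * psi (1 / 2) * elastica_x phi ->
  exists u, [/\ Msym psi u,
    elastic_energy u = (2 * elastica_energy (psi (1 / 2)) phi)%:E &
    elastica_y phi = 2 * psi (1 / 2) * elastica_x phi ->
    [/\ Ck01 2 u, (exists2 g, is_weak_derivn 3 u g & BV01 g) & ~ Ck01 3 u]].
Proof.
move=> psiSC; have [_ _ h0 _] := psiSC; move=> hphi phi2 yx.
have phi0 : 0 < phi by apply: lt_trans hphi; rewrite atan_gt0 ?mulr_gt0.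
have D0 := height_denom_gt0 hphi phi2.
have M0 := elastica_scale_gt0 h0 hphi phi2.
have [u [theta [ut crit]]] := half_elastica_exists h0 hphi phi2 yx.
exists (elastica_curve u); split.
- exact: (elastica_curve_Msym h0 phi0 phi2 M0 ut psiSC).
- rewrite (elastica_curve_energy phi2 ut) /elastica_scale /elastica_energy.
  have simp (j d : R) : 0 < d -> 2 * (j / d) ^+ 2 * d = 2 * (j ^+ 2 / d).
    by move=> d0; field; rewrite gt_eqF.
  by congr EFin; exact: simp.
- move=> /crit tl; split.
  + exact: (elastica_curve_C2 phi2 ut).
  + exact: (elastica_curve_third_BV phi2 ut tl).
  + exact: (elastica_curve_not_C3 phi0 phi2 M0 ut tl).
Qed.

End MinimalEnergy.

(** * Existence, uniqueness and nonexistence *)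

Theorem theorem1p2 (R : realType) (psi : R -> R) (psiSC : SC psi) :
  (psi (1 / 2) < c_star R ->
     exists u : R -> R,
       [/\ is_solution psi u,
           (forall v, is_solution psi v -> forall x : R, 0 <= x <= 1 -> v x = u x),
           Ck01 2 u,
           (exists2 g, is_weak_derivn 3 u g & BV01 g) &
           ~ Ck01 3 u])
  /\ (c_star R <= psi (1 / 2) -> ~ exists u : R -> R, is_solution psi u).
Proof.
have [_ _ h0 _] := psiSC; rewrite c_starE; split => [hc|hc].
  have hI : 0 < psi (1 / 2) < (J (pi / 2))^-1 by rewrite h0.
  have [phi [hphi phi2 crit]] := critical_angle hI.
  have [|u [uM uE /(_ crit) [u2 u3 n3]]] := elastica_competitor psiSC hphi phi2.
    by rewrite crit.
  have usol : elastic_energy u = ereal_inf [set elastic_energy v | v in Msym psi].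
    apply/eqP; rewrite eq_le; apply/andP; split.
      apply: le_ereal_inf_tmp => _ [v vM <-]; rewrite uE.
      by have [] := minimizer_slope h0 hphi phi2 crit vM.
    by apply: ereal_inf_lbound; exists u.
  exists u; split => // v [vM vE] x.
  apply: (minimizer_unique h0 hphi phi2 crit vM uM); last by rewrite uE.
  by rewrite vE -usol uE.
move=> [v [vM vE]].
have [P [f [phi1 [phi2 [D1 [D2 [_ ED [a1 b1 _ _ e1] [a2 b2 e2]]]]]]]] :=
  Msym_energy h0 vM.
(* Any angle beyond both [phi1] and [phi2] gives a competitor of smaller energy. *)
pose m := Num.max phi1 phi2; pose phi := (m + pi / 2) / 2.
have m2 : m < pi / 2 by rewrite gt_max b1 b2.
have mphi : m < phi by rewrite /phi; lra.
have phi2' : phi < pi / 2 by rewrite /phi; lra.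
have p1 : phi1 < phi by apply: le_lt_trans mphi; rewrite le_max lexx.
have p2 : phi2 < phi by apply: le_lt_trans mphi; rewrite le_max lexx orbT.
have hphi := lt_trans a1 p1.
have phi0 : 0 < phi by apply: lt_trans hphi; rewrite atan_gt0 ?mulr_gt0.
have yx := ltW (elastica_slope_lt hc phi0 phi2').
have [u [uM uE _]] := elastica_competitor psiSC hphi phi2' yx.
have E1 := elastica_energy_decr h0 a1 p1 phi2' yx.
have E2 := elastica_energy_decr h0 a2 p2 phi2' yx.
have : (elastic_energy v <= elastic_energy u)%E.
  by rewrite vE; apply: ereal_inf_lbound; exists u.
rewrite ED uE lee_fin leNgt => /negP; apply.
have W0 :=
  integral_deviation_ge0 `[0, 2^-1] P f (elastica_scale (psi (1 / 2)) phi1) phi1.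
by move: W0 e1; set W := \int[_]_(x in _) _; lra.
Qed.
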